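(* Let $n\ge 2$ and let $u$ be a positive solution of $4\Delta_b u=n^2u^{\frac{n+2}{n}}$ in $\mathbb{H}^n$. Assume that there exist constants $C>0$ and $q\in\left(\frac{2n+1}{n},\frac{2n+2}{n}\right]$ such that $$\int_{B_R(0)}u^{q}\le CR^2\qquad\forall R>1.$$ Then there exist $\mu\in\mathbb{C}^n$ and $\lambda\in\mathbb{C}$ with $|\mu|^2<4\operatorname{Im}\lambda$ such that $$u(z,t)=\frac{\left(4\operatorname{Im}\lambda-|\mu|^2\right)^{n/2}}{\left|t+\sqrt{-1}\,|z|^2+\langle\mu,z\rangle+\lambda\right|^n}\qquad\forall (z,t)\in\mathbb{H}^n.$$
   Context: $\mathbb{H}^n=\mathbb{C}^n\times\mathbb{R}$ is the Heisenberg group, with points $(z,t)$, $z=(z_1,\dots,z_n)$. For a smooth function $u$ on $\mathbb{H}^n$ and $\alpha\in\{1,\dots,n\}$, put $Z_\alpha u=\partial_{z_\alpha}u+\sqrt{-1}\,\overline{z_\alpha}\,\partial_t u$ and $Z_{\overline\alpha}u=\partial_{\overline{z_\alpha}}u-\sqrt{-1}\,z_\alpha\,\partial_t u$, where $\partial_{z_\alpha}=\frac12(\partial_{x_\alpha}-\sqrt{-1}\,\partial_{y_\alpha})$ and $\partial_{\overline{z_\alpha}}=\frac12(\partial_{x_\alpha}+\sqrt{-1}\,\partial_{y_\alpha})$ for $z_\alpha=x_\alpha+\sqrt{-1}\,y_\alpha$. The sub-Laplacian is $\Delta_b u=-\operatorname{Re}\sum_{\alpha=1}^n Z_{\overline\alpha}(Z_\alpha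 u)$. Solutions are understood to be smooth (classical) real-valued functions on all of $\mathbb{H}^n$. $B_R(0)=\{(z,t)\in\mathbb{H}^n:\ (|z|^4+t^2)^{1/4}<R\}$ is the Korányi ball, and integrals are with respect to Lebesgue (Haar) measure on $\mathbb{C}^n\times\mathbb{R}$. Here $|z|^2=\sum_\alpha|z_\alpha|^2$, and $\langle\mu,z\rangle=\sum_{\alpha=1}^n\mu_\alpha z_\alpha$ (complex-linear in $z$). *)

(* Defs.v *)
From HB Require Import structures.
From mathcomp Require Import all_boot all_order all_algebra.
From mathcomp Require Import all_classical all_reals all_analysis.
From mathcomp Require Import complex.
Set Implicit Arguments.
Unset Strict Implicit.
Unset Printing Implicit Defensive.
Import Order.TTheory GRing.Theory Num.Theory.
Import numFieldNormedType.Exports.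
Local Open Scope classical_set_scope.
Local Open Scope ring_scope.
Local Open Scope complex_scope.

Section measurable_rV.
Context (R : realType) (n : nat).

Let coord (i : 'I_n) (v : 'rV[R]_n) : R := v 0 i.

Let rV_set0 : g_sigma_preimage coord set0.
Proof. exact: sigma_algebra0. Qed.

Let rV_setC A : g_sigma_preimage coord A -> g_sigma_preimage coord (~` A).
Proof. exact: sigma_algebraC. Qed.

Let rV_bigcup (F : (set 'rV[R]_n)^nat) :
  (forall i, g_sigma_preimage coord (F i)) ->
  g_sigma_preimage coord (\bigcup_i (F i)).
Proof. exact: sigma_algebra_bigcup. Qed.

(* This product sigma-algebra is the Borel one. *)
HB.instance Definition _ := @isMeasurable.Build default_measure_display
  'rV[R]_n (g_sigma_preimage coord) rV_set0 rV_setC rV_bigcup.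

Lemma measurable_rV_coord (i : 'I_n) :
  measurable_fun [set: 'rV[R]_n] (fun v : 'rV[R]_n => v 0 i).
Proof.
move=> _ Y mY; rewrite setTI; apply: sub_sigma_algebra => /=.
rewrite -bigcup_seq/=; exists i => /=; first by rewrite mem_index_enum.
by exists Y => //; rewrite setTI.
Qed.

Lemma measurable_fun_rV d (T : measurableType d) (f : T -> 'rV[R]_n) :
  (forall i, measurable_fun [set: T] (fun x => f x 0 i)) ->
  measurable_fun [set: T] f.
Proof.
move=> mf _ A mA; rewrite setTI.
have : g_sigma_preimage (fun i => coord i \o f) `<=` measurable.
  apply: smallest_sub; first exact: sigma_algebra_measurable.
  rewrite -bigcup_seq/=; apply: bigcup_sub => i _ B [C mC <-]; exact: mf.
by apply; rewrite g_sigma_preimage_comp; exists A => //; rewrite setTI.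
Qed.

End measurable_rV.

(* The library's sigma-finite instance for \x is shadowed by the one for      *)
(* products of subprobabilities.                                             *)
Lemma product_measure_sigma_finite d1 d2 (T1 : measurableType d1)
    (T2 : measurableType d2) (R : realType)
    (m1 : {sigma_finite_measure set T1 -> \bar R})
    (m2 : {sigma_finite_measure set T2 -> \bar R}) :
  sigma_finite setT (m1 \x m2)%E.
Proof.
have /sigma_finiteP[F [TF ndF Foo]] := sigma_finiteT m1.
have /sigma_finiteP[G [TG ndG Goo]] := sigma_finiteT m2.
exists (fun k => F k `*` G k).
  rewrite -setXTT TF TG; apply/seteqP; split=> -[x y]/=; last first.
    by move=> [k _ []/= ? ?]; split; exists k.
  move=> [[k _ Fx] [l _ Gy]]; exists (maxn k l) => //; split => /=.
  - by move: x Fx; exact/subsetPset/ndF/leq_maxl.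
  - by move: y Gy; exact/subsetPset/ndG/leq_maxr.
move=> k; have [? ?] := Foo k; have [? ?] := Goo k.
split; first exact: measurableX.
by rewrite product_measure1E// lte_mul_pinfty// ge0_fin_numE.
Qed.

Section lebesgue_rV.
Context (R : realType).

Definition rV_cons n (p : R * 'rV[R]_n) : 'rV[R]_n.+1 :=
  \row_i oapp (p.2 0) p.1 (unlift ord0 i).

Definition rV_uncons n (v : 'rV[R]_n.+1) : R * 'rV[R]_n :=
  (v 0 ord0, \row_j v 0 (lift ord0 j)).

Lemma rV_cons0 n (p : R * 'rV[R]_n) : rV_cons p 0 ord0 = p.1.
Proof. by rewrite mxE unlift_none. Qed.

Lemma rV_consS n (p : R * 'rV[R]_n) i : rV_cons p 0 (lift ord0 i) = p.2 0 i.
Proof. by rewrite mxE liftK. Qed.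

Lemma rV_consK n : cancel (@rV_cons n) (@rV_uncons n).
Proof.
move=> [x v]; rewrite /rV_uncons rV_cons0; congr pair.
by apply/rowP => i; rewrite mxE rV_consS.
Qed.

Lemma measurable_rV_cons n : measurable_fun setT (@rV_cons n).
Proof.
apply: measurable_fun_rV => i; case: (unliftP ord0 i) => [j|] ->.
  under eq_fun do rewrite rV_consS.
  by apply: (measurableT_comp (measurable_rV_coord j)); exact: measurable_snd.
under eq_fun do rewrite rV_cons0.
exact: measurable_fst.
Qed.

Lemma measurable_rV_uncons n : measurable_fun setT (@rV_uncons n).
Proof.
apply/measurable_fun_pair; first exact: measurable_rV_coord.
apply: measurable_fun_rV => i.
under eq_fun do rewrite mxE.
exact: measurable_rV_coord.
Qed.

Section step.
Context (n : nat) (m : {sigma_finite_measure set 'rV[R]_n -> \bar R}).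

Definition lebesgue_rV_step : set 'rV[R]_n.+1 -> \bar R :=
  pushforward (@lebesgue_measure R \x m)%E (@rV_cons n).

HB.instance Definition _ := Measure.copy lebesgue_rV_step
  (measure_function_pushforward__canonical__measure_function_Measure
     (@lebesgue_measure R \x m)%E (@measurable_rV_cons n)).

Let sigma_finite_step : sigma_finite setT lebesgue_rV_step.
Proof.
have [F TF Foo] : sigma_finite setT (@lebesgue_measure R \x m)%E.
  exact: product_measure_sigma_finite.
exists (fun k => @rV_uncons n @^-1` F k).
  by rewrite -preimage_bigcup -TF preimage_setT.
move=> k; have [mF Fk] := Foo k; split.
  by rewrite -[X in measurable X]setTI; exact: measurable_rV_uncons.
rewrite /lebesgue_rV_step /pushforward -comp_preimage.
by rewrite (_ : _ \o _ = id) //; apply/funext => p /=; exact: rV_consK.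
Qed.

HB.instance Definition _ := Measure_isSigmaFinite.Build _ _ _
  lebesgue_rV_step sigma_finite_step.

End step.

(* Lebesgue measure on R^n: the iterated product of one-dimensional ones, *)
(* transported along R * 'rV_n -> 'rV_n.+1; on R^0 it is the unit mass.     *)
Fixpoint lebesgue_rV n : {sigma_finite_measure set 'rV[R]_n -> \bar R} :=
  match n with
  | 0 => \d_(0 : 'rV[R]_0)
  | k.+1 => lebesgue_rV_step (lebesgue_rV k)
  end.

Lemma lebesgue_rV_box n (A : 'I_n -> set R) :
  (forall i, measurable (A i)) ->
  lebesgue_rV n [set v | forall i, A i (v 0 i)] =
  (\prod_(i < n) lebesgue_measure (A i))%E.
Proof.
elim: n A => [|n IH] A mA /=.
  rewrite big_ord0 diracE mem_set//; by case.
have mB : measurable [set v : 'rV[R]_n | forall i, A (lift ord0 i) (v 0 i)].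
  have -> : [set v : 'rV[R]_n | forall i, A (lift ord0 i) (v 0 i)] =
      \bigcap_(i in [set: 'I_n])
        ((fun v : 'rV[R]_n => v 0 i) @^-1` A (lift ord0 i)).
    by apply/seteqP; split => v /= Av i; [move=> _; exact: Av | exact: Av].
  apply: fin_bigcap_measurable => // i _.
  by rewrite -[X in measurable X]setTI; exact: measurable_rV_coord.
rewrite big_ord_recl -IH; last by move=> i; exact: mA.
rewrite -product_measure1E//; last exact: mA.
rewrite /lebesgue_rV_step /pushforward; congr (product_measure1 _ _ _).
apply/seteqP; split => -[x v] /=.
  move=> Av; split; first by have := Av ord0; rewrite rV_cons0.
  by move=> i; have := Av (lift ord0 i); rewrite rV_consS.
move=> [Ax Av] i; case: (unliftP ord0 i) => [j|] ->; last by rewrite rV_cons0.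
by rewrite rV_consS; exact: Av.
Qed.

End lebesgue_rV.

(* The point ((x, y), t) stands for (z, t) with z = x + i y; the real         *)
(* coordinates give the space its real normed module structure.              *)
Notation heis R n := ('rV[R]_n * 'rV[R]_n * R)%type.

Definition modc (R : realType) (w : R[i]) : R := ComplexField.Normc.normc w.

Definition norm2 (R : realType) n (w : 'rV[R[i]]_n) : R :=
  \sum_(a < n) modc (w 0 a) ^+ 2.

Definition bilin (R : realType) n (w z : 'rV[R[i]]_n) : R[i] :=
  \sum_(a < n) w 0 a * z 0 a.

Fixpoint Ck (R : realType) (V W : normedModType R) (k : nat) (f : V -> W) :
    Prop :=
  match k with
  | 0 => continuous f
  | k'.+1 => (forall p, differentiable f p) /\
             (forall v, Ck k' (fun p => 'D_v f p))
  end.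

Definition smooth (R : realType) (V W : normedModType R) (f : V -> W) : Prop :=
  forall k, Ck k f.

Section heisenberg.
Context (R : realType) (n : nat).
Implicit Types (p : heis R n) (a : 'I_n) (F : heis R n -> R[i])
  (u : heis R n -> R).

Definition zcoord p : 'rV[R[i]]_n := \row_a (p.1.1 0 a +i* p.1.2 0 a).

Definition tcoord p : R := p.2.

Definition vx a : heis R n := (delta_mx 0 a, 0, 0).

Definition vy a : heis R n := (0, delta_mx 0 a, 0).

Definition vt : heis R n := (0, 0, 1).

(* R[i] is not a normed module over R: derive the real and imaginary parts. *)
Definition derivec (v : heis R n) F p : R[i] :=
  'D_v (fun q => complex.Re (F q)) p +i* 'D_v (fun q => complex.Im (F q)) p.

Definition dz a F p : R[i] :=
  2^-1 * (derivec (vx a) F p - 'i%C * derivec (vy a) F p).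

Definition dzbar a F p : R[i] :=
  2^-1 * (derivec (vx a) F p + 'i%C * derivec (vy a) F p).

Definition ZH a F p : R[i] :=
  dz a F p + 'i%C * conjc (zcoord p 0 a) * derivec vt F p.

Definition ZbarH a F p : R[i] :=
  dzbar a F p - 'i%C * zcoord p 0 a * derivec vt F p.

Definition sublaplacian u p : R :=
  - complex.Re (\sum_(a < n) ZbarH a (ZH a (fun q => (u q)%:C)) p).

Definition koranyi p : R :=
  (norm2 (zcoord p) ^+ 2 + tcoord p ^+ 2) `^ 4^-1.

Definition koranyi_ball (r : R) : set (heis R n) := [set p | koranyi p < r].

Definition heis_measure :=
  ((lebesgue_rV R n \x lebesgue_rV R n) \x @lebesgue_measure R)%E.

HB.instance Definition _ := Measure.on heis_measure.

Let sigma_finite_heis_measure : sigma_finite setT heis_measure.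
Proof.
pose xy_measure : set ('rV[R]_n * 'rV[R]_n) -> \bar R :=
  (lebesgue_rV R n \x lebesgue_rV R n)%E.
pose mxy := Measure.on xy_measure.
pose sxy := Measure_isSigmaFinite.Build _ _ _ xy_measure
  (product_measure_sigma_finite (lebesgue_rV R n) (lebesgue_rV R n)).
pose m : {sigma_finite_measure set _ -> \bar R} := HB.pack xy_measure mxy sxy.
exact: (product_measure_sigma_finite m (@lebesgue_measure R)).
Qed.

HB.instance Definition _ := Measure_isSigmaFinite.Build _ _ _
  heis_measure sigma_finite_heis_measure.

End heisenberg.

Arguments heis_measure : clear implicits.

(* Main.v *)
(* Put f = (1/n) log u, phi = u^(2/n)/4 and g = |Zf|^2 + phi - i Tf. The tensors
   D_ab, E_ab, G_a attached to f by Jerison and Lee enter a divergence identity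
   whose right-hand side is a positive quadratic form in them. With the weight
   w = phi^(n-1+de) |g|^(-2 de), de = (2n+2-nq)/2, the form N stays positive because
   0 <= de < 1/2, while w phi^2 <= u^q is controlled by the growth hypothesis.
   Testing with powers of c = 1 - (|z|^4+t^2)/r^4 bounds X_6 = int c^6 w N by
   r^-2 Y, Y = int c^4 w |g|^2, and a second divergence identity bounds Y by
   th r^2 X_6 + C r^2 for every th > 0. So X_6 is bounded; the Caccioppoli inequality in the form
   X_6 <= t (X_6 - X_7) + K/t then forces X_6 = 0, as X_6 and X_7 have the same limit.
   Once the tensors vanish, v = i/g satisfies Zbar_a v = 0, T v = 1 and Z_b Z_a v = 0,
   so v = t + i|z|^2 + <mu,z> + lambda, and the real part of g = i/v reads
   phi |v|^2 = Im lambda - |mu|^2/4. *)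
From HB Require Import structures.
Require Import Defs.
From mathcomp Require Import all_boot all_order all_algebra.
From mathcomp Require Import all_classical all_reals all_analysis.
From mathcomp Require Import complex.
From mathcomp Require Import measurable_realfun ring lra.
Import Order.TTheory GRing.Theory Num.Theory.
Import numFieldNormedType.Exports.
Local Open Scope classical_set_scope.
Local Open Scope ring_scope.
Local Open Scope complex_scope.
Set Implicit Arguments.
Unset Strict Implicit.
Unset Printing Implicit Defensive.

(** * Smooth functions on normed spaces *)

(** The growth hypothesis controls a power of phi but not the gradient of f, while the cutoff error
    of the first identity contains w|g|^2 >= w(|Zf|^4 + (Tf)^2). The second identity closes this
    gap: its field is w h Zf, with h chosen so that the divergence dominates |Zf|^4 + (Tf)^2 up to
    phi^2. The total exponent of w is forced by q: |g| >= phi bounds w by phi^(n-1-de), two powers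
    of phi below a multiple of u^q. The two exponents in w are coupled because Zg = 2g Zf up to the
    tensors: Z log w is then 2(n-1) Zf, as for phi^(n-1), plus a correction linear in the tensors
    that costs at most the fraction 2 de of the quadratic form. The difference X_6 - X_7 stems from
    |Zc|^2 <= 4(1-c)/r^2, where the factor 1-c vanishes at the centre. The divergence identities are
    derived in an abstract commutative ring with derivations and a conjugation, which the weight
    enters only through its logarithmic derivative; analysis is confined to the pointwise
    inequalities and to integration by parts, which rests on Euclidean translation invariance. *)

Section smooth_theory.
Context (R : realType) (V : normedModType R).
Implicit Types (f g : V -> R) (p v w : V).

Lemma eq_Ck k f g : f =1 g -> Ck k g -> Ck k f.
Proof. by move=> /funext ->. Qed.

Lemma Ck_pred k f : Ck k.+1 f -> Ck k f.
Proof.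
elim: k f => [|k IH] f [df Df] /=.
  by move=> p; exact/differentiable_continuous/df.
by split => // v; exact/IH/Df.
Qed.

Lemma smooth_differentiable f p : smooth f -> differentiable f p.
Proof. by move=> /(_ 1%N)[]. Qed.

Lemma smooth_continuous f : smooth f -> continuous f.
Proof. by move=> /(_ 0%N). Qed.

Lemma smooth_derivable f p v : smooth f -> derivable f p v.
Proof. by move=> sf; apply/diff_derivable/smooth_differentiable. Qed.

Lemma smooth_derive f v : smooth f -> smooth ('D_v f).
Proof. by move=> sf k; have [_ /(_ v)] := sf k.+1. Qed.

Lemma smooth_cst (c : R) : smooth (fun _ : V => c).
Proof.
move=> k; elim: k c => [|k IH] c /=; first exact: cst_continuous.
split=> [p|v]; first exact: differentiable_cst.
by apply: (@eq_Ck _ _ (fun=> 0)) => // p; exact: derive_cst.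
Qed.

Lemma Ck_add k f g : Ck k f -> Ck k g -> Ck k (fun p => f p + g p).
Proof.
elim: k f g => [|k IH] f g /=.
  by move=> cf cg p; apply: continuousD; [exact: cf|exact: cg].
move=> [df Df] [dg Dg]; split=> [p|v]; first exact: differentiableD.
apply: (@eq_Ck _ _ (fun p => 'D_v f p + 'D_v g p)); last exact: IH.
by move=> p; rewrite -deriveD//; exact: diff_derivable.
Qed.

Lemma smoothD f g : smooth f -> smooth g -> smooth (fun p => f p + g p).
Proof. by move=> sf sg k; exact: Ck_add. Qed.

Lemma Ck_mul k f g : Ck k f -> Ck k g -> Ck k (fun p => f p * g p).
Proof.
elim: k f g => [|k IH] f g /=.
  by move=> cf cg p; apply: continuousM; [exact: cf|exact: cg].
move=> Kf Kg; have := Kf; have := Kg.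
move=> [dg Dg] [df Df]; split=> [p|v]; first exact: differentiableM.
apply: (@eq_Ck _ _ (fun p => f p * 'D_v g p + g p * 'D_v f p)).
  by move=> p; rewrite -[LHS]/('D_v (f * g) p) deriveM//; exact: diff_derivable.
by apply: Ck_add; apply: IH => //; exact: Ck_pred.
Qed.

Lemma smoothM f g : smooth f -> smooth g -> smooth (fun p => f p * g p).
Proof. by move=> sf sg k; exact: Ck_mul. Qed.

Lemma continuous_add f g : continuous f -> continuous g ->
  continuous (fun p => f p + g p).
Proof. by move=> cf cg; exact: (@Ck_add 0 f g cf cg). Qed.

Lemma continuous_mul f g : continuous f -> continuous g ->
  continuous (fun p => f p * g p).
Proof. by move=> cf cg; exact: (@Ck_mul 0 f g cf cg). Qed.

Lemma continuous_scale (c : R) f : continuous f -> continuous (fun p => c * f p).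
Proof. by move=> cf; apply: continuous_mul => // p; exact: cst_continuous. Qed.

Lemma smoothN f : smooth f -> smooth (fun p => - f p).
Proof.
move=> sf k; apply: (@eq_Ck _ _ (fun p => -1 * f p)).
  by move=> p; rewrite mulN1r.
by apply: Ck_mul => //; exact: smooth_cst.
Qed.

Lemma derive_add f g v p : smooth f -> smooth g ->
  'D_v (fun q => f q + g q) p = 'D_v f p + 'D_v g p.
Proof.
move=> sf sg; have Df := @smooth_derivable f p v sf.
exact: deriveD Df (@smooth_derivable g p v sg).
Qed.

Lemma derive_opp f v p : smooth f -> 'D_v (fun q => - f q) p = - 'D_v f p.
Proof. by move=> sf; exact: deriveN (@smooth_derivable f p v sf). Qed.

Lemma derive_mul f g v p : smooth f -> smooth g ->
  'D_v (fun q => f q * g q) p = f p * 'D_v g p + g p * 'D_v f p.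
Proof.
move=> sf sg; have Df := @smooth_derivable f p v sf.
exact: deriveM Df (@smooth_derivable g p v sg).
Qed.

Lemma smooth_linear (f : {linear V -> R}) : continuous f -> smooth f.
Proof.
move=> cf [//|k]; split=> [p|v]; first exact: linear_differentiable.
apply: (@eq_Ck _ _ (fun=> f v)); last exact: smooth_cst.
by move=> p; rewrite deriveE ?diff_lin//; exact: linear_differentiable.
Qed.

Lemma derive_comp1 f (h : R -> R) (h' : R) p v : differentiable f p ->
  is_derive (f p) 1 h h' -> 
  differentiable (h \o f) p /\ 'D_v (h \o f) p = h' * 'D_v f p.
Proof.
move=> df dh.
have dh1 : derivable h (f p) 1 by case: dh.
have dh2 : differentiable h (f p) by exact/derivable1_diffP.
split; first exact: differentiable_comp.
rewrite !deriveE//; last exact: differentiable_comp.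
rewrite diff_comp//= diff1E// derive1E derive_val /=.
by rewrite /GRing.scale /= mulrC.
Qed.

Lemma Ck_powR k f r : (forall p, 0 < f p) -> Ck k f ->
  Ck k (fun p => f p `^ r).
Proof.
move=> f0; have dpow p s : is_derive (f p) 1 ((@powR R)^~ s) (s * f p `^ (s - 1)).
  exact: is_derive1_powR.
elim: k r => [|k IH] r /=.
  move=> cf p; apply: (@continuous_comp _ _ _ f ((@powR R)^~ r)); first exact: cf.
  have ? : derivable ((@powR R)^~ r) (f p) 1.
    by case: (dpow p r).
  exact/differentiable_continuous/derivable1_diffP.
move=> Kf; have [df Df] := Kf; split=> [p|v].
  by have [] := derive_comp1 0 (df p) (dpow p r).
apply: (@eq_Ck _ _ (fun p => (r * f p `^ (r - 1)) * 'D_v f p)).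
  by move=> p; have [] := derive_comp1 v (df p) (dpow p r).
apply: Ck_mul => //; apply: Ck_mul; first exact: smooth_cst.
exact/IH/Ck_pred.
Qed.

Lemma smooth_powR f r : (forall p, 0 < f p) -> smooth f ->
  smooth (fun p => f p `^ r).
Proof. by move=> f0 sf k; exact: Ck_powR. Qed.

Lemma derive_powR f r p v : (forall p, 0 < f p) -> smooth f ->
  'D_v (fun p => f p `^ r) p = r * f p `^ (r - 1) * 'D_v f p.
Proof.
move=> f0 sf; have [_ <-//] := @derive_comp1 f ((@powR R)^~ r) (r * f p `^ (r - 1)) p v
  (smooth_differentiable p sf) (is_derive1_powR _ (f0 p)).
Qed.

Lemma smooth_ln f : (forall p, 0 < f p) -> smooth f ->
  smooth (fun p => ln (f p)) /\
  forall p v, 'D_v (fun p => ln (f p)) p = (f p)^-1 * 'D_v f p.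
Proof.
move=> f0 sf.
have dln p v := derive_comp1 v (smooth_differentiable p sf) (is_derive1_ln (f0 p)).
split; last by move=> p v; have [] := dln p v.
case=> [|k] /=.
  by move=> p; apply: differentiable_continuous; have [] := dln p 0.
split=> [p|v]; first by have [] := dln p 0.
(* The inverse is written as the power -1, whose smoothness is already available. *)
apply: (@eq_Ck _ _ (fun p => (f p) `^ (-1) * 'D_v f p)).
  by move=> p; have [_ ->] := dln p v; rewrite powR_inv1// ltW.
by apply: Ck_mul; [exact: smooth_powR|exact: smooth_derive].
Qed.

Lemma is_derive_line f p v (t : R) : differentiable f (p + t *: v) ->
  is_derive t 1 (fun s : R => f (p + s *: v)) ('D_v f (p + t *: v)).
Proof.
move=> df; rewrite deriveE//.
have dl : is_diff t (fun s : R => p + s *: v) ( *:%R ^~ v : R -> V).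
  by apply: is_diff_eq; rewrite add0r.
have [dc E] := is_diff_comp dl (differentiableP df).
have dc' : derivable (fun s : R => f (p + s *: v)) t 1.
  exact/derivable1_diffP.
apply: (DeriveDef dc').
by rewrite deriveE// E /= scale1r.
Qed.

Lemma mean_value_line f p v (h : R) : (forall q, differentiable f q) -> 0 < h ->
  exists2 c : R, 0 < c < h & f (p + h *: v) - f p = 'D_v f (p + c *: v) * h.
Proof.
move=> df h0.
have := @MVT R (fun s => f (p + s *: v)) (fun s => 'D_v f (p + s *: v)) 0 h h0.
case.
- by move=> x _; apply: is_derive_line.
- apply: continuous_subspaceT => s.
  apply: differentiable_continuous; apply/derivable1_diffP.
  by case: (@is_derive_line f p v s (df _)).
- by move=> c; rewrite in_itv/= scale0r addr0 subr0 => ch E; exists c.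
Qed.

Lemma derive_shift_point f p w v : differentiable f (p + w) ->
  differentiable (fun q => f (q + w)) p /\
  'D_v (fun q => f (q + w)) p = 'D_v f (p + w).
Proof.
move=> df; have dl : is_diff p (fun q : V => q + w) id.
  by apply: is_diff_eq; rewrite addr0.
have [dc E] := is_diff_comp dl (differentiableP df).
by split; [exact: dc|rewrite !deriveE// E].
Qed.

(* Both mixed derivatives are limits of the same second difference quotient. *)
Lemma derive_comm f v w p : smooth f -> 'D_v ('D_w f) p = 'D_w ('D_v f) p.
Proof.
move=> sf.
have key (x y : V) : forall e : R, 0 < e -> exists d : R, 0 < d /\
    forall h, 0 < h < d ->
    `|f (p + h *: x + h *: y) - f (p + h *: x) - f (p + h *: y) + f p -
      'D_y ('D_x f) p * h ^+ 2| <= e * h ^+ 2.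
  move=> e e0.
  have cD : continuous ('D_y ('D_x f)) by exact/smooth_continuous/smooth_derive/smooth_derive.
  have /cvgrPdist_lt/(_ e e0) := cD p.
  rewrite nearE => /nbhs_ballP[r /= r0 hr].
  have B0 : 0 < `|x| + `|y| + 1 by rewrite ltr_wpDl// addr_ge0.
  exists (r / (`|x| + `|y| + 1)); split; first by rewrite divr_gt0.
  move=> h /andP[h0 hd].
  pose F q := f (q + h *: y) - f q.
  have dF q z : differentiable F q /\ 'D_z F q = 'D_z f (q + h *: y) - 'D_z f q.
    have [d1 D1] := derive_shift_point z (smooth_differentiable (q + h *: y) sf).
    have d2 := smooth_differentiable q sf.
    split; first exact: differentiableB.
    rewrite -[LHS]/('D_z ((fun q => f (q + h *: y)) - f) q) deriveB ?D1//.
    - exact: diff_derivable.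
    - exact: diff_derivable.
  have [c ch Ec] := @mean_value_line F p x h (fun q => (dF q 0).1) h0.
  have [c' ch' Ec'] := @mean_value_line ('D_x f) (p + c *: x) y h
     (fun q => smooth_differentiable q (smooth_derive x sf)) h0.
  have -> : f (p + h *: x + h *: y) - f (p + h *: x) - f (p + h *: y) + f p =
     'D_y ('D_x f) (p + c *: x + c' *: y) * h ^+ 2.
    transitivity (F (p + h *: x) - F p); first by rewrite /F; ring.
    rewrite Ec (dF _ _).2 Ec'; ring.
  rewrite -mulrBl normrM (ger0_norm (sqr_ge0 h)) ler_wpM2r ?sqr_ge0//.
  rewrite distrC ltW//; apply: hr; rewrite -ball_normE /=.
  rewrite -!addrA opprD addNKr normrN.
  move/andP: ch => [c0 ch]; move/andP: ch' => [c'0 ch'].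
  rewrite (le_lt_trans (ler_normD _ _))// !normrZ !gtr0_norm//.
  have hlt : h * (`|x| + `|y| + 1) < r by rewrite -ltr_pdivlMr.
  apply: le_lt_trans hlt.
  rewrite mulrDr mulr1 mulrDr.
  have : c * `|x| <= h * `|x| by rewrite ler_wpM2r// ltW.
  have : c' * `|y| <= h * `|y| by rewrite ler_wpM2r// ltW.
  lra.
apply/eqP; rewrite -subr_eq0 -normr_le0; apply/ler_addgt0Pl => e e0.
rewrite addr0.
have e2 : 0 < e / 2 by rewrite divr_gt0.
have [d1 [d10 h1]] := key v w _ e2.
have [d2 [d20 h2]] := key w v _ e2.
pose h := Num.min d1 d2 / 2.
have m0 : 0 < Num.min d1 d2 by rewrite lt_min d10.
have h0 : 0 < h by rewrite divr_gt0.
have hm : h < Num.min d1 d2 by rewrite ltr_pdivrMr// ltr_pMr// ltr1n.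
move: (hm); rewrite lt_min => /andP[hd1 hd2].
have {h1} := h1 h; rewrite h0 hd1 => /(_ isT).
have {h2} := h2 h; rewrite h0 hd2 => /(_ isT).
rewrite (addrAC p (h *: w)).
set X := f (p + h *: v + h *: w); set Y := f (p + h *: v); set Z := f (p + h *: w).
set a := 'D_v ('D_w f) p; set b := 'D_w ('D_v f) p => H1 H2.
have hh : 0 < h ^+ 2 by rewrite exprn_gt0.
rewrite -(ler_pM2r hh) -{1}(gtr0_norm hh) -normrM.
apply: le_trans (_ : e / 2 * h ^+ 2 + e / 2 * h ^+ 2 <= _); last by rewrite -mulrDl -splitr.
apply: le_trans (lerD H2 H1).
rewrite -[leRHS]/(_ + _) -[X in _ <= _ + X]normrN.
apply: le_trans (ler_normD _ _).
by rewrite le_eqVlt; apply/orP; left; apply/eqP; congr (`|_|); ring.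
Qed.

Lemma derive_eq0_cst f : smooth f -> (forall p v, 'D_v f p = 0) ->
  forall p, f p = f 0.
Proof.
move=> sf D0 p.
have [c _] := @mean_value_line f 0 p 1 (fun q => smooth_differentiable q sf) ltr01.
by rewrite D0 mul0r scale1r add0r => /eqP; rewrite subr_eq0 => /eqP.
Qed.

End smooth_theory.

(** * The ring of smooth complex functions and its derivations *)

Section smooth_ring.
Context (R : realType) (V : normedModType R).
Implicit Types (p v w : V).

Definition csmooth : {pred V -> R[i]} := fun F =>
  `[< smooth (fun p => complex.Re (F p)) /\ smooth (fun p => complex.Im (F p)) >].

Lemma csmoothP F : reflect
  (smooth (fun p => complex.Re (F p)) /\ smooth (fun p => complex.Im (F p)))
  (F \in csmooth).
Proof. exact: asboolP. Qed.

Lemma cReM (x y : R[i]) : complex.Re (x * y) =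
  complex.Re x * complex.Re y - complex.Im x * complex.Im y.
Proof. by case: x y => [a b] [c d]. Qed.

Lemma cImM (x y : R[i]) : complex.Im (x * y) =
  complex.Re x * complex.Im y + complex.Im x * complex.Re y.
Proof. by case: x y => [a b] [c d]; rewrite /= addrC. Qed.

Lemma cReD (x y : R[i]) : complex.Re (x + y) = complex.Re x + complex.Re y.
Proof. by case: x y => [a b] [c d]. Qed.

Lemma cImD (x y : R[i]) : complex.Im (x + y) = complex.Im x + complex.Im y.
Proof. by case: x y => [a b] [c d]. Qed.

Lemma cReN (x : R[i]) : complex.Re (- x) = - complex.Re x.
Proof. by case: x. Qed.

Lemma cImN (x : R[i]) : complex.Im (- x) = - complex.Im x.
Proof. by case: x. Qed.

Lemma smooth_eq (f g : V -> R) : f =1 g -> smooth g -> smooth f.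
Proof. by move=> /funext ->. Qed.

Fact csmooth_subring : subring_closed csmooth.
Proof.
split=> [|F G /csmoothP[F1 F2] /csmoothP[G1 G2]|F G /csmoothP[F1 F2] /csmoothP[G1 G2]];
  apply/csmoothP; split.
- exact: smooth_cst.
- exact: smooth_cst.
- apply: (@smooth_eq _ (fun p => complex.Re (F p) + - complex.Re (G p))).
    by move=> p; exact: etrans (cReD _ _) (congr1 _ (cReN _)).
  by apply: smoothD => //; exact: smoothN.
- apply: (@smooth_eq _ (fun p => complex.Im (F p) + - complex.Im (G p))).
    by move=> p; exact: etrans (cImD _ _) (congr1 _ (cImN _)).
  by apply: smoothD => //; exact: smoothN.
- apply: (smooth_eq (fun p => cReM (F p) (G p))); apply: smoothD; first exact: smoothM.
  by apply: smoothN; exact: smoothM.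
- apply: (smooth_eq (fun p => cImM (F p) (G p))); apply: smoothD; exact: smoothM.
Qed.

HB.instance Definition _ := GRing.isSubringClosed.Build _ csmooth csmooth_subring.

(** Packaging smooth functions as a commutative ring lets identities between iterated derivatives be
    closed by [ring], with the fields below acting as derivations of that ring. *)
Record sm := Sm { smval :> V -> R[i]; _ : smval \in csmooth }.

HB.instance Definition _ := [isSub for smval].
HB.instance Definition _ := [Choice of sm by <:].
HB.instance Definition _ := [SubChoice_isSubComNzRing of sm by <:].

Implicit Types F G H : sm.

Lemma smP F G : (forall p, F p = G p) -> F = G.
Proof. by move=> FG; apply: val_inj; apply/funext => p; exact: FG. Qed.

Lemma sm_smooth F : smooth (fun p => complex.Re (F p)) /\ smooth (fun p => complex.Im (F p)).
Proof. exact/csmoothP/(valP F). Qed.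

Lemma smD F G p : (F + G) p = F p + G p. Proof. by []. Qed.
Lemma smN F p : (- F) p = - F p. Proof. by []. Qed.
Lemma smM F G p : (F * G) p = F p * G p. Proof. by []. Qed.
Lemma sm1 p : (1 : sm) p = 1. Proof. by []. Qed.
Lemma sm_sum I (r : seq I) (P : pred I) (f : I -> sm) p :
  (\sum_(i <- r | P i) f i) p = \sum_(i <- r | P i) f i p.
Proof. by elim/big_rec2: _ => //= i y z _ <-. Qed.
Lemma smX F k p : (F ^+ k) p = F p ^+ k.
Proof. by elim: k => // k IH; rewrite !exprS smM IH. Qed.
Lemma sm_nat k p : (k%:R : sm) p = k%:R.
Proof. by elim: k => // k IH; rewrite !mulrS smD IH. Qed.

Fact cst_subproof (c : R[i]) : (fun=> c) \in csmooth.
Proof. by apply/csmoothP; split; exact: smooth_cst. Qed.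
Definition scst c := Sm (cst_subproof c).

Fact cj_subproof F : (fun p => conjc (F p)) \in csmooth.
Proof.
have [F1 F2] := sm_smooth F; apply/csmoothP; split.
  by apply: smooth_eq F1 => p; case: (F p).
by apply: (@smooth_eq _ (fun p => - complex.Im (F p))); [move=> p; case: (F p)|exact: smoothN].
Qed.
Definition cj F := Sm (cj_subproof F).

Lemma cjD F G : cj (F + G) = cj F + cj G.
Proof. by apply: smP => p; rewrite smD /= rmorphD. Qed.
Lemma cjN F : cj (- F) = - cj F.
Proof. by apply: smP => p; rewrite smN /= rmorphN. Qed.
Lemma cjM F G : cj (F * G) = cj F * cj G.
Proof. by apply: smP => p; rewrite smM /= rmorphM. Qed.
Lemma cj1 : cj 1 = 1.
Proof. by apply: smP => p; exact: conjc1. Qed.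
Lemma cjK : involutive cj.
Proof. by move=> F; apply: smP => p; rewrite /= conjcK. Qed.

Fact dv_subproof v F : (fun p => 'D_v (fun q => complex.Re (F q)) p +i*
  'D_v (fun q => complex.Im (F q)) p) \in csmooth.
Proof.
have [F1 F2] := sm_smooth F; apply/csmoothP; split.
  exact: (smooth_derive v F1).
exact: (smooth_derive v F2).
Qed.
Definition dv v F := Sm (dv_subproof v F).

Lemma complex_eqP (x y : R[i]) :
  complex.Re x = complex.Re y -> complex.Im x = complex.Im y -> x = y.
Proof. by case: x y => [a b] [c d] /= -> ->. Qed.

Lemma eq_derive (f g : V -> R) v p : f =1 g -> 'D_v f p = 'D_v g p.
Proof. by move=> /funext ->. Qed.

Lemma dvD v F G : dv v (F + G) = dv v F + dv v G.
Proof.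
apply: smP => p; have [F1 F2] := sm_smooth F; have [G1 G2] := sm_smooth G.
apply: complex_eqP.
  rewrite smD cReD /=; apply: etrans (derive_add v p F1 G1).
  by apply: eq_derive => q; exact: cReD.
rewrite smD cImD /=; apply: etrans (derive_add v p F2 G2).
by apply: eq_derive => q; exact: cImD.
Qed.

Lemma dvM v F G : dv v (F * G) = dv v F * G + F * dv v G.
Proof.
apply: smP => p; have [F1 F2] := sm_smooth F; have [G1 G2] := sm_smooth G.
apply: complex_eqP.
  rewrite smD cReD !smM !cReM.
  transitivity ('D_v (fun q => complex.Re (F q) * complex.Re (G q) +
     - (complex.Im (F q) * complex.Im (G q))) p).
    by apply: eq_derive => q; exact: cReM.
  rewrite (derive_add v p (smoothM F1 G1) (smoothN (smoothM F2 G2))).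
  rewrite (derive_opp v p (smoothM F2 G2)) (derive_mul v p F1 G1) (derive_mul v p F2 G2) /=.
  ring.
rewrite smD cImD !smM !cImM.
transitivity ('D_v (fun q => complex.Re (F q) * complex.Im (G q) +
     complex.Im (F q) * complex.Re (G q)) p).
  by apply: eq_derive => q; exact: cImM.
rewrite (derive_add v p (smoothM F1 G2) (smoothM F2 G1)).
rewrite (derive_mul v p F1 G2) (derive_mul v p F2 G1) /=.
ring.
Qed.

Lemma dv_cst v c : dv v (scst c) = 0.
Proof. by apply: smP => p; apply: complex_eqP; exact: derive_cst. Qed.

Lemma dv_cj v F : dv v (cj F) = cj (dv v F).
Proof.
apply: smP => p; have [F1 F2] := sm_smooth F.
apply: complex_eqP => /=.
  by apply: eq_derive => q; case: (F q).
rewrite -(derive_opp v p F2).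
by apply: eq_derive => q; case: (F q).
Qed.

Lemma dv_comm v w F : dv v (dv w F) = dv w (dv v F).
Proof.
have [F1 F2] := sm_smooth F.
by apply: smP => p; apply: complex_eqP; exact: derive_comm.
Qed.

Lemma dv_eq0 F : (forall v, dv v F = 0) -> forall p, F p = F 0.
Proof.
move=> D0 p; have [F1 F2] := sm_smooth F.
apply: complex_eqP.
  apply: (derive_eq0_cst F1) => {p} p v.
  by have /(congr1 (fun G : sm => complex.Re (G p))) := D0 v.
apply: (derive_eq0_cst F2) => {p} p v.
by have /(congr1 (fun G : sm => complex.Im (G p))) := D0 v.
Qed.

Fact real_subproof (f : V -> R) : smooth f -> (fun p => (f p)%:C) \in csmooth.
Proof. by move=> sf; apply/csmoothP; split => //=; exact: smooth_cst. Qed.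
Definition sreal f (sf : smooth f) := Sm (real_subproof sf).

Lemma dv_real v f (sf : smooth f) : dv v (sreal sf) = sreal (smooth_derive v sf).
Proof. by apply: smP => p; apply: complex_eqP => //=; exact: derive_cst. Qed.

Lemma cj_real (f : V -> R) (sf : smooth f) : cj (sreal sf) = sreal sf.
Proof. by apply: smP => p /=; rewrite oppr0. Qed.

End smooth_ring.

(** * The fields Z, Zbar, T on smooth functions and their commutators *)

Section heis_fields.
Context (R : realType) (n : nat).
Implicit Types (p v w : heis R n).
Local Notation sm := (sm (heis R n)).
Implicit Types F G H : sm.
Local Notation scst := (@scst R (heis R n)).

Lemma linear_form_smooth (f : heis R n -> R) :
  (forall (k : R) v w, f (k *: v + w) = k * f v + f w) -> continuous f ->
  smooth f /\ forall v p, 'D_v f p = f v.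
Proof.
move=> lf cf; pose fM := GRing.isLinear.Build _ _ _ _ f lf.
pose fL : {linear heis R n -> R} := HB.pack f fM.
split; first exact: (@smooth_linear _ _ fL).
move=> v p; have df : differentiable f p by exact: (@linear_differentiable _ _ _ fL).
by rewrite deriveE// (@diff_lin _ _ _ fL).
Qed.

Lemma xcoord_smooth a : smooth (fun p : heis R n => p.1.1 0 a) /\
  forall v p, 'D_v (fun p : heis R n => p.1.1 0 a) p = v.1.1 0 a.
Proof.
apply: linear_form_smooth; first by move=> k v w; rewrite !mxE.
move=> p; apply: (@continuous_comp _ _ _ (fun p : heis R n => p.1.1)
  (fun v : 'rV[R]_n => v 0 a : R) p); last exact: coord_continuous.
by apply: (@continuous_comp _ _ _ fst fst); [exact: cvg_fst|exact: cvg_fst].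
Qed.

Lemma ycoord_smooth a : smooth (fun p : heis R n => p.1.2 0 a) /\
  forall v p, 'D_v (fun p : heis R n => p.1.2 0 a) p = v.1.2 0 a.
Proof.
apply: linear_form_smooth; first by move=> k v w; rewrite !mxE.
move=> p; apply: (@continuous_comp _ _ _ (fun p : heis R n => p.1.2)
  (fun v : 'rV[R]_n => v 0 a : R) p); last exact: coord_continuous.
by apply: (@continuous_comp _ _ _ fst snd); [exact: cvg_fst|exact: cvg_snd].
Qed.

Lemma tcoord_smooth : smooth (fun p : heis R n => p.2) /\
  forall v p, 'D_v (fun p : heis R n => p.2) p = v.2.
Proof. by apply: linear_form_smooth => //; move=> p; exact: cvg_snd. Qed.

Definition sx a := sreal (xcoord_smooth a).1.
Definition sy a := sreal (ycoord_smooth a).1.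
Definition st := sreal tcoord_smooth.1.

Lemma dv_sx v a : dv v (sx a) = scst (v.1.1 0 a)%:C.
Proof. by apply: smP => p; rewrite dv_real/= (xcoord_smooth a).2. Qed.
Lemma dv_sy v a : dv v (sy a) = scst (v.1.2 0 a)%:C.
Proof. by apply: smP => p; rewrite dv_real/= (ycoord_smooth a).2. Qed.
Lemma dv_st v : dv v st = scst (v.2)%:C.
Proof. by apply: smP => p; rewrite dv_real/= tcoord_smooth.2. Qed.

Definition ii : sm := scst 'i%C.
Definition half : sm := scst 2^-1.
Definition sz a := sx a + ii * sy a.

Definition TT F : sm := dv (vt R n) F.
Definition ZZ a F : sm :=
  half * (dv (vx R a) F - ii * dv (vy R a) F) + ii * cj (sz a) * TT F.
Definition ZB a F : sm :=
  half * (dv (vx R a) F + ii * dv (vy R a) F) - ii * sz a * TT F.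

Lemma szE a p : sz a p = zcoord p 0 a.
Proof.
by rewrite /zcoord mxE smD smM /=; apply: complex_eqP; rewrite /= ?mul0r ?mul1r ?subr0 ?addr0 ?add0r.
Qed.

Lemma ZZE a F p : ZZ a F p = ZH a F p.
Proof. by rewrite /ZH /dz -szE. Qed.

Lemma ZBE a F p : ZB a F p = ZbarH a F p.
Proof. by rewrite /ZbarH /dzbar -szE. Qed.

Lemma ii2 : ii * ii = -1.
Proof. by apply: smP => p; rewrite smM smN sm1 /= -expr2 sqr_i. Qed.

Lemma half2 : half + half = 1.
Proof. by apply: smP => p; rewrite smD sm1 /=; field. Qed.

Lemma cj_ii : cj ii = - ii.
Proof. by apply: smP => p; rewrite smN /=; apply: complex_eqP; rewrite /= ?oppr0. Qed.

Lemma cj_half : cj half = half.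
Proof. by apply: smP => p; exact: etrans (conjc_inv _) (congr1 _ (conjc_nat _ 2)). Qed.

Lemma dv0 v : dv v 0 = 0.
Proof. by apply: (addrI (dv v 0)); rewrite -dvD !addr0. Qed.

Lemma dvN v F : dv v (- F) = - dv v F.
Proof. by apply: (addrI (dv v F)); rewrite -dvD !subrr dv0. Qed.

Lemma dv_ii v F : dv v (ii * F) = ii * dv v F.
Proof. by rewrite dvM dv_cst mul0r add0r. Qed.

Lemma scst1 : scst 1 = 1. Proof. exact: smP. Qed.
Lemma scst0C : scst 0%:C = 0. Proof. exact: smP. Qed.
Lemma scst1C : scst 1%:C = 1. Proof. exact: smP. Qed.

Definition dvE := (dvD, dvM, dvN, dv_cst, dv_sx, dv_sy, dv_st).

Lemma TTD F G : TT (F + G) = TT F + TT G. Proof. exact: dvD. Qed.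
Lemma TTM F G : TT (F * G) = TT F * G + F * TT G. Proof. exact: dvM. Qed.
Lemma TT_cj F : TT (cj F) = cj (TT F). Proof. exact: dv_cj. Qed.
Lemma TT_cst c : TT (scst c) = 0. Proof. exact: dv_cst. Qed.

Lemma ZZD a F G : ZZ a (F + G) = ZZ a F + ZZ a G.
Proof. by rewrite /ZZ /TT !dvD; ring. Qed.
Lemma ZZM a F G : ZZ a (F * G) = ZZ a F * G + F * ZZ a G.
Proof. by rewrite /ZZ /TT !dvM; ring. Qed.
Lemma ZZ_cst a c : ZZ a (scst c) = 0.
Proof. by rewrite /ZZ /TT !dv_cst; ring. Qed.
Lemma ZBD a F G : ZB a (F + G) = ZB a F + ZB a G.
Proof. by rewrite /ZB /TT !dvD; ring. Qed.
Lemma ZBM a F G : ZB a (F * G) = ZB a F * G + F * ZB a G.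
Proof. by rewrite /ZB /TT !dvM; ring. Qed.
Lemma ZB_cst a c : ZB a (scst c) = 0.
Proof. by rewrite /ZB /TT !dv_cst; ring. Qed.

Lemma ZZ_cj a F : ZZ a (cj F) = cj (ZB a F).
Proof.
by rewrite /ZZ /ZB /TT !(cjD, cjN, cjM) cj_ii cj_half !dv_cj; ring.
Qed.
Lemma ZB_cj a F : ZB a (cj F) = cj (ZZ a F).
Proof. by rewrite -[in RHS](cjK F) ZZ_cj cjK. Qed.

Definition dlt (a b : 'I_n) : sm := (a == b)%:R.

Lemma dltC a b : dlt a b = dlt b a.
Proof. by rewrite /dlt eq_sym. Qed.

Lemma scst_nat k : scst k%:R = k%:R.
Proof. by apply: smP => p; rewrite sm_nat. Qed.

Lemma real_nat k : (k%:R)%:C = k%:R :> R[i].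
Proof. exact: rmorph_nat. Qed.

Lemma dvx_sz a b : dv (vx R b) (sz a) = dlt a b.
Proof. by rewrite /sz !dvE /= !mxE /= ?scst0C ?scst1C ?real_nat ?scst_nat; rewrite /dlt; ring. Qed.

Lemma dvy_sz a b : dv (vy R b) (sz a) = ii * dlt a b.
Proof. by rewrite /sz !dvE /= !mxE /= ?scst0C ?scst1C ?real_nat ?scst_nat; rewrite /dlt; ring. Qed.

Lemma dvt_sz a : dv (vt R n) (sz a) = 0.
Proof. by rewrite /sz !dvE /= !mxE /= ?scst0C ?scst1C ?real_nat ?scst_nat; ring. Qed.

Lemma cj_dlt a b : cj (dlt a b) = dlt a b.
Proof. by rewrite /dlt; case: (a == b); [exact: cj1|apply: smP => p; exact: conjc0]. Qed.

Definition dv_szE := (dvx_sz, dvy_sz, dvt_sz, dv_cj, cjM, cj_ii, cj_dlt).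

Lemma TT_sz a : TT (sz a) = 0. Proof. exact: dvt_sz. Qed.

Lemma cj0 : cj (0 : sm) = 0. Proof. by apply: smP => p; exact: conjc0. Qed.

Lemma TT_ZZ a F : TT (ZZ a F) = ZZ a (TT F).
Proof.
rewrite /TT /ZZ /TT !(dvD, dvN, dvM) !dv_cst dv_cj dvt_sz cj0.
by rewrite (dv_comm (vt R n) (vx R a)) (dv_comm (vt R n) (vy R a)); ring.
Qed.

Lemma TT_ZB a F : TT (ZB a F) = ZB a (TT F).
Proof.
have := congr1 (@cj _ _) (TT_ZZ a (cj F)).
by rewrite -TT_cj -!ZB_cj -TT_cj !cjK.
Qed.

Lemma half_mul2 F : half * (F + F) = F.
Proof. by rewrite mulrDr -mulrDl half2 mul1r. Qed.

Lemma ZZ_sz a b : ZZ b (sz a) = dlt a b.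
Proof.
rewrite /ZZ /TT !dv_szE -[RHS]mul1r -half2; have i2 := ii2; ring: i2.
Qed.

Lemma ZB_sz a b : ZB b (sz a) = 0.
Proof.
rewrite /ZB /TT !dv_szE; have i2 := ii2; ring: i2.
Qed.

Lemma ZZ0 a : ZZ a 0 = 0.
Proof. by apply: (addrI (ZZ a 0)); rewrite -ZZD !addr0. Qed.

Lemma ZZN a F : ZZ a (- F) = - ZZ a F.
Proof. by apply: (addrI (ZZ a F)); rewrite -ZZD !subrr ZZ0. Qed.

Lemma ZB0 a : ZB a 0 = 0.
Proof. by apply: (addrI (ZB a 0)); rewrite -ZBD !addr0. Qed.

Lemma ZBN a F : ZB a (- F) = - ZB a F.
Proof. by apply: (addrI (ZB a F)); rewrite -ZBD !subrr ZB0. Qed.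

Lemma ZZ_comm a b F : ZZ b (ZZ a F) = ZZ a (ZZ b F).
Proof.
have E c d (P Q S : sm) : ZZ d (half * (P - ii * Q) + ii * cj (sz c) * S) =
    half * (ZZ d P - ii * ZZ d Q) + ii * cj (sz c) * ZZ d S.
  rewrite ZZD (ZZM d half) (ZZM d (ii * _)) (ZZM d ii (cj _)) ZZD ZZN (ZZM d ii Q).
  by rewrite !ZZ_cst ZZ_cj ZB_sz cj0; ring.
rewrite [ZZ a F]/ZZ [ZZ b F]/ZZ !E /ZZ /TT.
rewrite !(dv_comm (vt R n)) (dv_comm (vy R b) (vy R a)) (dv_comm (vx R b) (vx R a)).
rewrite (dv_comm (vy R b) (vx R a)) (dv_comm (vx R b) (vy R a)).
by move: (dv _ _) (dv _ _) (dv _ _) (dv _ _) (dv _ _) (dv _ _) (dv _ _) => *; ring.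
Qed.

(** The second-order parts cancel; Zbar_b of the coefficient conj(z_a) and Z_a of the coefficient
    z_b each leave one term i T on the diagonal. *)
Lemma ZB_ZZ a b F : ZB b (ZZ a F) = ZZ a (ZB b F) + (ii * dlt a b * TT F) *+ 2.
Proof.
have E1 (P Q S : sm) : ZB b (half * (P - ii * Q) + ii * cj (sz a) * S) =
    half * (ZB b P - ii * ZB b Q) + ii * dlt a b * S + ii * cj (sz a) * ZB b S.
  rewrite ZBD (ZBM b half) (ZBM b (ii * _)) (ZBM b ii (cj _)) ZBD ZBN (ZBM b ii Q).
  by rewrite !ZB_cst ZB_cj ZZ_sz cj_dlt; ring.
have E2 (P Q S : sm) : ZZ a (half * (P + ii * Q) - ii * sz b * S) =
    half * (ZZ a P + ii * ZZ a Q) - ii * dlt a b * S - ii * sz b * ZZ a S.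
  rewrite ZZD ZZN (ZZM a half) (ZZM a (ii * _)) (ZZM a ii (sz b)) ZZD (ZZM a ii Q).
  by rewrite !ZZ_cst ZZ_sz (dltC b a); ring.
rewrite [ZZ a F]/ZZ [ZB b F]/ZB E1 E2 /ZZ /ZB /TT.
rewrite !(dv_comm (vt R n)) (dv_comm (vy R b) (vy R a)) (dv_comm (vx R b) (vx R a)).
rewrite (dv_comm (vy R b) (vx R a)) (dv_comm (vx R b) (vy R a)).
by move: (dv _ _) (dv _ _) (dv _ _) (dv _ _) (dv _ _) (dv _ _) (dv _ _) => *; ring.
Qed.

Lemma ZZ_st a : ZZ a st = ii * cj (sz a).
Proof.
by rewrite /ZZ /TT !dvE /= ?scst0C ?scst1C; ring.
Qed.

End heis_fields.

(** * The Jerison-Lee identity *)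

Section jerison_lee.
Context (A : comNzRingType) (n : nat).
Variables (Z Zb : 'I_n -> A -> A) (T cj : A -> A) (i : A).

(** Everything about the fields that the Jerison-Lee computation uses. Over an arbitrary commutative
    ring the computation is purely algebraic and free of denominators. *)
Record heis_calculus : Prop := HeisCalculus {
  hcZD : forall a x y, Z a (x + y) = Z a x + Z a y;
  hcZM : forall a x y, Z a (x * y) = Z a x * y + x * Z a y;
  hcZbD : forall a x y, Zb a (x + y) = Zb a x + Zb a y;
  hcZbM : forall a x y, Zb a (x * y) = Zb a x * y + x * Zb a y;
  hcTD : forall x y, T (x + y) = T x + T y;
  hcTM : forall x y, T (x * y) = T x * y + x * T y;
  hccjD : forall x y, cj (x + y) = cj x + cj y;
  hccjM : forall x y, cj (x * y) = cj x * cj y;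
  hccjK : involutive cj;
  hci2 : i * i = -1;
  hccji : cj i = - i;
  hcZi : forall a, Z a i = 0;
  hcZbi : forall a, Zb a i = 0;
  hcTi : T i = 0;
  hcZcj : forall a x, Z a (cj x) = cj (Zb a x);
  hcZbcj : forall a x, Zb a (cj x) = cj (Z a x);
  hcTcj : forall x, T (cj x) = cj (T x);
  hcZZ : forall a b x, Z b (Z a x) = Z a (Z b x);
  hcZbZ : forall a b x,
    Zb b (Z a x) = Z a (Zb b x) + (i * (a == b)%:R * T x) *+ 2;
  hcTZ : forall a x, T (Z a x) = Z a (T x);
  hcTZb : forall a x, T (Zb a x) = Zb a (T x) }.

Hypothesis H : heis_calculus.
Let ZD := hcZD H. Let ZM := hcZM H. Let ZbD := hcZbD H. Let ZbM := hcZbM H.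
Let TD := hcTD H. Let TM := hcTM H. Let cjD := hccjD H. Let cjM := hccjM H.
Let cjK := hccjK H. Let i2 := hci2 H. Let cji := hccji H. Let Zi := hcZi H.
Let Zbi := hcZbi H. Let Ti := hcTi H. Let Zcj := hcZcj H. Let Zbcj := hcZbcj H.
Let Tcj := hcTcj H. Let ZZ := hcZZ H. Let ZbZ := hcZbZ H. Let TZ := hcTZ H.
Let TZb := hcTZb H.

Let Z0 a : Z a 0 = 0. Proof. by apply: (addrI (Z a 0)); rewrite -ZD !addr0. Qed.
Let Zb0 a : Zb a 0 = 0. Proof. by apply: (addrI (Zb a 0)); rewrite -ZbD !addr0. Qed.
Let T0 : T 0 = 0. Proof. by apply: (addrI (T 0)); rewrite -TD !addr0. Qed.
Let cj0 : cj 0 = 0. Proof. by apply: (addrI (cj 0)); rewrite -cjD !addr0. Qed.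
Let ZN a x : Z a (- x) = - Z a x.
Proof. by apply: (addrI (Z a x)); rewrite -ZD !subrr Z0. Qed.
Let ZbN a x : Zb a (- x) = - Zb a x.
Proof. by apply: (addrI (Zb a x)); rewrite -ZbD !subrr Zb0. Qed.
Let TN x : T (- x) = - T x.
Proof. by apply: (addrI (T x)); rewrite -TD !subrr T0. Qed.
Let cjN x : cj (- x) = - cj x.
Proof. by apply: (addrI (cj x)); rewrite -cjD !subrr cj0. Qed.
Let cj1 : cj 1 = 1.
Proof. by rewrite -[LHS]mulr1 -{2}[1]cjK -cjM mul1r cjK. Qed.
Let cjMn x k : cj (x *+ k) = cj x *+ k.
Proof. by elim: k => [|k IH]; rewrite ?cj0// !mulrS cjD IH. Qed.
Let ZMn a x k : Z a (x *+ k) = Z a x *+ k.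
Proof. by elim: k => [|k IH]; rewrite ?Z0// !mulrS ZD IH. Qed.
Let ZbMn a x k : Zb a (x *+ k) = Zb a x *+ k.
Proof. by elim: k => [|k IH]; rewrite ?Zb0// !mulrS ZbD IH. Qed.
Let TMn x k : T (x *+ k) = T x *+ k.
Proof. by elim: k => [|k IH]; rewrite ?T0// !mulrS TD IH. Qed.
Let Z1 a : Z a 1 = 0.
Proof. by apply: (addrI (Z a 1)); rewrite addr0 -{3}[1]mul1r ZM mulr1 mul1r. Qed.
Let Znat a k : Z a k%:R = 0. Proof. by rewrite ZMn Z1 mul0rn. Qed.
Let T1 : T 1 = 0.
Proof. by apply: (addrI (T 1)); rewrite addr0 -{3}[1]mul1r TM mulr1 mul1r. Qed.
Let Tnat k : T k%:R = 0. Proof. by rewrite TMn T1 mul0rn. Qed.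
Let cjnat k : cj k%:R = k%:R. Proof. by rewrite cjMn cj1. Qed.
Let Zsum a I (r : seq I) (F : I -> A) :
  Z a (\sum_(j <- r) F j) = \sum_(j <- r) Z a (F j).
Proof. by elim/big_rec2: _ => [|j y x _ <-]; rewrite ?Z0 ?ZD. Qed.
Let Zbsum a I (r : seq I) (F : I -> A) :
  Zb a (\sum_(j <- r) F j) = \sum_(j <- r) Zb a (F j).
Proof. by elim/big_rec2: _ => [|j y x _ <-]; rewrite ?Zb0 ?ZbD. Qed.
Let Tsum I (r : seq I) (F : I -> A) :
  T (\sum_(j <- r) F j) = \sum_(j <- r) T (F j).
Proof. by elim/big_rec2: _ => [|j y x _ <-]; rewrite ?T0 ?TD. Qed.
Let cjsum I (r : seq I) (F : I -> A) :
  cj (\sum_(j <- r) F j) = \sum_(j <- r) cj (F j).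
Proof. by elim/big_rec2: _ => [|j y x _ <-]; rewrite ?cj0 ?cjD. Qed.

Variables (f phi : A).
Hypothesis (f_real : cj f = f) (phi_real : cj phi = phi).

Definition fz a := Z a f.
Definition fzb a := cj (fz a).
Definition gradsq := \sum_a fz a * fzb a.
Definition rg := gradsq + phi.
Definition f0 := T f.
Definition jlg := rg - i * f0.
Definition jlgb := rg + i * f0.
(* Dt, Et and Gv are the tensors D_ab, E_ab and G_a of Jerison and Lee; Dv and Ev
   contract the first two with the gradient of f. *)
Definition Dt a b := Z b (fz a) - (fz a * fz b) *+ 2.
Definition Et a b := Zb b (fz a) + jlg * (a == b)%:R.
Definition Dv a := \sum_b Dt a b * fzb b.
Definition Ev a := \sum_b Et a b * fz b.
Definition Gv a := i * Z a f0 + jlg * fz a.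

Hypothesis Zphi : forall a, Z a phi = (phi * fz a) *+ 2.
Hypothesis Tphi : T phi = (phi * f0) *+ 2.
Hypothesis pde : \sum_a Zb a (fz a) = - (n%:R * jlg).

Let dlt_sum (F : 'I_n -> A) a : \sum_b (a == b)%:R * F b = F a.
Proof.
rewrite (bigD1 a)//= eqxx mul1r big1 ?addr0// => b ba.
by rewrite eq_sym (negPf ba) mul0r.
Qed.

Lemma f0_real : cj f0 = f0. Proof. by rewrite /f0 -Tcj f_real. Qed.
Lemma fzbE a : fzb a = Zb a f. Proof. by rewrite /fzb /fz -Zbcj f_real. Qed.
Lemma gradsq_real : cj gradsq = gradsq.
Proof. by rewrite /gradsq cjsum; apply: eq_bigr => a _; rewrite cjM /fzb cjK mulrC. Qed.
Lemma rg_real : cj rg = rg. Proof. by rewrite /rg cjD gradsq_real phi_real. Qed.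
Lemma cj_jlg : cj jlg = jlgb.
Proof. by rewrite /jlg /jlgb cjD cjN cjM rg_real cji f0_real; ring. Qed.

Lemma Dt_sym a b : Dt a b = Dt b a.
Proof. by rewrite /Dt /fz ZZ; ring. Qed.

(** Commuting the two derivatives produces -2i [f0] on the diagonal, which turns [jlgb] into [jlg];
    this is why [Et] carries the complex [jlg] and not its real part. *)
Lemma cj_Et a b : cj (Et a b) = Et b a.
Proof.
rewrite /Et cjD cjM cj_jlg cjMn cj1 -Zcj -/(fzb a) fzbE ZbZ /jlg /jlgb /f0 /fz.
rewrite [b == a]eq_sym; ring.
Qed.

Lemma Z_gradsq b : Z b gradsq = Dv b + Ev b + (jlg - phi *+ 2) * fz b.
Proof.
have -> : Z b gradsq = \sum_a (Z b (fz a) * fzb a + cj (Zb b (fz a)) * fz a).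
  rewrite Zsum; apply: eq_bigr => a _.
  by rewrite ZM {2}/fzb Zcj [X in _ + X]mulrC.
have -> : \sum_a (Z b (fz a) * fzb a + cj (Zb b (fz a)) * fz a) =
   \sum_a (Dt b a * fzb a + (fz a * fzb a) * (fz b *+ 2) + Et b a * fz a
     - jlgb * ((b == a)%:R * fz a)).
  apply: eq_bigr => a _.
  have -> : cj (Zb b (fz a)) = Et b a - jlgb * (b == a)%:R.
    by rewrite -cj_Et /Et cjD cjM cjnat cj_jlg [a == b]eq_sym; ring.
  by rewrite Dt_sym /Dt; ring.
rewrite sumrB !big_split /= -mulr_suml -mulr_sumr dlt_sum -/(Dv b) -/(Ev b).
by rewrite -/gradsq /jlg /jlgb /rg; ring.
Qed.

Lemma Z_rg b : Z b rg = Dv b + Ev b + jlg * fz b.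
Proof. by rewrite /rg ZD Z_gradsq Zphi; ring. Qed.

Lemma Z_f0 b : Z b f0 = - i * (Gv b - jlg * fz b).
Proof. by rewrite /Gv; ring: i2. Qed.

(** Together with [Z_jlgb] this explains the shape of the tensors: modulo D, E, G the function g has
    Z-derivative 2g Zf, and its conjugate is killed by Z. Both the weight and the rigidity argument
    rest on this. *)
Lemma Z_jlg b : Z b jlg = Dv b + Ev b - Gv b + (jlg * fz b) *+ 2.
Proof. by rewrite {1}/jlg ZD ZN ZM Zi Z_rg Z_f0; ring: i2. Qed.

Lemma Z_jlgb b : Z b jlgb = Dv b + Ev b + Gv b.
Proof. by rewrite {1}/jlgb ZD ZM Zi Z_rg Z_f0; ring: i2. Qed.

Lemma Zb_jlg b : Zb b jlg = cj (Dv b + Ev b + Gv b).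
Proof. by rewrite -Z_jlgb -Zbcj -cj_jlg cjK. Qed.

(* The trace of the commutator [Zb_b, Z_a]: the divergences of D and E reduce *)
(* to first derivatives of g by the equation.                                 *)
Lemma Z_trace a : \sum_b Z a (Zb b (fz b)) = - (n%:R * Z a jlg).
Proof. by rewrite -Zsum pde ZN ZM Znat mul0r add0r. Qed.

Lemma div_Et a : \sum_b Z b (Et a b) = - ((n%:R - 1) * (Dv a + Ev a + Gv a)).
Proof.
have -> : \sum_b Z b (Et a b) =
   \sum_b (Z a (Zb b (fz b)) + (a == b)%:R * ((i * Z b f0) *+ 2 + Z b jlg)
      - (i * Z a f0) *+ 2).
  apply: eq_bigr => b _.
  have E : Z b (Zb b (fz a)) = Zb b (Z b (fz a)) - (i * Z a f0) *+ 2.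
    by rewrite ZbZ eqxx /f0 /fz TZ /=; ring.
  have E' : Zb b (Z b (fz a)) = Z a (Zb b (fz b)) + (i * (a == b)%:R * Z b f0) *+ 2.
    by rewrite /f0 /fz ZZ ZbZ TZ.
  by rewrite /Et ZD ZM Znat E E'; ring.
rewrite sumrB big_split /= dlt_sum Z_trace sumr_const card_ord.
by rewrite Z_jlg Z_f0 -[_ *+ n]mulr_natl; ring: i2.
Qed.

Lemma div_Et_cj b : \sum_a Zb a (Et a b) = - ((n%:R - 1) * cj (Dv b + Ev b + Gv b)).
Proof.
have := congr1 cj (div_Et b); rewrite cjsum cjN [cj (_ * _)]cjM cjD cjN cjnat cj1.
by move=> <-; apply: eq_bigr => a _; rewrite -Zbcj cj_Et.
Qed.

Lemma div_Dt a : \sum_b Zb b (Dt a b) =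
  - (n%:R * Dv a) - (n%:R + 2) * (Ev a - Gv a).
Proof.
have -> : \sum_b Zb b (Dt a b) =
   \sum_b (Z a (Zb b (fz b)) + (a == b)%:R * ((i * Z b f0) *+ 2)
     - (Et a b * fz b) *+ 2 + (a == b)%:R * ((jlg * fz b) *+ 2)
     - Zb b (fz b) * (fz a *+ 2)).
  apply: eq_bigr => b _.
  have E' : Zb b (Z b (fz a)) = Z a (Zb b (fz b)) + (i * (a == b)%:R * Z b f0) *+ 2.
    by rewrite /f0 /fz ZZ ZbZ TZ.
  by rewrite /Dt ZbD ZbN ZbMn ZbM E' /Et; ring.
rewrite sumrB big_split /= sumrB big_split /= !dlt_sum Z_trace -mulr_suml pde.
rewrite sumrMnl -/(Ev a) Z_jlg Z_f0; ring: i2.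
Qed.


Definition normE := \sum_a \sum_b Et a b * cj (Et a b).
Definition normD := \sum_a \sum_b Dt a b * cj (Dt a b).

Lemma normE_real : cj normE = normE.
Proof.
rewrite /normE cjsum; apply: eq_bigr => a _; rewrite cjsum; apply: eq_bigr => b _.
by rewrite cjM cjK mulrC.
Qed.

Lemma normD_real : cj normD = normD.
Proof.
rewrite /normD cjsum; apply: eq_bigr => a _; rewrite cjsum; apply: eq_bigr => b _.
by rewrite cjM cjK mulrC.
Qed.

Lemma trace_Et : \sum_a Et a a = 0.
Proof.
rewrite (eq_bigr (fun a => Zb a (fz a) + jlg)); last first.
  by move=> a _; rewrite /Et eqxx /= mulr1.
by rewrite big_split /= pde sumr_const card_ord mulr_natl addNr.
Qed.

Lemma div_Ev : \sum_a Zb a (Ev a) =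
  normE - \sum_b (n%:R - 1) * (cj (Dv b + Ev b + Gv b) * fz b).
Proof.
have -> : \sum_a Zb a (Ev a) = \sum_a \sum_b (Zb a (Et a b) * fz b +
    Et a b * cj (Et a b) - (b == a)%:R * (jlg * Et a b)).
  apply: eq_bigr => a _; rewrite Zbsum; apply: eq_bigr => b _.
  have E : Zb a (fz b) = cj (Et a b) - jlg * (b == a)%:R by rewrite cj_Et /Et addrK.
  by rewrite ZbM E; ring.
under eq_bigr do rewrite sumrB big_split /=.
rewrite sumrB big_split /= -/normE.
(* These terms add up to g times the trace of E, which the equation makes zero. *)
have -> : \sum_a \sum_b (b == a)%:R * (jlg * Et a b) = 0.
  rewrite (eq_bigr (fun a => jlg * Et a a)); last first.
    move=> a _; rewrite -(dlt_sum (fun b => jlg * Et a b)).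
    by apply: eq_bigr => b _; rewrite eq_sym.
  by rewrite -mulr_sumr trace_Et mulr0.
rewrite subr0 exchange_big /= addrC; congr (_ + _).
rewrite -sumrN; apply: eq_bigr => b _.
by rewrite -mulr_suml div_Et_cj; ring.
Qed.

Lemma div_Dv : \sum_a Zb a (Dv a) =
  normD + \sum_a (2 * (Dv a * fzb a) - n%:R * (Dv a * fzb a)
                  - (n%:R + 2) * ((Ev a - Gv a) * fzb a)).
Proof.
have -> : \sum_a Zb a (Dv a) = \sum_a \sum_b (Zb a (Dt b a) * fzb b +
    Dt a b * cj (Dt a b) + Dt a b * fzb b * (fzb a *+ 2)).
  apply: eq_bigr => a _; rewrite Zbsum; apply: eq_bigr => b _.
  have E : Zb a (fzb b) = cj (Dt a b) + (fzb a * fzb b) *+ 2.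
    by rewrite /fzb Zbcj Dt_sym /Dt cjD cjN cjMn cjM; ring.
  by rewrite ZbM E (Dt_sym a b); ring.
under eq_bigr do rewrite !big_split /=.
rewrite big_split /= big_split /= -/normD exchange_big /= [_ + normD]addrC -addrA; congr (_ + _).
rewrite -big_split /=; apply: eq_bigr => b _.
by rewrite -!mulr_suml div_Dt -/(Dv b); ring.
Qed.

Lemma T_jlg : T jlg + T jlgb = \sum_a (cj (Z a f0) * fz a + Z a f0 * fzb a) *+ 2
   + (phi * f0) *+ 4.
Proof.
rewrite /jlg /jlgb /rg !TD !TN !TM Ti Tphi.
have -> : T gradsq = \sum_a (cj (Z a f0) * fz a + Z a f0 * fzb a).
  rewrite Tsum; apply: eq_bigr => a _.
  rewrite TM {2}/fzb Tcj /fz TZ -/f0; ring.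
rewrite sumrMnl; ring.
Qed.

Lemma Ev_real : \sum_a (Ev a * fzb a - cj (Ev a) * fz a) = 0.
Proof.
rewrite sumrB.
have -> : \sum_a cj (Ev a) * fz a = \sum_a \sum_b Et b a * fzb b * fz a.
  apply: eq_bigr => a _; rewrite /Ev cjsum mulr_suml.
  by apply: eq_bigr => b _; rewrite cjM cj_Et.
have -> : \sum_a Ev a * fzb a = \sum_a \sum_b Et a b * fzb a * fz b.
  by apply: eq_bigr => a _; rewrite mulr_suml; apply: eq_bigr => b _; ring.
by rewrite exchange_big /= subrr.
Qed.

(** In [Vv] the tensor G has an imaginary coefficient, a multiple of i [f0], so the real part of the
    divergence involves only this difference. Taking it removes T [f0], which the tensors do not
    express. *)
Lemma div_Gv : \sum_a Zb a (Gv a) - cj (\sum_a Zb a (Gv a)) =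
  \sum_a (- (2 * n%:R + 1) * (Gv a * fzb a - cj (Gv a) * fz a)
     - (Dv a * fzb a - cj (Dv a) * fz a) - (Ev a * fzb a - cj (Ev a) * fz a)).
Proof.
have SG : \sum_a Zb a (Gv a) = - (i * n%:R * T jlg) +
    \sum_a cj (Dv a + Ev a + Gv a) * fz a - n%:R * jlg ^+ 2.
  have -> : \sum_a Zb a (Gv a) = \sum_a (i * T (Zb a (fz a)) +
      cj (Dv a + Ev a + Gv a) * fz a + jlg * Zb a (fz a)).
    apply: eq_bigr => a _; rewrite {1}/Gv ZbD !ZbM Zbi Zb_jlg TZb /fz TZ -/f0; ring.
  by rewrite !big_split /= -!mulr_sumr -Tsum pde TN TM Tnat; ring.
have cSG : cj (\sum_a Zb a (Gv a)) = i * n%:R * cj (T jlg) +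
    \sum_a (Dv a + Ev a + Gv a) * fzb a - n%:R * jlgb ^+ 2.
  rewrite SG expr2 !(cj_jlg, cjD, cjN, cjM) cjsum cjnat cji -expr2.
  congr (_ + _ - _); first by ring.
  by apply: eq_bigr => a _; rewrite cjM cjK.
have {cSG}cSG : cj (\sum_a Zb a (Gv a)) = i * n%:R * T jlgb +
    \sum_a (Dv a + Ev a + Gv a) * fzb a - n%:R * jlgb ^+ 2.
  by rewrite cSG -Tcj cj_jlg.
rewrite {}cSG {}SG.
have -> : - (i * n%:R * T jlg) + \sum_a cj (Dv a + Ev a + Gv a) * fz a -
   n%:R * jlg ^+ 2 - (i * n%:R * T jlgb + \sum_a (Dv a + Ev a + Gv a) * fzb a -
   n%:R * jlgb ^+ 2) =
   - (i * n%:R * (\sum_a (cj (Z a f0) * fz a + Z a f0 * fzb a) *+ 2 + (phi * f0) *+ 4))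
   + \sum_a (cj (Dv a + Ev a + Gv a) * fz a - (Dv a + Ev a + Gv a) * fzb a)
   + (n%:R * i * phi * f0) *+ 4 + n%:R * i * f0 * (\sum_a fz a * fzb a) *+ 4.
  rewrite -T_jlg sumrB -/gradsq /jlg /jlgb /rg; ring.
rewrite mulrDr mulr_sumr mulr_sumr.
have -> : forall x y z t u : A, - (x + y) + z + t + u = - x + z + u + (t - y).
  by move=> *; ring.
rewrite (_ : _ *+ 4 - _ = 0) ?addr0; last by ring.
rewrite -sumrMnl -sumrN -!big_split /=; apply: eq_bigr => a _.
rewrite Z_f0 !(cj_jlg, cji, cjN, cjM, cjD) /jlg /jlgb.
rewrite -/(fzb a); ring: i2.
Qed.

(** * The two divergence identities with a weight W *)

Variables (W : A) (kap : 'I_n -> A).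
Hypothesis W_real : cj W = W.
Hypothesis ZW : forall a, Z a W = W * ((2 * (n%:R - 1)) * fz a + kap a).

(** The vector field of Jerison and Lee. Its coefficients are such that the terms in which a tensor
    is contracted with [fz] drop out of the real part of the divergence. *)
Definition Vv a := (rg + (i * f0) *+ 2) * Ev a + (rg - (i * f0) *+ 2) * Dv a
  - (i * f0 * Gv a) *+ 3.

Lemma ZbW a : Zb a W = W * ((2 * (n%:R - 1)) * fzb a + cj (kap a)).
Proof.
by rewrite -{1}W_real Zbcj ZW !(W_real, cjnat, cj1, cjM, cjD, cjN) -/(fzb a).
Qed.

(** The sum with the conjugate plays the role of twice the real part. Terms linear in D and G cancel
    index by index; those linear in E leave a multiple of an expression whose sum is zero by
    [Ev_real]. What survives is quadratic in the tensors, apart from the correction [kap] of the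
    weight. *)
Lemma jerison_lee_identity (X := \sum_a Zb a (W * Vv a)) :
  X + cj X = W * ((rg * (normE + normD)) *+ 2 +
  \sum_a ((Dv a * cj (Dv a) + Ev a * cj (Ev a) + Dv a * cj (Ev a) + Ev a * cj (Dv a)
     - Gv a * cj (Ev a) - Ev a * cj (Gv a) + Gv a * cj (Dv a) + Dv a * cj (Gv a)) *+ 2
     + (Gv a * cj (Gv a)) *+ 6 + cj (kap a) * Vv a + kap a * cj (Vv a))).
Proof.
set c1 := rg + (i * f0) *+ 2; set c2 := rg - (i * f0) *+ 2.
have cc1 : cj c1 = c2.
  by rewrite /c1 /c2 cjD cjMn cjM rg_real cji f0_real; ring.
have cc2 : cj c2 = c1 by rewrite -cc1 cjK.
(* The terms in which the derivative falls on the weight or on a coefficient of [Vv], not on a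
   tensor. *)
pose Rr a := (2 * (n%:R - 1) * fzb a + cj (kap a)) * Vv a +
   cj (Z a c2) * Ev a + cj (Z a c1) * Dv a - (i * cj (Z a f0) * Gv a) *+ 3.
have XE : X = W * (c1 * (\sum_a Zb a (Ev a)) + c2 * (\sum_a Zb a (Dv a))
   - (i * f0 * \sum_a Zb a (Gv a)) *+ 3 + \sum_a Rr a).
  rewrite !mulr_sumr -sumrMnl -!big_split /= -sumrB -big_split /= mulr_sumr.
  apply: eq_bigr => a _.
  have E : Zb a (Vv a) = Zb a c1 * Ev a + c1 * Zb a (Ev a) + (Zb a c2 * Dv a +
    c2 * Zb a (Dv a)) - (i * (Zb a f0 * Gv a + f0 * Zb a (Gv a))) *+ 3.
    rewrite /Vv -/c1 -/c2; clear cc1 cc2 Rr; move: c1 c2 => d1 d2.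
    by rewrite ZbD ZbN ZbMn ZbD !ZbM Zbi; ring.
  rewrite ZbM ZbW E /Rr -!Zbcj cc1 cc2 f0_real.
  clear cc1 cc2 Rr E; move: (Vv a) c1 c2 => v d1 d2; ring.
have cXE : cj X = W * (c2 * cj (\sum_a Zb a (Ev a)) + c1 * cj (\sum_a Zb a (Dv a))
   + (i * f0 * cj (\sum_a Zb a (Gv a))) *+ 3 + \sum_a cj (Rr a)).
  rewrite XE; move: (\sum_a Zb a (Ev a)) (\sum_a Zb a (Dv a)) => SE SD.
  move: (\sum_a Zb a (Gv a)) => SG; rewrite -cjsum; move: (\sum_a Rr a) => SR.
  by rewrite !(cc1, cc2, W_real, cji, f0_real, cjD, cjN, cjMn, cjM); ring.
have XX : X + cj X = W * ((c1 + c2) * (normE + normD) + \sum_a (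
   - ((n%:R - 1) * (c1 * (cj (Dv a + Ev a + Gv a) * fz a) + c2 * ((Dv a + Ev a + Gv a) * fzb a)))
   + (2 - n%:R) * (c2 * (Dv a * fzb a) + c1 * (cj (Dv a) * fz a))
   - (n%:R + 2) * (c2 * ((Ev a - Gv a) * fzb a) + c1 * (cj (Ev a - Gv a) * fz a))
   - (i * f0 * (- (2 * n%:R + 1) * (Gv a * fzb a - cj (Gv a) * fz a)
     - (Dv a * fzb a - cj (Dv a) * fz a) - (Ev a * fzb a - cj (Ev a) * fz a))) *+ 3
   + Rr a + cj (Rr a))).
  have -> : X + cj X = W * (c1 * (\sum_a Zb a (Ev a)) + c2 * cj (\sum_a Zb a (Ev a))
     + (c2 * (\sum_a Zb a (Dv a)) + c1 * cj (\sum_a Zb a (Dv a)))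
     - (i * f0 * (\sum_a Zb a (Gv a) - cj (\sum_a Zb a (Gv a)))) *+ 3
     + (\sum_a Rr a + \sum_a cj (Rr a))).
    rewrite cXE XE; ring.
  rewrite div_Gv div_Ev div_Dv; have := normE_real; have := normD_real.
  move: normE normD => NE ND rD rE; rewrite !(rD, rE, cjD, cjN) !cjsum.
  congr (W * _).
  rewrite !mulrDr !mulrN !mulr_sumr -sumrMnl.
  have -> : forall x y s1 s2 s3 s4 s5 s6 s7 : A,
    c1 * x - s1 + (c2 * x - s2) + (c2 * y + s3 + (c1 * y + s4)) - s5 + (s6 + s7) =
    (c1 + c2) * x + (c1 + c2) * y + (- s1 - s2 + s3 + s4 - s5 + s6 + s7).
    by move=> *; ring.
  congr (_ + _); rewrite -!sumrN -!big_split /=; apply: eq_bigr => a _.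
  rewrite /fzb; move: (Rr a) (Dv a) (Ev a) (Gv a) (fz a) => r D E G ff.
  clear Rr XE cXE; move: cc1 cc2; move: c1 c2 => d1 d2 _ _.
  by rewrite !(cjnat, cj1, cjK, cjD, cjN, cjM); ring.
rewrite XX; congr (W * _); rewrite {1}/c1 {1}/c2.
have -> : rg + i * f0 *+ 2 + (rg - i * f0 *+ 2) = rg *+ 2 by ring.
congr (_ + _); first by ring.
(* The coefficient left on the terms linear in E; it does not depend on the index, so [Ev_real]
   applies after summation. *)
pose K := 2 * (n%:R - 1) * c1 - (2 * n%:R + 1) * c2 + 3 * i * f0 + 3 * jlgb.
transitivity (\sum_a ((Dv a * cj (Dv a) + Ev a * cj (Ev a) + Dv a * cj (Ev a) + Ev a * cj (Dv a)
     - Gv a * cj (Ev a) - Ev a * cj (Gv a) + Gv a * cj (Dv a) + Dv a * cj (Gv a)) *+ 2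
     + (Gv a * cj (Gv a)) *+ 6 + cj (kap a) * Vv a + kap a * cj (Vv a)
     + K * (Ev a * fzb a - cj (Ev a) * fz a))).
  apply: eq_bigr => a _.
  have Zc1 : Z a c1 = Dv a + Ev a + Gv a *+ 2 - jlg * fz a.
    by rewrite /c1 ZD ZMn ZM Zi Z_rg Z_f0; ring: i2.
  have Zc2 : Z a c2 = Dv a + Ev a - Gv a *+ 2 + (jlg * fz a) *+ 3.
    by rewrite /c2 ZD ZN ZMn ZM Zi Z_rg Z_f0; ring: i2.
  rewrite /Rr Zc1 Zc2 Z_f0 /K /Vv -/c1 -/c2 /fzb.
  have := cj_jlg; move: cc1 cc2.
  clear Rr XE cXE XX K Zc1 Zc2 X.
  rewrite /c1 /c2 /jlg /jlgb; have := f0_real; have := rg_real.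
  move: rg f0 (Dv a) (Ev a) (Gv a) (fz a) (kap a) => r s D E G ff k rr rs _ _ _.
  rewrite !(cjnat, cj1, cji, rr, rs, cjK, cjD, cjN, cjMn, cjM).
  move: (cj D) (cj E) (cj G) (cj ff) (cj k) => *.
  by ring: i2.
by rewrite big_split /= -mulr_sumr Ev_real mulr0 addr0.
Qed.

(** Write a for [gradsq]. In the real part of the divergence below, the summand with 2a + 4 [phi]
    yields n((2n-2)(a^2 + a [phi]) - 4n [phi]^2) and the summand - [jlgb] yields n([f0]^2 + [phi]^2
    - a^2). Together they are positive in a^2 and [f0]^2 and negative only in [phi]^2, which the
    growth hypothesis controls. *)
Definition hh := n%:R * (gradsq *+ 2 + phi *+ 4) - jlgb.
(** The part of Z (cj [hh]) that is linear in the tensors. *)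
Definition Pv a := (2 * n%:R) * (Dv a + Ev a) - (Dv a + Ev a - Gv a).

Lemma cj_hh : cj hh = n%:R * (gradsq *+ 2 + phi *+ 4) - jlg.
Proof.
rewrite /hh; have := gradsq_real; have := cj_jlg; move: jlg jlgb gradsq => x y z.
by move=> xy zz; rewrite -xy !(cjnat, phi_real, zz, cjK, cjD, cjN, cjMn, cjM).
Qed.

Lemma Z_cj_hh a : Z a (cj hh) =
  Pv a + (2 * n%:R * (jlg + phi *+ 2) - jlg *+ 2) * fz a.
Proof.
rewrite cj_hh ZD ZM Znat ZD !ZMn ZN Z_gradsq Zphi Z_jlg /Pv; ring.
Qed.

Lemma gradient_identity (Y := \sum_a Zb a (W * hh * fz a)) :
  Y + cj Y = W * ((n%:R * ((2 * (n%:R - 1)) * gradsq ^+ 2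
      - (2 * (n%:R + 1)) * (gradsq * phi) + (4 * n%:R) * (phi * (gradsq - phi))
      - (gradsq ^+ 2 - phi ^+ 2 - f0 ^+ 2))) *+ 2 +
    \sum_a (cj (kap a) * hh * fz a + kap a * cj hh * fzb a
       + cj (Pv a) * fz a + Pv a * fzb a)).
Proof.
have Zbhh a : Zb a hh = cj (Pv a) +
    (2 * n%:R * (jlgb + phi *+ 2) - jlgb *+ 2) * fzb a.
  rewrite -[hh]cjK Zbcj Z_cj_hh; have := cj_jlg; move: jlg jlgb (Pv a) => x y z.
  by move=> xy; rewrite /fzb !(xy, cjnat, cjD, cjN, cjMn, cjM, phi_real).
have YE : Y = W * (\sum_a (cj (kap a) * hh * fz a + cj (Pv a) * fz a) +
   (2 * (n%:R - 1) * hh + (2 * n%:R * (jlgb + phi *+ 2) - jlgb *+ 2)) * gradsq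
   - n%:R * jlg * hh).
  transitivity (W * (\sum_a (cj (kap a) * hh * fz a + cj (Pv a) * fz a) +
   (2 * (n%:R - 1) * hh + (2 * n%:R * (jlgb + phi *+ 2) - jlgb *+ 2)) * gradsq
   + hh * \sum_a Zb a (fz a))); last by rewrite pde; ring.
  rewrite /gradsq !mulr_sumr -!big_split /= mulr_sumr; apply: eq_bigr => a _.
  rewrite !ZbM ZbW Zbhh; move: (Zb a (fz a)) hh => z h; ring.
have cYE : cj Y = W * (\sum_a (kap a * cj hh * fzb a + Pv a * fzb a) +
   (2 * (n%:R - 1) * cj hh + (2 * n%:R * (jlg + phi *+ 2) - jlg *+ 2)) * gradsq
   - n%:R * jlgb * cj hh).
  rewrite YE; have := gradsq_real; have := cj_jlg.
  have -> : \sum_a (kap a * cj hh * fzb a + Pv a * fzb a) =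
     cj (\sum_a (cj (kap a) * hh * fz a + cj (Pv a) * fz a)).
    rewrite cjsum; apply: eq_bigr => a _; rewrite /fzb.
    by move: hh (Pv a) (fz a) => h p z; rewrite !(cjK, cjD, cjM).
  move: (\sum_a (cj (kap a) * hh * fz a + cj (Pv a) * fz a)) => S.
  move: jlg jlgb hh gradsq => x y h a xy aa; rewrite -xy.
  by rewrite !(W_real, cjK, aa, cjnat, cj1, phi_real, cjD, cjN, cjMn, cjM).
rewrite {}cYE {}YE cj_hh /hh.
have -> : \sum_a (cj (kap a) * (n%:R * (gradsq *+ 2 + phi *+ 4) - jlgb) * fz a +
    kap a * (n%:R * (gradsq *+ 2 + phi *+ 4) - jlg) * fzb a
       + cj (Pv a) * fz a + Pv a * fzb a) =
   \sum_a (cj (kap a) * (n%:R * (gradsq *+ 2 + phi *+ 4) - jlgb) * fz a + cj (Pv a) * fz a) +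
   \sum_a (kap a * (n%:R * (gradsq *+ 2 + phi *+ 4) - jlg) * fzb a + Pv a * fzb a).
  by rewrite -big_split /=; apply: eq_bigr => a _; ring.
move: (\sum_a (cj _ * _ * _ + _)) (\sum_a (kap a * _ * _ + _)) => S S'.
rewrite /jlg /jlgb /rg; move: gradsq f0 => a s; ring: i2.
Qed.

End jerison_lee.

(** * Pointwise inequalities *)

Section pointwise.
Context (R : realType).
Implicit Types (x y z : R[i]) (A s de : R).

Definition sq x : R := complex.Re x ^+ 2 + complex.Im x ^+ 2.

(** For x, y, z the components of D, E, G, twice this form is the pointwise quadratic form in
    [jerison_lee_identity] (without [kap]) plus 2(|x|^2 + |y|^2). *)
Definition Pf x y z : R := sq z + sq (z + x) + sq (z - y) + sq (x + y).

Lemma sq_ge0 x : 0 <= sq x. Proof. by rewrite addr_ge0 ?sqr_ge0. Qed.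

Lemma Pf_ge0 x y z : 0 <= Pf x y z.
Proof. by rewrite /Pf !addr_ge0 ?sqr_ge0. Qed.

Lemma sqD_ge0 (a b : R) : 0 <= a ^+ 2 + b ^+ 2.
Proof. by rewrite addr_ge0 ?sqr_ge0. Qed.

(** The left side is the real part of conj(A(x+y) - isz) times the Jerison-Lee field, and A^2 + s^2
    is |g|^2. Up to the factor -4 de/|g|^2 this is the contribution of the weight correction, so the
    constant 1 on the right is what admits every de below 1/2. *)
Lemma key_form (x1 x2 y1 y2 z1 z2 A s : R) : 0 < A ->
  (A * (x1 + y1) + s * z2) * (A * (x1 + y1) - s * (2 * (y2 - x2) - 3 * z2))
  - (s * z1 - A * (x2 + y2)) * (A * (x2 + y2) + s * (2 * (y1 - x1) - 3 * z1))
  <= (A ^+ 2 + s ^+ 2) * (z1 ^+ 2 + z2 ^+ 2 + ((z1 + x1) ^+ 2 + (z2 + x2) ^+ 2)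
     + ((z1 - y1) ^+ 2 + (z2 - y2) ^+ 2) + ((x1 + y1) ^+ 2 + (x2 + y2) ^+ 2)).
Proof.
move=> A0; set B := (X in X <= _); set P := (X in _ <= _ * X).
set M := A ^+ 2 + s ^+ 2.
have s2 : 0 <= s ^+ 2 by exact: sqr_ge0.
have A2 : 0 < A ^+ 2 by exact: exprn_gt0.
have M0 : 0 < M by rewrite /M; lra.
have Ms0 : 0 < M + 2 * s ^+ 2 by lra.
have K0 : 0 < M * (M + 2 * s ^+ 2) by exact: mulr_gt0.
rewrite -subr_ge0 -(pmulr_rge0 _ K0).
(* Squares are completed in x - y, then in z; a positive multiple of |x + y|^2 remains. *)
have -> : M * (M + 2 * s ^+ 2) * (M * P - B) =
  (M + 2 * s ^+ 2) / 2 *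
    ((M * (x1 - y1) + 2 * A ^+ 2 * z1 + 2 * A * s * (x2 + y2)) ^+ 2 +
     (M * (x2 - y2) + 2 * A ^+ 2 * z2 - 2 * A * s * (x1 + y1)) ^+ 2) +
  (((M + 2 * s ^+ 2) * A * z1 + 2 * s ^+ 3 * (x2 + y2)) ^+ 2 +
   ((M + 2 * s ^+ 2) * A * z2 - 2 * s ^+ 3 * (x1 + y1)) ^+ 2) +
  M ^+ 3 / 2 * ((x1 + y1) ^+ 2 + (x2 + y2) ^+ 2).
  by rewrite /M /P /B; field.
apply: addr_ge0; last by rewrite mulr_ge0 ?sqD_ge0// divr_ge0// exprn_ge0// ltW.
by apply: addr_ge0; [rewrite mulr_ge0 ?sqD_ge0// divr_ge0// ltW|exact: sqD_ge0].
Qed.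

(** Here A and s are the values of |Zf|^2 + phi and Tf, so that g = A - is; [kapf] and [Vf] are the
    pointwise forms of the weight correction and of the Jerison-Lee field. *)
Definition kapf x y z A s de : R[i] :=
  - (2 * de / (A ^+ 2 + s ^+ 2))%:C * (A%:C * (x + y) - 'i%C * s%:C * z).
Definition Vf x y z A s : R[i] :=
  (A%:C + ('i%C * s%:C) *+ 2) * y + (A%:C - ('i%C * s%:C) *+ 2) * x
  - ('i%C * s%:C * z) *+ 3.

(** The [kapf] terms equal -4 de/|g|^2 times the left side of [key_form], so they remove at most the
    fraction 2 de of 2 [Pf]. The summand 2(|x|^2 + |y|^2) is supplied later by Cauchy-Schwarz from
    the full norms of D and E. *)
Lemma key_inequality x y z A s de : 0 < A -> 0 <= de ->
  (1 - 2 * de) * 2 * Pf x y z <=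
  complex.Re ((x * conjc x + y * conjc y + x * conjc y + y * conjc x - z * conjc y
     - y * conjc z + z * conjc x + x * conjc z) *+ 2 + (z * conjc z) *+ 6
     + conjc (kapf x y z A s de) * Vf x y z A s
     + kapf x y z A s de * conjc (Vf x y z A s)) + 2 * (sq x + sq y).
Proof.
move=> A0 de0; case: x => x1 x2; case: y => y1 y2; case: z => z1 z2.
have := @key_form x1 x2 y1 y2 z1 z2 A s A0.
set B := (X in X <= _); set P := (X in _ <= _ * X).
set M := A ^+ 2 + s ^+ 2.
have M0 : 0 < M by rewrite ltr_pwDl ?sqr_ge0 ?exprn_gt0.
rewrite -ler_pdivrMl// => BP.
have -> : Pf (x1 +i* x2) (y1 +i* y2) (z1 +i* z2) = P.
  by rewrite /Pf /sq /= /P.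
rewrite [leRHS](_ : _ = 2 * P - 4 * de * (M^-1 * B)); last first.
  rewrite /kapf /Vf /sq -/M; have Mn : M != 0 by rewrite gt_eqF.
  rewrite !mulr2n /= !(mulrS, mulr0n) /=.
  by rewrite /P /B; field.
have : de * (M^-1 * B) <= de * P by rewrite ler_wpM2l.
lra.
Qed.

(** After |a+b-c|^2 <= 3(|a|^2+|b|^2+|c|^2) the z-term costs 27 s^2 |z|^2. The constant 75 leaves 48
    |z|^2, that is 24 |z|^2 to accompany each of |z+x|^2 and |z-y|^2 in dominating 12 |x|^2 and 12
    |y|^2. *)
Lemma Vf_bound x y z A s :
  sq (Vf x y z A s) <= 75 * (A ^+ 2 + s ^+ 2) * Pf x y z.
Proof.
case: x => x1 x2; case: y => y1 y2; case: z => z1 z2.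
pose V1 : R[i] := (A%:C + ('i%C * s%:C) *+ 2) * (y1 +i* y2).
pose V2 : R[i] := (A%:C - ('i%C * s%:C) *+ 2) * (x1 +i* x2).
pose V3 : R[i] := ('i%C * s%:C * (z1 +i* z2)) *+ 3.
have sq3 (a b c : R[i]) : sq (a + b - c) <= 3 * (sq a + sq b + sq c).
  case: a => a1 a2; case: b => b1 b2; case: c => c1 c2; rewrite /sq /=.
  rewrite -subr_ge0 [leRHS](_ : _ = (a1 - b1) ^+ 2 + (a1 + c1) ^+ 2 + (b1 + c1) ^+ 2
    + ((a2 - b2) ^+ 2 + (a2 + c2) ^+ 2 + (b2 + c2) ^+ 2)); last by ring.
  by rewrite !addr_ge0 ?sqr_ge0.
apply: (le_trans (sq3 V1 V2 V3)).
have -> : sq V1 = (A ^+ 2 + 4 * s ^+ 2) * (y1 ^+ 2 + y2 ^+ 2).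
  by rewrite /V1 /sq !mulr2n /=; ring.
have -> : sq V2 = (A ^+ 2 + 4 * s ^+ 2) * (x1 ^+ 2 + x2 ^+ 2).
  by rewrite /V2 /sq !mulr2n /=; ring.
have -> : sq V3 = 9 * s ^+ 2 * (z1 ^+ 2 + z2 ^+ 2).
  by rewrite /V3 /sq !(mulrS, mulr0n) /=; ring.
rewrite /Pf /sq /= -subr_ge0.
set A2 := A ^+ 2; set s2 := s ^+ 2.
have A20 : 0 <= A2 by exact: sqr_ge0.
have s20 : 0 <= s2 by exact: sqr_ge0.
rewrite [leRHS](_ : _ =
  A2 * (75 * ((z1 + x1) ^+ 2 + (z2 + x2) ^+ 2) + 75 * ((z1 - y1) ^+ 2 + (z2 - y2) ^+ 2)
     + 75 * (z1 ^+ 2 + z2 ^+ 2) + 75 * ((x1 + y1) ^+ 2 + (x2 + y2) ^+ 2)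
     - 3 * (y1 ^+ 2 + y2 ^+ 2) - 3 * (x1 ^+ 2 + x2 ^+ 2)) +
  s2 * (75 * ((z1 + x1) ^+ 2 + (z2 + x2) ^+ 2) + 75 * ((z1 - y1) ^+ 2 + (z2 - y2) ^+ 2)
     + 48 * (z1 ^+ 2 + z2 ^+ 2) + 75 * ((x1 + y1) ^+ 2 + (x2 + y2) ^+ 2)
     - 12 * (y1 ^+ 2 + y2 ^+ 2) - 12 * (x1 ^+ 2 + x2 ^+ 2))); last by ring.
have aux (a b : R) : 0 <= 75 * (a + b) ^+ 2 + 24 * a ^+ 2 - 12 * b ^+ 2.
  by have := sqr_ge0 (21 * b + 25 * a); have := sqr_ge0 a; lra.
have bux (a b : R) : 0 <= 75 * (a - b) ^+ 2 + 24 * a ^+ 2 - 12 * b ^+ 2.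
  by have := sqr_ge0 (21 * b - 25 * a); have := sqr_ge0 a; lra.
have X1 := aux z1 x1; have X2 := aux z2 x2; have Y1 := bux z1 y1; have Y2 := bux z2 y2.
rewrite addr_ge0// mulr_ge0//; have := sqr_ge0 (x1 + y1); have := sqr_ge0 (x2 + y2);
  have := sqr_ge0 z1; have := sqr_ge0 z2; have := sqr_ge0 x1; have := sqr_ge0 x2;
  have := sqr_ge0 y1; have := sqr_ge0 y2; lra.
Qed.

(** The factor |g|^2 on the left matches the bound 16 n^2 |g|^2 for the squared test function, so
    that the product of the two is controlled by [Pf] alone. *)
Lemma kapf_bound x y z A s de : 0 < A -> 0 <= de <= 2^-1 ->
  (A ^+ 2 + s ^+ 2) * sq (kapf x y z A s de) <= 2 * Pf x y z.
Proof.
move=> A0 /andP[de0 de1]; case: x => x1 x2; case: y => y1 y2; case: z => z1 z2.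
set M := A ^+ 2 + s ^+ 2.
have s20 : 0 <= s ^+ 2 by exact: sqr_ge0.
have A20 : 0 < A ^+ 2 by exact: exprn_gt0.
have M0 : 0 < M by rewrite /M; lra.
have Mn : M != 0 by rewrite gt_eqF.
pose S := (A * (x1 + y1) + s * z2) ^+ 2 + (A * (x2 + y2) - s * z1) ^+ 2.
have -> : M * sq (kapf (x1 +i* x2) (y1 +i* y2) (z1 +i* z2) A s de) = (4 * de ^+ 2) * (S / M).
  by rewrite /kapf /sq /S -/M /=; field.
have S0 : 0 <= S by rewrite addr_ge0 ?sqr_ge0.
have d1 : 4 * de ^+ 2 <= 1 by nra.
have SM0 : 0 <= S / M by rewrite divr_ge0// ltW.
apply: (@le_trans _ _ (S / M)); first by rewrite -[leRHS]mul1r ler_wpM2r.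
rewrite ler_pdivrMr//.
apply: (@le_trans _ _ (2 * (((x1 + y1) ^+ 2 + (x2 + y2) ^+ 2) + (z1 ^+ 2 + z2 ^+ 2)) * M)).
  rewrite -subr_ge0 /S /M [leRHS](_ : _ = (A * (x1 + y1) - s * z2) ^+ 2 +
    (A * (x2 + y2) + s * z1) ^+ 2 + 2 * (A ^+ 2 * (z1 ^+ 2 + z2 ^+ 2) + s ^+ 2 *
    ((x1 + y1) ^+ 2 + (x2 + y2) ^+ 2))); last by ring.
  apply: addr_ge0; first exact: sqD_ge0.
  by rewrite mulr_ge0//; apply: addr_ge0; apply: mulr_ge0; rewrite ?sqr_ge0 ?sqD_ge0.
rewrite ler_wpM2r ?(ltW M0)// ler_wpM2l// /Pf /sq /=.
have := sqr_ge0 (z1 + x1); have := sqr_ge0 (z2 + x2); have := sqr_ge0 (z1 - y1);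
  have := sqr_ge0 (z2 - y2); lra.
Qed.

Lemma Re_mul_young x y (e : R) : 0 < e ->
  `|2 * complex.Re (x * y)| <= e * sq x + e^-1 * sq y.
Proof.
move=> e0; case: x => a b; case: y => c d; rewrite /sq /=.
have en : e != 0 by rewrite gt_eqF.
rewrite ler_norml -subr_ge0 -[X in _ && X]subr_ge0; apply/andP; split.
  rewrite [leRHS](_ : _ = e^-1 * ((e * a + c) ^+ 2 + (e * b - d) ^+ 2)); last by field.
  by rewrite mulr_ge0 ?invr_ge0 ?(ltW e0)// addr_ge0 ?sqr_ge0.
rewrite [leRHS](_ : _ = e^-1 * ((e * a - c) ^+ 2 + (e * b + d) ^+ 2)); last by field.
by rewrite mulr_ge0 ?invr_ge0 ?(ltW e0)// addr_ge0 ?sqr_ge0.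
Qed.

Lemma sqM x y : sq (x * y) = sq x * sq y.
Proof. by case: x => a b; case: y => c d; rewrite /sq /=; ring. Qed.

Lemma sq_conj x : sq (conjc x) = sq x.
Proof. by case: x => a b; rewrite /sq /= sqrrN. Qed.

Lemma mul_conj x : x * conjc x = (sq x)%:C.
Proof. by case: x => a b; rewrite /sq; apply/eqP; rewrite eq_complex /=; apply/andP; split; apply/eqP; ring. Qed.

Lemma Pv_bound x y z (N : R) : 1 <= N ->
  sq ((2 * N)%:C * (x + y) - (x + y - z)) <= 8 * N ^+ 2 * Pf x y z.
Proof.
move=> N1; case: x => x1 x2; case: y => y1 y2; case: z => z1 z2.
apply: (@le_trans _ _ (8 * N ^+ 2 * (((x1 + y1) ^+ 2 + (x2 + y2) ^+ 2) + (z1 ^+ 2 + z2 ^+ 2)))).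
  rewrite /sq /=.
  have aux (a b : R) : ((2 * N - 1) * a + b) ^+ 2 <= 8 * N ^+ 2 * (a ^+ 2 + b ^+ 2).
    have N2 : 0 <= N ^+ 2 - 1 by nra.
    have := sqr_ge0 ((2 * N - 1) * a - b); have := mulr_ge0 N2 (sqr_ge0 b).
    have : 0 <= (8 * N ^+ 2 - 2 * (2 * N - 1) ^+ 2) * a ^+ 2.
      by rewrite mulr_ge0 ?sqr_ge0//; nra.
    have := sqr_ge0 b; lra.
  have := aux (x1 + y1) z1; have := aux (x2 + y2) z2.
  rewrite (_ : _ - _ - _ = (2 * N - 1) * (x1 + y1) + z1); last by ring.
  rewrite (_ : (2 * N) * (x2 + y2) + 0 * (x1 + y1) - (x2 + y2 - z2) = (2 * N - 1) * (x2 + y2) + z2); last by ring.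
  lra.
have N0 : 0 <= 8 * N ^+ 2 by exact: mulr_ge0 (sqr_ge0 N).
rewrite ler_wpM2l// /Pf /sq /=.
have := sqr_ge0 (z1 + x1); have := sqr_ge0 (z2 + x2); have := sqr_ge0 (z1 - y1);
  have := sqr_ge0 (z2 - y2); lra.
Qed.
End pointwise.

(** * Lebesgue measure on the Heisenberg group *)

Section translation.
Context (R : realType).

Lemma lebesgue_measure_translate (c : R) (A : set R) : measurable A ->
  lebesgue_measure ((fun x : R => x + c) @^-1` A) = lebesgue_measure A.
Proof.
move=> mA.
have mf : measurable_fun [set: measurableTypeR R] (fun x : measurableTypeR R => x + c : measurableTypeR R).
  by apply: measurable_funD => //; exact: measurable_cst.
pose mM : {measure set _ -> \bar R} := 
  measure_function_pushforward__canonical__measure_function_Measure (@lebesgue_measure R) mf.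
suff H : forall X, ocitv X -> lebesgue_measure X = mM X.
  exact: esym (@lebesgue_measure_unique R mM H A mA).
move=> _ [[a b] _ <-].
rewrite /mM /= /pushforward /=.
have -> : (fun x : R => x + c) @^-1` `]a, b]%classic = `]a - c, b - c]%classic.
  by apply/seteqP; split=> x /=; rewrite !in_itv/= ltrBlDr lerBrDr.
rewrite !lebesgue_measure_itv/= !lte_fin ltrD2r.
by case: ifP => // _; rewrite -!EFinB; congr (_%:E); ring.
Qed.

Lemma product_measure_preserving d1 d2 (T1 : measurableType d1) (T2 : measurableType d2)
    (m1 : {sigma_finite_measure set T1 -> \bar R})
    (m2 : {sigma_finite_measure set T2 -> \bar R}) (h1 : T1 -> T1) (h2 : T2 -> T2) :
  measurable_fun setT h1 -> measurable_fun setT h2 ->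
  (forall A, measurable A -> m1 (h1 @^-1` A) = m1 A) ->
  (forall A, measurable A -> m2 (h2 @^-1` A) = m2 A) ->
  measurable_fun setT (fun p => (h1 p.1, h2 p.2)) /\
  forall X, measurable X ->
    (m1 \x m2)%E ((fun p => (h1 p.1, h2 p.2)) @^-1` X) = (m1 \x m2)%E X.
Proof.
move=> mh1 mh2 H1 H2.
have mf : measurable_fun [set: T1 * T2] (fun p => (h1 p.1, h2 p.2)).
  apply/measurable_fun_pair; first exact: (measurableT_comp mh1 measurable_fst).
  exact: (measurableT_comp mh2 measurable_snd).
split=> // X mX.
pose mM : {measure set _ -> \bar R} := 
  measure_function_pushforward__canonical__measure_function_Measure (m1 \x m2)%E mf.
suff H : forall A B, measurable A -> measurable B ->
    mM (A `*` B) = (m1 A * m2 B)%E.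
  exact: esym (@product_measure_unique _ _ _ _ _ m1 m2 mM H X mX).
move=> A B mA mB; rewrite /mM /= /pushforward.
have -> : (fun p => (h1 p.1, h2 p.2)) @^-1` (A `*` B) = (h1 @^-1` A) `*` (h2 @^-1` B) by [].
have mA' : measurable (h1 @^-1` A) by rewrite -[h1 @^-1` A]setTI; exact: mh1.
have mB' : measurable (h2 @^-1` B) by rewrite -[h2 @^-1` B]setTI; exact: mh2.
rewrite product_measure1E//; congr (_ * _)%E; [exact: H1|exact: H2].
Qed.

Lemma measurable_rV_translate n (w : 'rV[R]_n) :
  measurable_fun setT (fun v : 'rV[R]_n => v + w).
Proof.
apply: measurable_fun_rV => i; under eq_fun do rewrite mxE.
apply: measurable_funD; [exact: measurable_rV_coord|exact: measurable_cst].
Qed.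

Lemma lebesgue_rV_translate n (w : 'rV[R]_n) (A : set 'rV[R]_n) : measurable A ->
  lebesgue_rV R n ((fun v => v + w) @^-1` A) = lebesgue_rV R n A.
Proof.
elim: n w A => [|n IH] w A mA.
  congr (lebesgue_rV R 0 _); apply/seteqP; split => v /=.
    by rewrite (_ : v + w = v)//; apply/rowP; case.
  by rewrite (_ : v + w = v)//; apply/rowP; case.
rewrite /= /lebesgue_rV_step /pushforward.
pose w0 := w 0 ord0; pose w1 : 'rV[R]_n := \row_j w 0 (lift ord0 j).
have mt : measurable_fun setT (fun x : measurableTypeR R => x + w0 : measurableTypeR R).
  by apply: measurable_funD => //; exact: measurable_cst.
have [mf E] := @product_measure_preserving _ _ _ _ (@lebesgue_measure R) (lebesgue_rV R n)
  (fun x : R => x + w0) (fun v => v + w1) mt (measurable_rV_translate w1)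
  (@lebesgue_measure_translate w0) (IH w1).
have mC : measurable (@rV_cons R n @^-1` A).
  by rewrite -[_ @^-1` A]setTI; exact: measurable_rV_cons.
rewrite -(E _ mC).
congr (product_measure1 _ _ _).
have E2 x v : rV_cons (x + w0, v + w1) = rV_cons (x, v) + w.
  by apply/rowP => j; rewrite !mxE; case: unliftP => [k|] ->; rewrite /= ?mxE.
by apply/seteqP; split=> -[x v] /=; rewrite E2.
Qed.

Section heis.
Context (n : nat).

(* The domain of heis_measure carries the display of measurableTypeR. *)
Local Notation mheis := (('rV[R]_n * 'rV[R]_n) * measurableTypeR R)%type.

(** Translation is Euclidean addition here, not the group law. This suffices because integration by
    parts is carried out for derivatives in constant directions. *)
Lemma heis_translate (w : heis R n) :
  measurable_fun [set: mheis] (fun p : mheis => (p + w : heis R n) : mheis) /\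
  forall A : set mheis, measurable A ->
    heis_measure R n ((fun p => p + w) @^-1` A) = heis_measure R n A.
Proof.
pose L := lebesgue_rV R n.
have [mf E] := @product_measure_preserving _ _ _ _ L L
  (fun v => v + w.1.1) (fun v => v + w.1.2) (measurable_rV_translate w.1.1)
  (measurable_rV_translate w.1.2) (@lebesgue_rV_translate n w.1.1)
  (@lebesgue_rV_translate n w.1.2).
pose xy_measure : set ('rV[R]_n * 'rV[R]_n) -> \bar R :=
  (lebesgue_rV R n \x lebesgue_rV R n)%E.
pose mxy := Measure.on xy_measure.
pose sxy := Measure_isSigmaFinite.Build _ _ _ xy_measure
  (product_measure_sigma_finite (lebesgue_rV R n) (lebesgue_rV R n)).
pose m : {sigma_finite_measure set _ -> \bar R} := HB.pack xy_measure mxy sxy.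
have mt : measurable_fun setT (fun x : measurableTypeR R => x + w.2 : measurableTypeR R).
  by apply: measurable_funD => //; exact: measurable_cst.
have [mf' E'] := @product_measure_preserving _ _ _ _ m (@lebesgue_measure R)
  (fun v => (v.1 + w.1.1, v.2 + w.1.2)) (fun x : R => x + w.2) mf mt E
  (@lebesgue_measure_translate w.2).
have -> : (fun p => p + w) = (fun p : heis R n => (p.1.1 + w.1.1, p.1.2 + w.1.2, p.2 + w.2)).
  by apply/funext => -[[x y] t]; case: w {E mf m mt mf' E'} => -[w1 w2] w3.
split; first exact: mf'.
exact: E'.
Qed.

(** Two sizes, since a Koranyi ball of radius r has horizontal extent r and vertical extent r^2. *)
Definition box (q : heis R n) (r s : R) : set (heis R n) :=
  ([set x : 'rV[R]_n | forall i, `[q.1.1 0 i - r, q.1.1 0 i + r]%classic (x 0 i)] `*`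
   [set x : 'rV[R]_n | forall i, `[q.1.2 0 i - r, q.1.2 0 i + r]%classic (x 0 i)]) `*`
  `[q.2 - s, q.2 + s]%classic.

Lemma measurable_rV_box (c : 'rV[R]_n) r :
  measurable [set x : 'rV[R]_n | forall i, `[c 0 i - r, c 0 i + r]%classic (x 0 i)].
Proof.
have -> : [set v : 'rV[R]_n | forall i, `[c 0 i - r, c 0 i + r]%classic (v 0 i)] =
      \bigcap_(i in [set: 'I_n])
        ((fun v : 'rV[R]_n => v 0 i) @^-1` `[c 0 i - r, c 0 i + r]%classic).
  by apply/seteqP; split => v /= Av i; [move=> _; exact: Av | exact: Av].
apply: fin_bigcap_measurable => // i _.
by rewrite -[X in measurable X]setTI; apply: measurable_rV_coord => //; exact: measurable_itv.
Qed.

Lemma measurable_box q r s : measurable (box q r s : set mheis).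
Proof.
apply: measurableX; last exact: measurable_itv.
by apply: measurableX; exact: measurable_rV_box.
Qed.

Lemma box_measure q r s : 0 < r -> 0 < s ->
  heis_measure R n (box q r s) = ((2 * r) ^+ n * (2 * r) ^+ n * (2 * s))%:E.
Proof.
move=> r0 s0.
have I (c x : R) : 0 < x -> lebesgue_measure (`[c - x, c + x]%classic : set R) = (2 * x)%:E.
  move=> x0; rewrite lebesgue_measure_itv/= lte_fin.
  rewrite ifT; last by lra.
  by rewrite -EFinB; congr (_%:E); ring.
have B (c : 'rV[R]_n) : lebesgue_rV R n
    [set x : 'rV[R]_n | forall i, `[c 0 i - r, c 0 i + r]%classic (x 0 i)] = ((2 * r) ^+ n)%:E.
  rewrite (@lebesgue_rV_box R n (fun i => `[c 0 i - r, c 0 i + r]%classic)); last first.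
    by move=> i; exact: measurable_itv.
  rewrite (eq_bigr (fun=> (2 * r)%:E)); last by move=> i _; exact: I.
  by rewrite prodEFin big_const_ord iter_mulr_1.
pose L := lebesgue_rV R n.
pose A1 := [set x : 'rV[R]_n | forall i, `[q.1.1 0 i - r, q.1.1 0 i + r]%classic (x 0 i)].
pose A2 := [set x : 'rV[R]_n | forall i, `[q.1.2 0 i - r, q.1.2 0 i + r]%classic (x 0 i)].
have mA1 : measurable A1 by exact: measurable_rV_box.
have mA2 : measurable A2 by exact: measurable_rV_box.
have mC : measurable (`[q.2 - s, q.2 + s]%classic : set R) by exact: measurable_itv.
have P : (L \x L)%E (A1 `*` A2) = ((2 * r) ^+ n * (2 * r) ^+ n)%:E.
  by rewrite product_measure1E// EFinM; congr (_ * _)%E; exact: B.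
transitivity ((L \x L)%E (A1 `*` A2) * lebesgue_measure (`[(q.2 - s)%R, (q.2 + s)%R]%classic : set R))%E.
  by apply: product_measure1E => //; exact: measurableX.
by rewrite P I// -EFinM.
Qed.

Lemma compact_box q r s : compact (box q r s).
Proof.
apply: compact_setX; last exact: segment_compact.
apply: compact_setX.
- by apply: (@rV_compact _ n (fun i => `[q.1.1 0 i - r, q.1.1 0 i + r]%classic)) => i; exact: segment_compact.
- by apply: (@rV_compact _ n (fun i => `[q.1.2 0 i - r, q.1.2 0 i + r]%classic)) => i; exact: segment_compact.
Qed.

Lemma nbhs_box (p : heis R n) (U : set (heis R n)) : nbhs p U ->
  exists2 e, 0 < e & box p e e `<=` U.
Proof.
move=> /nbhs_ballP[e /= e0 eU]; exists (e / 2); first by rewrite divr_gt0.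
move=> q [[/= q1 q2] q3]; apply: eU.
have aux (x y : R) : `[x - e / 2, x + e / 2]%classic y -> ball x e y.
  rewrite /= in_itv/= => /andP[h1 h2]; rewrite -ball_normE /= ltr_norml; apply/andP; split; lra.
split; last exact: aux q3.
by split; split => // i j; rewrite ord1; [exact: aux (q1 j)|exact: aux (q2 j)].
Qed.

(** An open set is the union of the countably many boxes with rational centre and size 1/(k+1) that
    it contains. *)
Lemma heis_open_measurable (U : set (heis R n)) : open U -> measurable (U : set mheis).
Proof.
move=> oU.
pose I := ((('rV[rat]_n * 'rV[rat]_n) * rat) * nat)%type.
pose qc (i : I) : heis R n := (map_mx ratr i.1.1.1, map_mx ratr i.1.1.2, ratr i.1.2).
pose e (i : I) : R := i.2.+1%:R^-1.
pose F (i : I) : set (heis R n) := if pselect (box (qc i) (e i) (e i) `<=` U)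
  then box (qc i) (e i) (e i) else set0.
have -> : U = \bigcup_i F i.
  apply/seteqP; split => p; last first.
    by move=> [i _]; rewrite /F; case: pselect => h //; exact: h.
  move=> Up; have /nbhs_box[r r0 rU] : nbhs p U by exact: open_nbhs_nbhs.
  (* A box of size d = 1/(k+1) about a rational point closer than d to p contains p and stays within
     2d < r of it. *)
  have /ltr_add_invr[k] : 0 < r / 2 by rewrite divr_gt0.
  rewrite add0r => kr; set d := k.+1%:R^-1 in kr.
  have d0 : 0 < d by rewrite invr_gt0.
  have q_of (x : R) : exists q : rat, x - d < ratr q < x + d.
    have /rat_in_itvoo[q] : x - d < x + d by lra.
    by rewrite in_itv/=; exists q.
  have /choice[q1 Q1] : forall i, exists q : rat, p.1.1 0 i - d < ratr q < p.1.1 0 i + d.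
    by move=> i; exact: q_of.
  have /choice[q2 Q2] : forall i, exists q : rat, p.1.2 0 i - d < ratr q < p.1.2 0 i + d.
    by move=> i; exact: q_of.
  have [q3 Q3] := q_of p.2.
  exists (((\row_i q1 i, \row_i q2 i), q3), k) => //.
  rewrite /F; case: pselect => [?|].
    split; [split=> i /=; rewrite !mxE|]; rewrite /= in_itv/= /e/= -/d.
    - move: (Q1 i) => /andP[? ?]; apply/andP; split; lra.
    - move: (Q2 i) => /andP[? ?]; apply/andP; split; lra.
    - move: (Q3) => /andP[? ?]; apply/andP; split; lra.
  case=> x [[/= x1 x2] x3]; apply: rU; split; [split=> i /=|]; rewrite /= in_itv/=.
  - have := x1 i; rewrite /= !mxE in_itv/= /e/= -/d => /andP[? ?].
    move: (Q1 i) => /andP[? ?]; apply/andP; split; lra.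
  - have := x2 i; rewrite /= !mxE in_itv/= /e/= -/d => /andP[? ?].
    move: (Q2 i) => /andP[? ?]; apply/andP; split; lra.
  - move: x3; rewrite /= in_itv/= /e/= -/d => /andP[? ?].
    move: (Q3) => /andP[? ?]; apply/andP; split; lra.
apply: countable_bigcupT_measurable; first exact: countableP.
move=> j; rewrite /F; case: pselect => ?; [exact: measurable_box|exact: measurable0].
Qed.

Lemma heis_continuous_measurable (f : heis R n -> R) : continuous f ->
  measurable_fun [set: mheis] f.
Proof.
move=> cf; apply: (measurability _ (RGenOInfty.measurableE R)) => //.
move=> _ [_ [a ->] <-]; rewrite setTI; apply: heis_open_measurable.
by apply: open_comp; [move=> p _; exact: cf|exact: interval_open].
Qed.
End heis.
End translation.

(** * Integration by parts *)

Section ibp.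
Context (R : realType) (n : nat).
Local Notation mheis := (('rV[R]_n * 'rV[R]_n) * measurableTypeR R)%type.
Local Notation mu := (heis_measure R n).
Implicit Types (p v : heis R n) (h k : heis R n -> R).

Lemma continuous_bounded_box h q r s : continuous h ->
  exists2 M : R, 0 <= M & forall p, box q r s p -> `|h p| <= M.
Proof.
move=> ch.
have /compact_bounded[M [Mr HM]] : compact (h @` box q r s).
  by apply: continuous_compact; [exact: continuous_subspaceT|exact: compact_box].
exists (`|M| + 1); first by rewrite addr_ge0.
move=> p bp; apply: (HM (`|M| + 1)).
  by rewrite (le_lt_trans (ler_norm _))// ltrDl.
by exists p.
Qed.

Lemma is_derive_quadratic (f : R -> R) (x d : R) :
  (forall y, `|f (x + y) - f x - d * y| <= y ^+ 2) -> is_derive x 1 f d.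
Proof.
move=> H.
have C : (fun y : R => y^-1 *: (f (y *: 1 + x) - f x)) @ 0^' --> d.
  apply/cvgrPdist_le => e e0; near=> y.
  have y0 : y != 0 by near: y; exact: nbhs_dnbhs_neq.
  have -> : d - y^-1 *: (f (y *: 1 + x) - f x) = - (y^-1 * (f (x + y) - f x - d * y)).
    by rewrite /GRing.scale /= mulr1 [y + x]addrC; field.
  rewrite normrN normrM normfV ler_pdivrMl ?normr_gt0//.
  apply: (le_trans (H y)); rewrite -real_normK ?num_real// expr2 ler_wpM2l//.
  near: y; exact: dnbhs0_le.
apply: DeriveDef; first by apply/cvg_ex; exists d.
by rewrite /derive; apply/cvg_lim.
Unshelve. all: by end_near. Qed.

Lemma integrable_supported h (M : R) q r s : 0 < r -> 0 < s -> measurable_fun [set: mheis] h ->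
  (forall p, `|h p| <= M * \1_(box q r s) p) -> mu.-integrable setT (EFin \o h).
Proof.
move=> r0 s0 mh hM.
have mb : measurable (box q r s : set mheis) by exact: measurable_box.
have bfin : (mu (box q r s) < +oo)%E by rewrite box_measure// ltry.
have I : mu.-integrable (box q r s) (EFin \o h).
  apply: measurable_bounded_integrable => //; first exact: measurable_funTS.
  exists `|M|; split; first exact: num_real.
  move=> x Mx p pB; have := hM p; rewrite indicE mem_set// mulr1 => h1.
  by rewrite /= (le_trans h1)// ltW// (le_lt_trans (ler_norm _)).
have -> : EFin \o h = (EFin \o h) \_ (box q r s).
  apply/funext => p; rewrite patchE; case: ifPn => // pB.
  have := hM p; rewrite indicE (negbTE pB) mulr0 normr_le0 => /eqP /= ->.
  by [].
exact: (iffLR (@integrable_mkcond _ mheis R mu (box q r s) (EFin \o h) mb) I).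
Qed.

(** Applied to c, this is c^2 extended by zero outside the set where c > 0. It is C^1, which is why
    the cutoffs below carry at least two powers of c. *)
Definition pos2 (x : R) : R := Num.max x 0 ^+ 2.

Lemma is_derive_pos2 (x : R) : is_derive x 1 pos2 (2 * Num.max x 0).
Proof.
apply: is_derive_quadratic => y; rewrite /pos2.
case: (leP x 0) => x0; case: (leP (x + y) 0) => xy0; rewrite ler_norml; apply/andP; split; nra.
Qed.

Variables (c : heis R n -> R) (r s : R).
Hypotheses (c_smooth : smooth c) (r0 : 0 < r) (s0 : 0 < s).
Let B := [set p | 0 < c p].
Hypothesis Bbox : B `<=` box 0 r s.

Lemma measurable_pos_set : measurable (B : set mheis).
Proof.
apply: heis_open_measurable.
have -> : B = c @^-1` [set x | x > 0] by [].
apply: open_comp; last exact: open_gt.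
by move=> p _; exact: smooth_continuous.
Qed.

Lemma integrable_pos_set h : continuous h -> mu.-integrable B (EFin \o h).
Proof.
move=> ch; apply: measurable_bounded_integrable.
- exact: measurable_pos_set.
- apply: (@le_lt_trans _ _ (mu (box 0 r s))); last by rewrite box_measure// ltry.
  apply: le_measure; rewrite ?inE//; [exact: measurable_pos_set|exact: measurable_box].
- by apply: measurable_funTS; exact: heis_continuous_measurable.
- have [M M0 HM] := continuous_bounded_box 0 r s ch.
  exists M; split; first exact: num_real.
  by move=> x Mx p /Bbox /HM hM; rewrite /= (le_trans hM)// ltW.
Qed.

Variables (k : heis R n -> R) (v : heis R n).
Hypothesis k_smooth : smooth k.

Let K p := pos2 (c p) * k p.
Let dK p := if 0 < c p then 'D_v (fun q => c q ^+ 2 * k q) p else 0.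

Lemma cutoff_derive p : differentiable K p /\ 'D_v K p = dK p.
Proof.
have [d1 D1] := derive_comp1 v (smooth_differentiable p c_smooth) (is_derive_pos2 (c p)).
have d2 := smooth_differentiable p k_smooth.
have dc := smooth_differentiable p c_smooth.
split; first by apply: differentiableM.
rewrite -[LHS]/('D_v ((pos2 \o c) * k) p).
rewrite deriveM; [|exact: diff_derivable|exact: diff_derivable].
rewrite D1 /dK /= /pos2.
have -> : 'D_v (fun q => c q ^+ 2 * k q) p =
    c p ^+ 2 * 'D_v k p + k p * (c p * 'D_v c p + c p * 'D_v c p).
  have cc := smoothM c_smooth c_smooth.
  rewrite -(derive_mul v p c_smooth c_smooth) -[c p ^+ 2]/(c p * c p).
  by rewrite -(derive_mul v p cc k_smooth).
case: ltP => cp; rewrite /GRing.scale /=.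
  by ring.
by rewrite expr0n /= mulr0 !mul0r mulr0 addr0.
Qed.

Lemma cutoff_bounded : exists2 M, 0 <= M & forall p, `|K p| <= M /\ `|dK p| <= M.
Proof.
have cK : continuous K by move=> p; apply: differentiable_continuous; have [] := cutoff_derive p.
have sD : smooth (fun q => c q ^+ 2 * k q).
  exact: smoothM (smoothM c_smooth c_smooth) k_smooth.
have [M M0 HM] := continuous_bounded_box 0 r s cK.
have [N N0 HN] := continuous_bounded_box 0 r s (smooth_continuous (smooth_derive v sD)).
exists (M + N); first exact: addr_ge0.
move=> p; have [cp|cp] := ltP 0 (c p).
  have bp := Bbox cp; split.
    by rewrite (le_trans (HM _ bp))// lerDl.
  by rewrite /dK cp (le_trans (HN _ bp))// lerDr.
rewrite /dK /K /pos2 ltNge cp /= (max_idPr cp) expr0n /= mul0r normr0.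
by rewrite addr_ge0.
Qed.

Lemma cutoff_out p : ~ B p -> K p = 0.
Proof.
by move=> /negP; rewrite -leNgt => cp; rewrite /K /pos2 (max_idPr cp) expr0n /= mul0r.
Qed.

(** The l^1 norm of v: shifts by tv with 0 <= t <= 1 keep the support in the box enlarged by [L],
    which gives one dominating function for all difference quotients. *)
Let L := \sum_i `|v.1.1 0 i| + \sum_i `|v.1.2 0 i| + `|v.2|.

Lemma box_shift p (t : R) : 0 <= t <= 1 -> box 0 r s (p + t *: v) -> box 0 (r + L) (s + L) p.
Proof.
move=> /andP[t0 t1].
have S0 (w : 'rV[R]_n) : 0 <= \sum_i `|w 0 i| by apply: sumr_ge0.
have Sle (w : 'rV[R]_n) i : `|w 0 i| <= \sum_i `|w 0 i|.
  by rewrite (bigD1 i)//= lerDl; apply: sumr_ge0.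
have aux (x y z e : R) : `|y| <= z -> `[0 - e, 0 + e]%classic (x + t * y) ->
    `[0 - (e + z), 0 + (e + z)]%classic x.
  move=> yz; rewrite /= !in_itv/= => /andP[h1 h2].
  have : `|t * y| <= z.
    rewrite normrM (ger0_norm t0); apply: le_trans yz.
    by rewrite -[leRHS]mul1r ler_wpM2r.
  by rewrite ler_norml => /andP[? ?]; apply/andP; split; lra.
case=> -[b1 b2] b3; split; [split=> i|].
- have := b1 i; rewrite !mxE; apply: aux; rewrite (le_trans (Sle _ _))//.
  by rewrite /L -addrA lerDl addr_ge0.
- have := b2 i; rewrite !mxE; apply: aux; rewrite (le_trans (Sle _ _))//.
  by rewrite /L addrAC lerDr addr_ge0.
- by apply: aux b3; rewrite /L lerDr addr_ge0.
Qed.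

Let D (m : nat) p := m.+1%:R * (K (p + m.+1%:R^-1 *: v) - K p).

Lemma quotient_bounded M : (forall p, `|dK p| <= M) ->
  forall m p, `|D m p| <= M * \1_(box 0 (r + L) (s + L)) p.
Proof.
move=> HM m p; rewrite indicE; have m0 : 0 < m.+1%:R^-1 :> R by rewrite invr_gt0.
have m1 : m.+1%:R^-1 <= 1 :> R by rewrite invf_le1// ler1n.
case: (boolP (p \in _)) => [_|/negP pB].
  rewrite mulr1 /D.
  have [c' _ ->] := @mean_value_line R _ K p v _ (fun q => (cutoff_derive q).1) m0.
  by rewrite (cutoff_derive _).2 mulrCA mulfV ?mulr1 ?pnatr_eq0.
rewrite mulr0 /D !cutoff_out ?subrr ?mulr0 ?normr0//.
  move=> /Bbox bp; apply: pB; rewrite inE; apply: (@box_shift p 0).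
    by rewrite lexx ler01.
  by rewrite scale0r addr0.
move=> /Bbox bp; apply: pB; rewrite inE; apply: box_shift bp.
by rewrite ltW.
Qed.

Lemma quotient_cvg p : D m p @[m --> \oo] --> dK p.
Proof.
have [dp <-] := cutoff_derive p.
have /cvg_ex[l Hl] := @diff_derivable _ _ _ K p v dp.
have -> : 'D_v K p = l by apply/cvg_lim.
apply/cvgrPdist_lt => e e0.
move/cvgrPdist_lt : Hl => /(_ e e0) /nbhs_ballP[d /= d0 Hd].
have /cvgrPdist_lt/(_ d d0)[N _ HN] := @cvg_harmonic R.
exists N => // m /HN; rewrite /= sub0r normrN => md.
have := Hd m.+1%:R^-1; rewrite /= /ball /= sub0r normrN => /(_ md).
rewrite invr_neq0 ?pnatr_eq0// => /(_ isT).
by rewrite invrK /D /GRing.scale /= [_ + p]addrC.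
Qed.

Lemma cutoff_continuous : continuous K.
Proof. by move=> p; apply: differentiable_continuous; have [] := cutoff_derive p. Qed.

Lemma cutoff_supported M (t : R) : (forall p, `|K p| <= M) -> 0 <= t <= 1 ->
  forall p, `|K (p + t *: v)| <= M * \1_(box 0 (r + L) (s + L)) p.
Proof.
move=> HM t01 p; rewrite indicE; case: (boolP (p \in _)) => [_|/negP pB].
  by rewrite mulr1.
rewrite mulr0 cutoff_out ?normr0// => /Bbox bp; apply: pB; rewrite inE.
exact: box_shift bp.
Qed.

Let rL : 0 < r + L.
Proof. by rewrite ltr_pwDl// !addr_ge0//; apply: sumr_ge0. Qed.
Let sL : 0 < s + L.
Proof. by rewrite ltr_pwDl// !addr_ge0//; apply: sumr_ge0. Qed.

Let mK (w : heis R n) : measurable_fun [set: mheis] (fun p : mheis => K (p + w)).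
Proof.
have [mt _] := heis_translate w.
exact: (measurableT_comp (heis_continuous_measurable cutoff_continuous) mt).
Qed.

Lemma cutoff_integrable (t : R) : 0 <= t <= 1 ->
  mu.-integrable setT (EFin \o (fun p => K (p + t *: v))).
Proof.
move=> t01; have [M _ HM] := cutoff_bounded.
apply: (@integrable_supported _ M 0 (r + L) (s + L) rL sL); first exact: mK.
by apply: cutoff_supported => // p; have [] := HM p.
Qed.

Lemma integral_translate (t : R) : 0 <= t <= 1 ->
  (\int[mu]_p (K (p + t *: v))%:E = \int[mu]_p (K p)%:E)%E.
Proof.
move=> t01; have [mt E] := heis_translate (t *: v).
have mK0 : measurable_fun [set: mheis] (EFin \o K).
  apply/measurable_EFinP; exact: (heis_continuous_measurable cutoff_continuous).
have I := @integral_pushforward _ _ mheis mheis R (fun p : mheis => (p + t *: v : heis R n) : mheis) mt mu setT (EFin \o K) mK0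
  (cutoff_integrable t01) measurableT.
rewrite preimage_setT in I; rewrite -[LHS]I.
apply: eq_measure_integral => A mA _; exact: E.
Qed.

Lemma quotient_integral m : (\int[mu]_p (D m p)%:E = 0)%E.
Proof.
have t01 : 0 <= (m.+1%:R^-1 : R) <= 1 by rewrite invr_ge0 ler0n invf_le1// ler1n.
have i0 : mu.-integrable setT (EFin \o K).
  have : mu.-integrable setT (EFin \o (fun p => K (p + 0 *: v))).
    by apply: cutoff_integrable; rewrite lexx ler01.
  by apply: eq_integrable => // p _ /=; rewrite scale0r addr0.
have i1 := cutoff_integrable t01.
transitivity (m.+1%:R%:E * \int[mu]_p ((K (p + m.+1%:R^-1 *: v))%:E - (K p)%:E))%E.
  rewrite -integralZl//; last exact: integrableB.
rewrite integralB_EFin// integral_translate// subee ?mule0//.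
exact: integrable_fin_num.
Qed.

(** By translation invariance each difference quotient of the cut-off function has integral zero,
    and dominated convergence passes this on to the derivative; no boundary term on the ball has to
    be considered. *)
Lemma integral_derive_cutoff :
  Rintegral mu B (fun p => 'D_v (fun q => c q ^+ 2 * k q) p) = 0.
Proof.
have [M M0 HM] := cutoff_bounded.
have mD m : measurable_fun [set: mheis] (D m).
  apply: measurable_funM; first exact: measurable_cst.
  apply: measurable_funB; first exact: mK.
  by have := mK 0; under eq_fun do rewrite addr0.
have mdK : measurable_fun [set: mheis] dK.
  by apply: (measurable_fun_cvg mD) => p _; exact: quotient_cvg.
have i1 : mu.-integrable setT (EFin \o (fun p => M * \1_(box 0 (r + L) (s + L)) p)).
  apply: (@integrable_supported _ M 0 (r + L) (s + L) rL sL).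
    apply: measurable_funM; first exact: measurable_cst.
    exact: (@measurable_indic _ mheis R setT _ (measurable_box _ _ _)).
  by move=> p; rewrite ger0_norm// mulr_ge0// indicE ler0n.
have [] := @dominated_convergence _ _ _ mu setT measurableT (fun m p => (D m p)%:E)
  (EFin \o dK) (EFin \o (fun p => M * \1_(box 0 (r + L) (s + L)) p)).
- by move=> m; apply/measurable_EFinP; exact: mD.
- exact/measurable_EFinP.
- apply: aeW => p _; apply/fine_cvgP; split; first by near=> m.
  exact: quotient_cvg.
- exact: i1.
- apply: aeW => p m _ /=; rewrite lee_fin; apply: quotient_bounded.
  by move=> q; have [] := HM q.
move=> _ _; under eq_fun do rewrite quotient_integral.
move=> /cvg_lim; rewrite lim_cst// => E.
rewrite Rintegral_mkcond /Rintegral.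
rewrite (_ : (\int[mu]_p _)%E = 0%E)// [RHS]E//.
by apply: eq_integral => p _; rewrite patchE /= /dK mem_setE.
Unshelve. all: by end_near. Qed.

End ibp.

(** * The logarithm of the solution *)

Section heis_instance.
Context (R : realType) (n : nat).
Local Notation sm := (sm (heis R n)).
Implicit Types (F G K : sm) (p v : heis R n).
Local Notation I := (ii R n).

Lemma heis_calculus_sm : heis_calculus (@ZZ R n) (@ZB R n) (@TT R n) (@cj R (heis R n)) I.
Proof.
split.
- exact: ZZD. - exact: ZZM. - exact: ZBD. - exact: ZBM. - exact: TTD. - exact: TTM.
- exact: cjD. - exact: cjM. - exact: cjK. - exact: ii2. - exact: cj_ii.
- by move=> a; exact: ZZ_cst.
- by move=> a; exact: ZB_cst.
- exact: TT_cst.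
- exact: ZZ_cj. - exact: ZB_cj. - exact: TT_cj.
- exact: ZZ_comm. - exact: ZB_ZZ. - exact: TT_ZZ. - exact: TT_ZB.
Qed.

(** The fields combine directional derivatives with function coefficients, so a chain rule valid in
    every direction carries over. The shape with K, K1, K2 is that of the derivative of the
    weight. *)
Lemma ZZ_linear F G1 G2 (K K1 K2 : sm) :
  (forall v, dv v F = K * (K1 * dv v G1 + K2 * dv v G2)) ->
  (forall a, ZZ a F = K * (K1 * ZZ a G1 + K2 * ZZ a G2)) /\
  TT F = K * (K1 * TT G1 + K2 * TT G2).
Proof. by move=> H; split=> [a|]; rewrite /ZZ /TT ?H//; ring. Qed.

Lemma real_part F p : cj F = F -> F p = (complex.Re (F p))%:C.
Proof.
move=> /(congr1 (fun G : sm => G p)) /=; case: (F p) => a b /= [] /eqP.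
by rewrite -subr_eq0 -opprD oppr_eq0 -mulr2n mulrn_eq0 /= => /eqP ->.
Qed.

Context (u : heis R n -> R) (us : smooth u) (u0 : forall p, 0 < u p).
Hypothesis hn : (0 < n)%N.

Let n0 : n%:R != 0 :> R. Proof. by rewrite pnatr_eq0 -lt0n. Qed.

Lemma logu_smooth : smooth (fun p => n%:R^-1 * ln (u p)).
Proof. by apply: smoothM; [exact: smooth_cst|exact: (smooth_ln u0 us).1]. Qed.

Lemma phi_smooth : smooth (fun p => 4^-1 * u p `^ (2 / n%:R)).
Proof. by apply: smoothM; [exact: smooth_cst|exact: smooth_powR]. Qed.

Definition uS := sreal us.
Definition fS := sreal logu_smooth.
Definition phiS := sreal phi_smooth.

Lemma dv_fS v p : dv v fS p = (n%:R^-1 * (u p)^-1 * 'D_v u p)%:C.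
Proof.
rewrite dv_real /= (derive_mul v p (smooth_cst _ _) (smooth_ln u0 us).1).
by rewrite (smooth_ln u0 us).2 derive_cst mulr0 addr0 mulrA.
Qed.

Lemma dv_uS v : dv v uS = n%:R * uS * dv v fS.
Proof.
apply: smP => p; rewrite !smM dv_fS sm_nat dv_real /=.
rewrite -(rmorph_nat (real_complex R)) -!rmorphM /=; congr (_%:C).
by have := u0 p; move=> /gt_eqF/negbT up; field; rewrite up n0.
Qed.

Lemma dv_phiS v : dv v phiS = phiS * dv v fS *+ 2.
Proof.
rewrite -mulr_natr; apply: smP => p; rewrite !smM dv_fS sm_nat dv_real /=.
rewrite -(rmorph_nat (real_complex R)) -!rmorphM /=; congr (_%:C).
rewrite (derive_mul v p (smooth_cst _ _) (smooth_powR _ u0 us)).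
rewrite derive_cst mulr0 addr0 derive_powR//.
have up := gt_eqF (u0 p); rewrite powRD; last by rewrite up implybT.
rewrite powR_inv1 ?ltW//.
by field; rewrite up n0.
Qed.

Lemma ZZ_uS a : ZZ a uS = n%:R * uS * ZZ a fS.
Proof. by rewrite /ZZ /TT !dv_uS; ring. Qed.

Lemma ZB_uS a : ZB a uS = n%:R * uS * ZB a fS.
Proof. by rewrite /ZB /TT !dv_uS; ring. Qed.

Lemma ZZ_phiS a : ZZ a phiS = phiS * ZZ a fS *+ 2.
Proof. by rewrite /ZZ /TT !dv_phiS; ring. Qed.

Lemma TT_phiS : TT phiS = phiS * TT fS *+ 2.
Proof. by rewrite /TT dv_phiS. Qed.

Lemma fS_real : cj fS = fS. Proof. exact: cj_real. Qed.
Lemma phiS_real : cj phiS = phiS. Proof. exact: cj_real. Qed.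

Local Notation gS := (jlg (@ZZ R n) (@TT R n) (@cj R (heis R n)) I fS phiS).
Local Notation gradS := (gradsq (@ZZ R n) (@cj R (heis R n)) fS).

Hypothesis u_sol : forall p,
  4 * sublaplacian u p = n%:R ^+ 2 * u p `^ ((n%:R + 2) / n%:R).

(** The given equation fixes only the real part of the sum. The commutator of Zbar_a and Z_a
    supplies the imaginary part n Tf, and together they form -n g. *)
Lemma pde_sm : \sum_a ZB a (ZZ a fS) = - (n%:R * gS).
Proof.
pose S := \sum_a ZB a (ZZ a fS).
have H := heis_calculus_sm.
have cS : cj S = S - (n%:R * (I * TT fS)) *+ 2.
  have -> : cj S = \sum_a (ZB a (ZZ a fS) - (I * TT fS) *+ 2).
    rewrite /S (big_morph (@cj R (heis R n)) (@cjD _ _) (@cj0 _ _)).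
    apply: eq_bigr => a _; rewrite -ZZ_cj.
    have := hcZbcj H a fS; have := hcZcj H a fS; rewrite fS_real => e1 e2.
    rewrite -e2 (hcZbZ H a a) eqxx /=; ring.
  by rewrite sumrB sumr_const card_ord -/S -[_ *+ n]mulr_natl mulrnAr.
have rS p : complex.Re (S p) = - (n%:R * (complex.Re (gradS p) + 4^-1 * u p `^ (2 / n%:R))).
  have := u_sol p; rewrite /sublaplacian.
  have -> : \sum_a ZbarH a (ZH a (fun q => (u q)%:C)) p = (\sum_a ZB a (ZZ a uS)) p.
    rewrite sm_sum; apply: eq_bigr => a _; rewrite ZBE; congr (ZbarH a _ p).
    by apply/funext => q; rewrite ZZE.
  have -> : \sum_a ZB a (ZZ a uS) = n%:R * uS * (n%:R * gradS + S).
    rewrite /gradsq /S mulr_sumr -big_split mulr_sumr /=; apply: eq_bigr => a _.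
    have := hcZbcj H a fS; rewrite fS_real => e2.
    rewrite ZZ_uS ZBM ZBM ZB_uS (_ : ZB a n%:R = 0); last by rewrite -scst_nat ZB_cst.
    by rewrite /fzb /fz -e2; ring.
  rewrite !smM smD smM !sm_nat.
  have -> : (n%:R : R[i]) * uS p = (n%:R * u p)%:C by rewrite rmorphM /= rmorph_nat.
  have -> : (n%:R : R[i]) = (n%:R)%:C by rewrite rmorph_nat.
  rewrite cReM cReD cReM /= !mul0r !subr0.
  have up := gt_eqF (u0 p).
  have -> : u p `^ ((n%:R + 2) / n%:R) = u p * u p `^ (2 / n%:R).
    rewrite mulrDl divff// powRD; last by rewrite up implybT.
    by rewrite powRr1// ltW.
  have nu : n%:R * u p != 0 by rewrite mulf_neq0// up.
  move=> E; apply: (mulfI nu); apply: (mulfI (_ : 4 != 0 :> R)); first by rewrite pnatr_eq0.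
  lra.
apply: smP => p.
have g_real : cj gradS = gradS by apply: (gradsq_real H); exact: fS_real.
have t_real : cj (TT fS) = TT fS by rewrite -TT_cj fS_real.
have cSp : cj S p = S p - n%:R * ('i%C * TT fS p) * 2%:R.
  by rewrite cS -mulr_natr smD smN !smM !sm_nat.
have := rS p; have := real_part p t_real; have := real_part p g_real.
have := congr1 (@complex.Im R) cSp; rewrite cImD cImN -[cj S p]/(conjc (S p)).
rewrite -/S smN smM /jlg /rg smD smN smD smM /f0 sm_nat -[I p]/('i%C).
rewrite -[phiS p]/((4^-1 * u p `^ (2 / n%:R))%:C).
move: (complex.Re (TT fS p)) (complex.Re (gradS p)) (4^-1 * u p `^ (2 / n%:R)) => t a b.
have -> : (n%:R : R[i]) = (n%:R)%:C by rewrite rmorph_nat.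
have -> : (2%:R : R[i]) = (2%:R)%:C by rewrite rmorph_nat.
move=> E1 -> E2; move: E1; rewrite {}E2.
by case: (S p) => c d /= E1 E2; apply: complex_eqP => /=; rewrite ?E2; lra.
Qed.

End heis_instance.

(** * The weighted identity *)

Section cauchy_schwarz.
Context (R : realType).

(** Expansion of the nonnegative sum of |Y x_b - c conj(y_b)|^2, with Y the second factor on the
    right and c the sum on the left; the case Y = 0 is separate. *)
Lemma sq_sum_mul (I : finType) (x y : I -> R[i]) :
  sq (\sum_b x b * y b) <= (\sum_b sq (x b)) * (\sum_b sq (y b)).
Proof.
set X := \sum_b sq (x b); set Y := \sum_b sq (y b); set c := \sum_b x b * y b.
have Y0 : 0 <= Y by apply: sumr_ge0 => b _; exact: sq_ge0.
have aux (r : R) (k : R[i]) : \sum_b sq (r%:C * x b - k * conjc (y b)) =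
     r ^+ 2 * (\sum_b sq (x b)) - 2 * r * complex.Re (conjc k * \sum_b x b * y b)
     + sq k * \sum_b sq (y b).
  rewrite [conjc k * _]mulr_sumr (big_morph (@complex.Re R) (@cReD R) (erefl _)) !mulr_sumr -sumrB -big_split /=.
  apply: eq_bigr => b _; case: (x b) => x1 x2; case: (y b) => y1 y2.
  by case: k => c1 c2; rewrite /sq /=; ring.
have E : \sum_b sq (Y%:C * x b - c * conjc (y b)) = Y * (X * Y - sq c).
  by rewrite aux -/X -/Y -/c [conjc c * c]mulrC mul_conj /=; ring.
have : 0 <= Y * (X * Y - sq c) by rewrite -E; apply: sumr_ge0 => b _; exact: sq_ge0.
case: (eqVneq Y 0) => [YE|Yn].
  have y0 b : y b = 0.
    have /eqP := YE; rewrite psumr_eq0; last by move=> *; exact: sq_ge0.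
    move=> /allP/(_ b); rewrite mem_index_enum => /(_ isT).
    case: (y b) => y1 y2; rewrite /sq /= paddr_eq0 ?sqr_ge0// !sqrf_eq0.
    by move=> /andP[/eqP-> /eqP->].
  have -> : c = 0 by rewrite /c big1// => b _; rewrite y0 mulr0.
  by rewrite YE mulr0 /sq /= expr0n /= addr0.
by rewrite pmulr_rge0 ?subr_ge0// lt_neqAle eq_sym Yn.
Qed.

End cauchy_schwarz.

Section weighted.
Context (R : realType) (n : nat) (hn : (2 <= n)%N).
Local Notation sm := (sm (heis R n)).
Local Notation I := (ii R n).
Local Notation cj := (@cj R (heis R n)).
Local Notation Z := (@ZZ R n).
Local Notation Zb := (@ZB R n).
Local Notation T := (@TT R n).
Implicit Types (p v : heis R n).

Variables (f phi : sm).
Hypotheses (f_real : cj f = f) (phi_real : cj phi = phi).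
Hypothesis Zphi : forall a, Z a phi = (phi * Z a f) *+ 2.
Hypothesis Tphi : T phi = (phi * T f) *+ 2.
Local Notation g := (jlg Z T cj I f phi).
Local Notation gb := (jlgb Z T cj I f phi).
Hypothesis pde : \sum_a Zb a (Z a f) = - (n%:R * g).
Hypothesis phi_gt0 : forall p, 0 < complex.Re (phi p).

Local Notation fz := (fz Z f).
Local Notation grad := (gradsq Z cj f).
Local Notation rg := (rg Z cj f phi).
Local Notation D := (Dv Z cj f).
Local Notation E := (Ev Z Zb T cj I f phi).
Local Notation G := (Gv Z T cj I f phi).
Local Notation Dt := (Dt Z f).
Local Notation Et := (Et Z Zb T cj I f phi).
Local Notation V := (Vv Z Zb T cj I f phi).
Local Notation H := (heis_calculus_sm R n).

Definition aR p := \sum_a sq (fz a p).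
Definition phR p := complex.Re (phi p).
Definition sR p := complex.Re (T f p).
Definition AR p := aR p + phR p.
Definition mR p := AR p ^+ 2 + sR p ^+ 2.
Definition nER p := \sum_a \sum_b sq (Et a b p).
Definition nDR p := \sum_a \sum_b sq (Dt a b p).
Definition PfR p := \sum_a Pf (D a p) (E a p) (G a p).

Lemma aR_ge0 p : 0 <= aR p. Proof. by apply: sumr_ge0 => a _; exact: sq_ge0. Qed.
Lemma phR_gt0 p : 0 < phR p. Proof. exact: phi_gt0. Qed.
Lemma AR_gt0 p : 0 < AR p. Proof. by rewrite ltr_wpDl ?aR_ge0 ?phR_gt0. Qed.
Lemma mR_gt0 p : 0 < mR p.
Proof. by rewrite ltr_pwDl ?sqr_ge0 ?exprn_gt0 ?AR_gt0. Qed.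

Lemma phiE p : phi p = (phR p)%:C. Proof. exact: real_part. Qed.
Lemma TfE p : T f p = (sR p)%:C. Proof. by apply: real_part; rewrite -TT_cj f_real. Qed.

Lemma rsum (J : finType) (F : J -> R) : ((\sum_j F j)%:C : R[i]) = \sum_j (F j)%:C.
Proof. exact: rmorph_sum. Qed.

Lemma gradE p : grad p = (aR p)%:C.
Proof. by rewrite sm_sum rsum; apply: eq_bigr => a _; rewrite smM mul_conj. Qed.

Lemma rgE p : rg p = (AR p)%:C.
Proof. by rewrite /AR /rg smD gradE phiE rmorphD. Qed.

Lemma gE p : g p = (AR p)%:C - 'i%C * (sR p)%:C.
Proof. by rewrite /jlg smD smN smM rgE -TfE. Qed.

Lemma gbE p : gb p = (AR p)%:C + 'i%C * (sR p)%:C.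
Proof. by rewrite /jlgb smD smM rgE -TfE. Qed.

Lemma ggbE p : (g * gb) p = (mR p)%:C.
Proof. by rewrite smM gE gbE /mR; apply: complex_eqP => /=; ring. Qed.

Lemma smooth_aR : smooth aR.
Proof.
have [h _] := sm_smooth grad; suff -> : aR = (fun p => complex.Re (grad p)) by [].
by apply/funext => p; rewrite gradE.
Qed.
Lemma smooth_phR : smooth phR. Proof. by have [] := sm_smooth phi. Qed.
Lemma smooth_sR : smooth sR. Proof. by have [] := sm_smooth (T f). Qed.
Lemma smooth_AR : smooth AR. Proof. exact: smoothD smooth_aR smooth_phR. Qed.
Lemma smooth_mR : smooth mR.
Proof. exact: smoothD (smoothM smooth_AR smooth_AR) (smoothM smooth_sR smooth_sR). Qed.

Variable de : R.
Hypotheses (de0 : 0 <= de) (de1 : de < 2^-1).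

(* For de = 0 this is the weight phi^(n-1) of Jerison and Lee; mR is |jlg|^2,
   and the factor |jlg|^(-2 de) absorbs the missing decay of u. *)
Definition wR p := phR p `^ (n%:R - 1 + de) * mR p `^ (- de).

Lemma smooth_wR : smooth wR.
Proof.
exact: smoothM (smooth_powR _ phR_gt0 smooth_phR) (smooth_powR _ mR_gt0 smooth_mR).
Qed.

Lemma wR_gt0 p : 0 < wR p.
Proof. by rewrite mulr_gt0// powR_gt0// ?phR_gt0 ?mR_gt0. Qed.

Definition weight : sm := sreal smooth_wR.

(** [dphi_coef] and [dm_coef] are the partial derivatives of log w with respect to phi and |g|^2,
    with inverses written as powers -1. *)
Definition dphi_coef : sm := scst _ (n%:R - 1 + de)%:C * sreal (smooth_powR (- 1) phR_gt0 smooth_phR).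
Definition dm_coef : sm := scst _ (- de)%:C * sreal (smooth_powR (- 1) mR_gt0 smooth_mR).

Lemma dphi_coefE p : dphi_coef p = ((n%:R - 1 + de) * (phR p)^-1)%:C.
Proof. by rewrite smM /= powR_inv1 ?ltW ?phR_gt0// rmorphM. Qed.
Lemma dm_coefE p : dm_coef p = (- de * (mR p)^-1)%:C.
Proof. by rewrite smM /= powR_inv1 ?ltW ?mR_gt0// rmorphM. Qed.

Lemma dv_realE (F : sm) v p : cj F = F ->
  dv v F p = ('D_v (fun q => complex.Re (F q)) p)%:C.
Proof.
move=> rF; have r : cj (dv v F) = dv v F by rewrite -dv_cj rF.
by rewrite (real_part p r).
Qed.

Lemma dv_weight v : dv v weight = weight * (dphi_coef * dv v phi + dm_coef * dv v (g * gb)).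
Proof.
apply: smP => p; rewrite dv_real !(dphi_coefE, dm_coefE, smM, smD) (dv_realE _ _ phi_real).
have rgg : cj (g * gb) = g * gb.
  by apply: smP => q; rewrite -[LHS]/(conjc ((g * gb) q)) ggbE /= oppr0.
rewrite (dv_realE _ _ rgg).
have -> : (fun q => complex.Re ((g * gb) q)) = mR by apply/funext => q; rewrite ggbE.
rewrite -[weight p]/((wR p)%:C) -[LHS]/(('D_v wR p)%:C) -[fun q => complex.Re (phi q)]/phR.
rewrite -!rmorphM -rmorphD -rmorphM /=; congr (_%:C).
have s1 := smooth_powR (n%:R - 1 + de) phR_gt0 smooth_phR.
have s2 := smooth_powR (- de) mR_gt0 smooth_mR.
rewrite (derive_mul v p s1 s2).
rewrite (derive_powR _ _ _ phR_gt0 smooth_phR) (derive_powR _ _ _ mR_gt0 smooth_mR).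
have p0 := gt_eqF (phR_gt0 p); have m0 := gt_eqF (mR_gt0 p).
rewrite [phR p `^ (_ - 1)]powRD; last by rewrite p0 implybT.
rewrite [mR p `^ (_ - 1)]powRD; last by rewrite m0 implybT.
rewrite !powR_inv1 ?ltW ?phR_gt0 ?mR_gt0// /wR.
by ring.
Qed.

Definition kap a : sm := dm_coef * ((D a + E a - G a) * gb + (D a + E a + G a) * g).

(** The power of phi contributes 2(n-1+de) Zf and the power of |g|^2 contributes -2 de Zf plus
    tensor terms, because Zg = 2g Zf up to tensors. The de parts cancel: the leading coefficient is
    that of phi^(n-1), and [kap] is linear in D, E, G. *)
Lemma Z_weight a : Z a weight = weight * ((2 * (n%:R - 1)) * fz a + kap a).
Proof.
have [ZWa _] := ZZ_linear dv_weight.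
rewrite ZWa ZZM (Z_jlg H f_real phi_real Zphi) (Z_jlgb H f_real phi_real Zphi) Zphi -/(fz a).
congr (weight * _).
have e1 : dphi_coef * phi = scst _ (n%:R - 1 + de)%:C.
  apply: smP => p; rewrite smM dphi_coefE phiE -rmorphM /= mulfVK//.
  by rewrite gt_eqF// phR_gt0.
have e2 : dm_coef * (g * gb) = scst _ (- de)%:C.
  apply: smP => p; rewrite smM dm_coefE ggbE -rmorphM /= mulfVK//.
  by rewrite gt_eqF// mR_gt0.
have e3 : scst _ (n%:R - 1 + de)%:C + scst _ (- de)%:C = n%:R - 1 :> sm.
  apply: smP => p; rewrite !smD smN sm1 sm_nat /= -rmorphD /=.
  by rewrite -addrA subrr addr0 rmorphB /= rmorph_nat.
rewrite /kap.
have -> : dphi_coef * (phi * fz a *+ 2) + dm_coef * ((D a + E a - G a + g * fz a *+ 2) * gb + g * (D a + E a + G a))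
  = (dphi_coef * phi + dm_coef * (g * gb)) * fz a *+ 2 + dm_coef * ((D a + E a - G a) * gb + (D a + E a + G a) * g).
  by ring.
by rewrite e1 e2 e3; ring.
Qed.

Lemma kapE a p : kap a p = kapf (D a p) (E a p) (G a p) (AR p) (sR p) de.
Proof.
have e (k x y z b c : sm) : (k * ((x + y - z) * b + (x + y + z) * c)) p =
  k p * ((x p + y p - z p) * b p + (x p + y p + z p) * c p) by [].
rewrite /kap e dm_coefE gE gbE /kapf.
move: (D a p) (E a p) (G a p) => [x1 x2] [y1 y2] [z1 z2]; rewrite -/(mR p).
by apply: complex_eqP => /=; ring.
Qed.

Lemma VE a p : V a p = Vf (D a p) (E a p) (G a p) (AR p) (sR p).
Proof.
have e (r i t x y z : sm) :
  ((r + i * t *+ 2) * y + (r - i * t *+ 2) * x - i * t * z *+ 3) p =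
  (r p + i p * t p *+ 2) * y p + (r p - i p * t p *+ 2) * x p - i p * t p * z p *+ 3 by [].
by rewrite /Vv e rgE TfE.
Qed.

Lemma Ev_bound p : \sum_a sq (E a p) <= aR p * nER p.
Proof.
rewrite /nER mulr_sumr; apply: ler_sum => a _.
rewrite /Ev sm_sum (eq_bigr (fun b => Et a b p * fz b p)); last by move=> b _; rewrite smM.
by rewrite mulrC; exact: sq_sum_mul.
Qed.

Lemma Dv_bound p : \sum_a sq (D a p) <= aR p * nDR p.
Proof.
rewrite /nDR mulr_sumr; apply: ler_sum => a _.
rewrite /Dv sm_sum (eq_bigr (fun b => Dt a b p * conjc (fz b p))); last by move=> b _; rewrite smM.
rewrite mulrC (_ : aR p = \sum_b sq (conjc (fz b p))); first exact: sq_sum_mul.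
by apply: eq_bigr => b _; rewrite sq_conj.
Qed.

Definition NR p := phR p * (nER p + nDR p) + (1 - 2 * de) * PfR p.

Lemma nER_ge0 p : 0 <= nER p.
Proof. by apply: sumr_ge0 => a _; apply: sumr_ge0 => b _; exact: sq_ge0. Qed.
Lemma nDR_ge0 p : 0 <= nDR p.
Proof. by apply: sumr_ge0 => a _; apply: sumr_ge0 => b _; exact: sq_ge0. Qed.
Lemma PfR_ge0 p : 0 <= PfR p.
Proof. by apply: sumr_ge0 => a _; exact: Pf_ge0. Qed.

Definition divV : sm := \sum_a Zb a (weight * V a).

Lemma Re_sum (J : finType) (F : J -> R[i]) :
  complex.Re (\sum_j F j) = \sum_j complex.Re (F j).
Proof. exact: (big_morph _ (@cReD R) (erefl _)). Qed.

Lemma Re_realM (r : R) (x : R[i]) : complex.Re (r%:C * x) = r * complex.Re x.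
Proof. by case: x => a b /=; rewrite mul0r subr0. Qed.

Lemma nE_val p : normE Z Zb T cj I f phi p = (nER p)%:C.
Proof.
rewrite sm_sum rsum; apply: eq_bigr => a _; rewrite sm_sum rsum.
by apply: eq_bigr => b _; rewrite smM mul_conj.
Qed.

Lemma nD_val p : normD Z cj f p = (nDR p)%:C.
Proof.
rewrite sm_sum rsum; apply: eq_bigr => a _; rewrite sm_sum rsum.
by apply: eq_bigr => b _; rewrite smM mul_conj.
Qed.

Lemma Re_add_cj (F : sm) p : complex.Re ((F + cj F) p) = 2 * complex.Re (F p).
Proof. by rewrite -[(F + cj F) p]/(F p + conjc (F p)); case: (F p) => x y /=; ring. Qed.

(** In the Jerison-Lee identity |Zf|^2 + phi multiplies the full norms of D and E. By Cauchy-Schwarz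
    the |Zf|^2 part pays for the contracted norms required by [key_inequality]; the phi part stays
    in [NR]. *)
Lemma divV_ge p : wR p * NR p <= complex.Re (divV p).
Proof.
have := congr1 (fun F : sm => complex.Re (F p))
  (jerison_lee_identity H f_real phi_real Zphi Tphi pde (cj_real _) Z_weight).
rewrite -/divV Re_add_cj => ER.
rewrite -(ler_pM2l (ltr0Sn _ 1 : 0 < 2 :> R)) {}ER.
rewrite smM -[weight p]/((wR p)%:C) Re_realM smD cReD mulrCA ler_wpM2l ?(ltW (wR_gt0 p))//.
have e (x y z : sm) : (x * (y + z) *+ 2) p = (x p * (y p + z p)) *+ 2 by [].
rewrite e nE_val nD_val rgE.
have -> : complex.Re ((AR p)%:C * ((nER p)%:C + (nDR p)%:C) *+ 2) = 2 * (AR p * (nER p + nDR p)).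
  by rewrite mulr2n /=; ring.
rewrite sm_sum Re_sum.
have : \sum_a ((1 - 2 * de) * 2 * Pf (D a p) (E a p) (G a p)
     - 2 * (sq (D a p) + sq (E a p))) <= \sum_a complex.Re (
   (((D a * cj (D a) + E a * cj (E a) + D a * cj (E a) + E a * cj (D a)
     - G a * cj (E a) - E a * cj (G a) + G a * cj (D a) + D a * cj (G a)) *+ 2
     + (G a * cj (G a)) *+ 6 + cj (kap a) * V a + kap a * cj (V a)) : sm) p).
  apply: ler_sum => a _; rewrite lerBlDr.
  have K := @key_inequality R (D a p) (E a p) (G a p) (AR p) (sR p) de (AR_gt0 p) de0.
  rewrite -(kapE a p) -(VE a p) in K.
  have eT (d e' g' k v : sm) : (((d * cj d + e' * cj e' + d * cj e' + e' * cj d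
     - g' * cj e' - e' * cj g' + g' * cj d + d * cj g') *+ 2
     + (g' * cj g') *+ 6 + cj k * v + k * cj v) : sm) p =
     ((d p * conjc (d p) + e' p * conjc (e' p) + d p * conjc (e' p) + e' p * conjc (d p)
     - g' p * conjc (e' p) - e' p * conjc (g' p) + g' p * conjc (d p) + d p * conjc (g' p)) *+ 2
     + (g' p * conjc (g' p)) *+ 6 + conjc (k p) * v p + k p * conjc (v p)) by [].
  by rewrite (congr1 (@complex.Re R) (eT (D a) (E a) (G a) (kap a) (V a))).
have -> : \sum_a ((1 - 2 * de) * 2 * Pf (D a p) (E a p) (G a p)
     - 2 * (sq (D a p) + sq (E a p))) = (1 - 2 * de) * 2 * PfR p
     - 2 * (\sum_a sq (D a p) + \sum_a sq (E a p)).
  by rewrite sumrB -!mulr_sumr -/(PfR p) big_split.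
have := Ev_bound p; have := Dv_bound p; rewrite /NR /AR.
move: (\sum_a sq (D a p)) (\sum_a sq (E a p)) (\sum_a complex.Re _) => d e' s hd he hs.
lra.
Qed.

Lemma V_bound p : \sum_a sq (V a p) <= 75 * mR p * PfR p.
Proof.
rewrite /PfR mulr_sumr; apply: ler_sum => a _; rewrite VE; exact: Vf_bound.
Qed.

Definition test_fun : sm := hh Z T cj I f phi.
Definition divh : sm := \sum_a Zb a (weight * test_fun * fz a).

Lemma hE p : test_fun p = (n%:R * (2 * aR p + 4 * phR p) - AR p)%:C - 'i%C * (sR p)%:C.
Proof.
have e (k x y z : sm) : (k * (x *+ 2 + y *+ 4) - z) p = k p * (x p *+ 2 + y p *+ 4) - z p by [].
rewrite /test_fun /hh e sm_nat gradE phiE gbE.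
have -> : (n%:R : R[i]) = (n%:R)%:C by rewrite rmorph_nat.
rewrite /AR; move: (aR p) (phR p) (sR p) (n%:R : R) => a b s N.
by apply: complex_eqP; rewrite !(mulrS, mulr0n) /=; ring.
Qed.

Let n2 : 2 <= n%:R :> R. Proof. by rewrite (ler_nat _ 2 n). Qed.

Lemma h_bound p : sq (test_fun p) <= 16 * n%:R ^+ 2 * mR p.
Proof.
rewrite hE /mR /AR; have a0 := aR_ge0 p; have p0 := phR_gt0 p; move: n2.
move: (aR p) (phR p) (sR p) (n%:R : R) a0 p0 => a b s N a0 b0 N2.
have -> : sq ((N * (2 * a + 4 * b) - (a + b))%:C - 'i%C * s%:C) =
  (N * (2 * a + 4 * b) - (a + b)) ^+ 2 + s ^+ 2 by rewrite /sq /=; ring.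
rewrite [leRHS]mulrDr; apply: lerD.
  have -> : 16 * N ^+ 2 * (a + b) ^+ 2 = (4 * N * (a + b)) ^+ 2 by ring.
  have Na : 0 <= N * a by rewrite mulr_ge0//; lra.
  have Nb : 0 <= N * b by rewrite mulr_ge0//; lra.
  have N2a : 0 <= (N - 2) * a by rewrite mulr_ge0//; lra.
  have N2b : 0 <= (N - 2) * b by rewrite mulr_ge0//; lra.
  by rewrite ler_sqr ?nnegrE; lra.
have N4 : 1 <= 16 * N ^+ 2 by nra.
by rewrite ler_peMl ?sqr_ge0.
Qed.

(** The tensor terms of [gradient_identity] are linear in D, E, G and in Zf, and Young's inequality
    with parameter e splits them. The two products cost (32 + 8) n^2 e [Pf] per index, halved
    because the identity gives twice the real part. *)
Lemma divh_ge p (e : R) : 0 < e ->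
  wR p * (n%:R * (aR p ^+ 2 + sR p ^+ 2 - 4 * n%:R * phR p ^+ 2)
    - 20 * n%:R ^+ 2 * e * PfR p - e^-1 * aR p) <= complex.Re (divh p).
Proof.
move=> e0.
have := congr1 (fun F : sm => complex.Re (F p))
  (gradient_identity H f_real phi_real Zphi pde (cj_real _) Z_weight).
rewrite -/test_fun -/divh Re_add_cj => ER.
rewrite -(ler_pM2l (ltr0Sn _ 1 : 0 < 2 :> R)) {}ER.
rewrite smM -[weight p]/((wR p)%:C) Re_realM smD cReD mulrCA ler_wpM2l ?(ltW (wR_gt0 p))//.
have eM (k x y t : sm) : ((k * ((2 * (k - 1)) * x ^+ 2 - (2 * (k + 1)) * (x * y)
    + (4 * k) * (y * (x - y)) - (x ^+ 2 - y ^+ 2 - t ^+ 2))) *+ 2) p =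
   (k p * ((2 * (k p - 1)) * x p ^+ 2 - (2 * (k p + 1)) * (x p * y p)
    + (4 * k p) * (y p * (x p - y p)) - (x p ^+ 2 - y p ^+ 2 - t p ^+ 2))) *+ 2 by [].
rewrite eM sm_nat gradE phiE TfE sm_sum Re_sum.
have -> : complex.Re ((n%:R * ((2 * (n%:R - 1)) * (aR p)%:C ^+ 2 - (2 * (n%:R + 1)) * ((aR p)%:C * (phR p)%:C)
    + (4 * n%:R) * ((phR p)%:C * ((aR p)%:C - (phR p)%:C)) - ((aR p)%:C ^+ 2 - (phR p)%:C ^+ 2 - (sR p)%:C ^+ 2))) *+ 2) =
   2 * (n%:R * ((2 * (n%:R - 1)) * aR p ^+ 2 - (2 * (n%:R + 1)) * (aR p * phR p)
    + (4 * n%:R) * (phR p * (aR p - phR p)) - (aR p ^+ 2 - phR p ^+ 2 - sR p ^+ 2))).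
  have -> : (n%:R : R[i]) = (n%:R)%:C by rewrite rmorph_nat.
  by rewrite mulr2n /=; ring.
have : - (40 * n%:R ^+ 2 * e * PfR p + 2 * e^-1 * aR p)
  <= \sum_a complex.Re ((cj (kap a) * test_fun * fz a + kap a * cj test_fun * fzb Z cj f a
       + cj (Pv Z Zb T cj I f phi a) * fz a + Pv Z Zb T cj I f phi a * fzb Z cj f a : sm) p).
  have -> : - (40 * n%:R ^+ 2 * e * PfR p + 2 * e^-1 * aR p) =
    \sum_a (- (40 * n%:R ^+ 2 * e * Pf (D a p) (E a p) (G a p) + 2 * e^-1 * sq (fz a p))).
    by rewrite /PfR /aR !mulr_sumr -big_split -sumrN.
  apply: ler_sum => a _.
  have eT (k h' z q : sm) : (cj k * h' * z + k * cj h' * cj z + cj q * z + q * cj z : sm) p =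
    conjc (k p) * h' p * z p + k p * conjc (h' p) * conjc (z p) + conjc (q p) * z p
    + q p * conjc (z p) by [].
  rewrite (congr1 (@complex.Re R) (eT (kap a) test_fun (fz a) (Pv Z Zb T cj I f phi a))).
  have Kb : mR p * sq (kap a p) <= 2 * Pf (D a p) (E a p) (G a p).
    rewrite kapE; apply: kapf_bound; first exact: AR_gt0.
    by rewrite de0 ltW.
  have Pb : sq (Pv Z Zb T cj I f phi a p) <= 8 * n%:R ^+ 2 * Pf (D a p) (E a p) (G a p).
    have eP (k x y z : sm) : ((2 * k) * (x + y) - (x + y - z)) p =
      (2 * k p) * (x p + y p) - (x p + y p - z p) by [].
    have n1 : 1 <= n%:R :> R by have := n2; lra.
    have := @Pv_bound R (D a p) (E a p) (G a p) n%:R n1.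
    rewrite (congr1 (@sq R) (eP n%:R (D a) (E a) (G a))) sm_nat.
    by rewrite (_ : (2 * n%:R)%:C = 2 * n%:R :> R[i])// rmorphM /= !rmorph_nat.
  have P0 := Pf_ge0 (D a p) (E a p) (G a p); move: Kb Pb P0.
  move: (Pf _ _ _) => P Kb Pb P0.
  have khb : sq (conjc (kap a p) * test_fun p) <= 32 * n%:R ^+ 2 * P.
    rewrite sqM sq_conj.
    apply: (@le_trans _ _ (sq (kap a p) * (16 * n%:R ^+ 2 * mR p))).
      by rewrite ler_wpM2l ?sq_ge0// h_bound.
    have nn : 0 <= 16 * n%:R ^+ 2 :> R by rewrite mulr_ge0 ?sqr_ge0.
    have := ler_wpM2l nn Kb; lra.
  have := @Re_mul_young R (conjc (kap a p) * test_fun p) (fz a p) e e0.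
  have := @Re_mul_young R (conjc (Pv Z Zb T cj I f phi a p)) (fz a p) e e0.
  rewrite sq_conj !ler_norml => /andP[Y1 _] /andP[Y2 _].
  have eb1 := ler_wpM2l (ltW e0) khb; have eb2 := ler_wpM2l (ltW e0) Pb.
  set k := kap a p in Y1 Y2 eb1 eb2 *; set q := smval (Pv Z Zb T cj I f phi a) p in Y1 Y2 eb1 eb2 *.
  set hp := test_fun p in Y1 Y2 eb1 eb2 *; set z := fz a p in Y1 Y2 eb1 eb2 *.
  have -> : complex.Re (conjc k * hp * z + k * conjc hp * conjc z + conjc q * z + q * conjc z)
    = 2 * complex.Re (conjc k * hp * z) + 2 * complex.Re (conjc q * z).
    by case: (k) (hp) (z) (q) => [k1 k2] [h1 h2] [z1 z2] [q1 q2] /=; ring.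
  lra.
have a0 := aR_ge0 p; have p0 := phR_gt0 p.
move: (\sum_a complex.Re _) => S hS.
(* With a = [aR p] and b = [phR p] the two brackets differ by (2n-4)a^2 + (2n-2)ab + b^2,
   nonnegative as n >= 2. *)
have main : n%:R * (aR p ^+ 2 + sR p ^+ 2 - 4 * n%:R * phR p ^+ 2) <=
  n%:R * ((2 * (n%:R - 1)) * aR p ^+ 2 - (2 * (n%:R + 1)) * (aR p * phR p)
    + (4 * n%:R) * (phR p * (aR p - phR p)) - (aR p ^+ 2 - phR p ^+ 2 - sR p ^+ 2)).
  rewrite ler_wpM2l ?ler0n// -subr_ge0.
  have ap : 0 <= aR p * phR p by rewrite mulr_ge0 ?(ltW p0).
  have N2 : 0 <= n%:R - 2 :> R by rewrite subr_ge0.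
  have := mulr_ge0 N2 ap; have := mulr_ge0 N2 (sqr_ge0 (aR p)); have := sqr_ge0 (phR p).
  lra.
lra.
Qed.

End weighted.

(** * Koranyi balls *)

Section ball.
Context (R : realType) (n : nat).
Local Notation sm := (sm (heis R n)).
Local Notation I := (ii R n).
Local Notation sz := (@sz R n).
Local Notation cj := (@cj R (heis R n)).
Local Notation mu := (heis_measure R n).
Implicit Types (p v : heis R n) (F : sm) (r : R).

Definition znorm p : R := \sum_a ((p.1.1 0 a) ^+ 2 + (p.1.2 0 a) ^+ 2).
Definition rho p : R := znorm p ^+ 2 + p.2 ^+ 2.
Definition nz : sm := \sum_a sz a * cj (sz a).
Definition rhoS : sm := nz * nz + st R n * st R n.

Lemma nzE p : nz p = (znorm p)%:C.
Proof.
rewrite sm_sum /znorm rmorph_sum; apply: eq_bigr => a _.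
rewrite smM -[cj (sz a) p]/(conjc (sz a p)) szE /zcoord mxE.
by apply: complex_eqP => /=; ring.
Qed.

Lemma rhoE p : rhoS p = (rho p)%:C.
Proof.
have e (x y : sm) : (x * x + y * y) p = x p * x p + y p * y p by [].
rewrite /rhoS e nzE /rho -[st R n p]/((p.2)%:C).
by apply: complex_eqP => /=; ring.
Qed.

Lemma norm2E p : norm2 (zcoord p) = znorm p.
Proof.
apply: eq_bigr => a _; rewrite /zcoord mxE /modc /=.
by rewrite sqr_sqrtr// addr_ge0 ?sqr_ge0.
Qed.

Lemma rho_ge0 p : 0 <= rho p. Proof. by rewrite addr_ge0 ?sqr_ge0. Qed.
Lemma znorm_ge0 p : 0 <= znorm p.
Proof. by apply: sumr_ge0 => a _; rewrite addr_ge0 ?sqr_ge0. Qed.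

Definition cR r p : R := 1 - r ^- 4 * rho p.
Definition cS r : sm := 1 - scst _ (r ^- 4)%:C * rhoS.

Lemma cE r p : cS r p = (cR r p)%:C.
Proof.
have e (x y : sm) : (1 - x * y) p = 1 - x p * y p by [].
rewrite /cS e rhoE /cR -[scst _ _ p]/((r ^- 4)%:C).
by rewrite rmorphB rmorphM rmorph1.
Qed.

Lemma c_smooth r : smooth (cR r).
Proof.
have [h _] := sm_smooth (cS r); suff -> : cR r = (fun p => complex.Re (cS r p)) by [].
by apply/funext => p; rewrite cE.
Qed.

Lemma c_pos r p : 0 < r -> (0 < cR r p) = (rho p < r ^+ 4).
Proof.
move=> r0; rewrite /cR subr_gt0 -[X in _ < X](@mulVf _ (r ^+ 4)) ?gt_eqF ?exprn_gt0//.
by rewrite ltr_pM2l// invr_gt0 exprn_gt0.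
Qed.

Lemma koranyi_ballE r : 0 < r -> koranyi_ball r = [set p : heis R n | 0 < cR r p].
Proof.
move=> r0; apply/seteqP; split=> p /=; rewrite c_pos// /koranyi_ball /= /koranyi norm2E -/(rho p) => h.
  have -> : rho p = (rho p `^ 4^-1) ^+ 4.
    by rewrite -powR_mulrn ?powR_ge0// -powRrM mulVf// powRr1// rho_ge0.
  by rewrite ltrXn2r// ?powR_ge0.
have -> : r = (r ^+ 4) `^ 4^-1.
  by rewrite -powR_mulrn ?(ltW r0)// -powRrM divff// powRr1// ltW.
by rewrite gt0_ltr_powR// ?nnegrE ?rho_ge0 ?exprn_ge0 ?invr_gt0// ltW.
Qed.

Lemma znorm_lt r p : 0 < r -> 0 < cR r p -> znorm p < r ^+ 2.
Proof.
move=> r0; rewrite c_pos// => h.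
rewrite -(@ltr_pXn2r _ 2)// ?nnegrE ?znorm_ge0 ?exprn_ge0 ?(ltW r0)//.
by rewrite -exprM; apply: le_lt_trans h; rewrite lerDl sqr_ge0.
Qed.

Lemma ball_box r : 0 < r -> [set p : heis R n | 0 < cR r p] `<=` box 0 r (r ^+ 2).
Proof.
move=> r0 p /= cp; have zr := znorm_lt r0 cp.
have xi i : p.1.1 0 i ^+ 2 + p.1.2 0 i ^+ 2 <= znorm p.
  rewrite /znorm (bigD1 i)//= lerDl; apply: sumr_ge0 => a _.
  by rewrite addr_ge0 ?sqr_ge0.
have aux (x : R) : x ^+ 2 <= r ^+ 2 -> `[0 - r, 0 + r]%classic x.
  move=> h; rewrite /= in_itv/= sub0r add0r -ler_norml.
  by rewrite -(@ler_pXn2r _ 2)// ?nnegrE ?(ltW r0)// real_normK ?num_real.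
split; [split=> i; rewrite /= mxE; apply: aux|].
- by have := xi i; have := sqr_ge0 (p.1.2 0 i); lra.
- by have := xi i; have := sqr_ge0 (p.1.1 0 i); lra.
move: cp; rewrite c_pos// /rho => cp.
rewrite /= in_itv/= sub0r add0r -ler_norml -(@ler_pXn2r _ 2)// ?nnegrE ?exprn_ge0 ?(ltW r0)//.
by rewrite real_normK ?num_real// -exprM; have := sqr_ge0 (znorm p); lra.
Qed.

(** The ball is written as the set where c > 0, the form in which the cutoff lemmas apply;
    [koranyi_ballE] identifies it for r > 0. *)
Definition ball_int r (h : heis R n -> R) : R := Rintegral mu [set p | 0 < cR r p] h.

Lemma ball_int_integrable r (h : heis R n -> R) : 0 < r -> continuous h ->
  mu.-integrable [set p | 0 < cR r p] (EFin \o h).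
Proof.
move=> r0 ch; apply: (integrable_pos_set (c_smooth r) r0 (exprn_gt0 2 r0) (ball_box r0) ch).
Qed.

Lemma ball_measurable r : measurable ([set p | 0 < cR r p] :
  set (('rV[R]_n * 'rV[R]_n) * measurableTypeR R)%type).
Proof. exact: measurable_pos_set (c_smooth r). Qed.

Lemma ball_int_le r (h1 h2 : heis R n -> R) : 0 < r -> continuous h1 -> continuous h2 ->
  (forall p, 0 < cR r p -> h1 p <= h2 p) -> ball_int r h1 <= ball_int r h2.
Proof.
move=> r0 c1 c2 h12; apply: le_Rintegral => //.
- exact: ball_measurable.
- exact: ball_int_integrable.
- exact: ball_int_integrable.
Qed.

Lemma ball_int_add r (h1 h2 : heis R n -> R) : 0 < r -> continuous h1 -> continuous h2 ->
  ball_int r (fun p => h1 p + h2 p) = ball_int r h1 + ball_int r h2.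
Proof.
move=> r0 c1 c2; apply: RintegralD.
- exact: ball_measurable.
- exact: ball_int_integrable.
- exact: ball_int_integrable.
Qed.

Lemma ball_int_scale r (k : R) (h : heis R n -> R) : 0 < r -> continuous h -> ball_int r (fun p => k * h p) = k * ball_int r h.
Proof.
move=> r0 ch; apply: RintegralZl; first exact: ball_measurable.
exact: ball_int_integrable.
Qed.

Lemma ball_int_ge0 r (h : heis R n -> R) : (forall p, 0 < cR r p -> 0 <= h p) -> 0 <= ball_int r h.
Proof. by move=> h0; apply: Rintegral_ge0. Qed.

Lemma ball_int_eq r (h1 h2 : heis R n -> R) : (forall p, 0 < cR r p -> h1 p = h2 p) -> ball_int r h1 = ball_int r h2.
Proof. by move=> h12; apply: eq_Rintegral => p; rewrite inE => /h12. Qed.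

Lemma Re_continuous F : continuous (fun p => complex.Re (F p)).
Proof. by have [h _] := sm_smooth F; exact: smooth_continuous. Qed.

(** Two of the factors c form the C^1 cutoff; the others go into the smooth function it
    multiplies. *)
Lemma ball_int_dv r v F k : 0 < r -> ball_int r (fun p => complex.Re (dv v (cS r ^+ k.+2 * F) p)) = 0.
Proof.
move=> r0; have [h _] := sm_smooth (cS r ^+ k * F).
have E : (fun p => complex.Re (dv v (cS r ^+ k.+2 * F) p)) =
  (fun p => 'D_v (fun q => cR r q ^+ 2 * complex.Re ((cS r ^+ k * F) q)) p).
  apply/funext => p; rewrite -[LHS]/('D_v (fun q => complex.Re ((cS r ^+ k.+2 * F) q)) p).
  apply: eq_derive => q.
  have e (x y : sm) m : (x ^+ m * y) q = x q ^+ m * y q by rewrite smM smX.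
  rewrite (e (cS r) F k.+2) (e (cS r) F k) cE.
  have -> : (cR r q)%:C ^+ k.+2 = (cR r q ^+ 2)%:C * (cR r q)%:C ^+ k :> R[i].
    by rewrite rmorphXn -exprD.
  by rewrite -mulrA; case: ((cR r q)%:C ^+ k * F q) => a b /=; ring.
rewrite E; apply: (integral_derive_cutoff (c_smooth r) r0 (exprn_gt0 2 r0) (ball_box r0) v h).
Qed.

(** The coefficients i and z_a can be moved inside the derivatives, because z_a does not depend on
    t; Zbar_a then becomes a sum of derivatives in constant directions. *)
Lemma ball_int_ZB r a F k : 0 < r -> ball_int r (fun p => complex.Re (ZB a (cS r ^+ k.+2 * F) p)) = 0.
Proof.
move=> r0; set c := cS r ^+ k.+2.
have E : ZB a (c * F) = half R n * dv (vx R a) (c * F) + half R n * dv (vy R a) (c * (I * F))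
   + dv (vt R n) (c * (- (I * sz a * F))).
  have -> : c * (I * F) = I * (c * F) by ring.
  have -> : c * (- (I * sz a * F)) = - (I * (sz a * (c * F))) by ring.
  rewrite /ZB /TT dvN !dv_ii (dvM _ (sz a)) dvt_sz.
  by move: (dv _ _) (dv _ _) (dv _ _) => x y z; ring.
transitivity (ball_int r (fun p => 2^-1 * complex.Re (dv (vx R a) (c * F) p) +
   (2^-1 * complex.Re (dv (vy R a) (c * (I * F)) p) +
   complex.Re (dv (vt R n) (c * (- (I * sz a * F))) p)))).
  apply: ball_int_eq => p _; rewrite E.
  move: (dv (vx R a) (c * F)) (dv (vy R a) (c * (I * F))) (dv (vt R n) _) => x y z.
  rewrite !smD !smM !cReD -addrA -[half R n p]/(2^-1).
  have -> : (2^-1 : R[i]) = (2^-1)%:C by rewrite fmorphV rmorph_nat.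
  by case: (x p) => ? ?; case: (y p) => ? ? /=; ring.
have S (x : sm) : continuous (fun p => 2^-1 * complex.Re (x p)).
  exact: continuous_scale (@Re_continuous x).
have S' (x : sm) := @Re_continuous x.
rewrite (ball_int_add r0 (S _) (continuous_add (S _) (S' _))) (ball_int_add r0 (S _) (S' _)).
rewrite (ball_int_scale _ r0 (S' _)) (ball_int_scale _ r0 (S' _)).
by rewrite !ball_int_dv// !mulr0 !addr0.
Qed.

Lemma ZB_c r a : ZB a (cS r) = scst _ (- 2 * r ^- 4)%:C * (sz a * (nz - I * st R n)).
Proof.
have Znz : ZB a nz = sz a.
  rewrite /nz (big_morph (ZB a) (@ZBD R n a) (ZB0 R a)).
  rewrite (eq_bigr (fun b => dlt R b a * sz b)); last first.
    by move=> b _; rewrite ZBM ZB_sz ZB_cj ZZ_sz cj_dlt; ring.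
  rewrite (bigD1 a)//= /dlt eqxx mul1r big1 ?addr0// => b /negPf ->.
  by rewrite mul0r.
have Zt : ZB a (st R n) = - (I * sz a).
  by rewrite -[st R n]cj_real ZB_cj ZZ_st cjM cj_ii cjK mulNr.
have Z1 : ZB a (1 : sm) = 0 by rewrite -scst1 ZB_cst.
have -> : ZB a (cS r) = - (scst _ (r ^- 4)%:C * (sz a * nz + nz * sz a - I * sz a * st R n - st R n * (I * sz a))).
  rewrite /cS ZBD Z1 ZBN (ZBM a (scst _ _)) ZB_cst /rhoS ZBD (ZBM a nz) (ZBM a (st R n)) Znz Zt; ring.
have -> : scst _ (- 2 * r ^- 4)%:C = - (scst _ (r ^- 4)%:C) *+ 2 :> sm.
  apply: smP => p; rewrite mulr2n smD smN /= -!rmorphN -rmorphD; congr (_%:C); ring.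
by ring.
Qed.

(** The squared gradient is 4|z|^2 rho/r^8, where rho = r^4 (1 - c) and |z|^2 < r^2 on the ball. The
    factor 1 - c is kept: it produces the difference of two energies in [caccioppoli]. *)
Lemma grad_c_bound r p : 0 < r -> 0 < cR r p ->
  \sum_a sq (ZB a (cS r) p) <= 4 * (1 - cR r p) / r ^+ 2.
Proof.
move=> r0 cp; have zr := znorm_lt r0 cp.
have -> : \sum_a sq (ZB a (cS r) p) = 4 * r ^- 4 ^+ 2 * (znorm p * rho p).
  transitivity (\sum_a (4 * r ^- 4 ^+ 2 * rho p) * (p.1.1 0 a ^+ 2 + p.1.2 0 a ^+ 2)).
    apply: eq_bigr => a _; rewrite ZB_c.
    have e (k x y i t : sm) : (k * (x * (y - i * t))) p = k p * (x p * (y p - i p * t p)) by [].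
    rewrite e nzE -[st R n p]/((p.2)%:C) szE /zcoord mxE -[I p]/('i%C).
    rewrite -[scst _ _ p]/((- 2 * r ^- 4)%:C) !sqM /sq /= /rho; ring.
  by rewrite -mulr_sumr -/(znorm p); ring.
have r4 : r ^+ 4 != 0 by rewrite gt_eqF ?exprn_gt0.
have -> : 4 * (1 - cR r p) / r ^+ 2 = 4 * r ^- 4 ^+ 2 * (r ^+ 2 * rho p).
  rewrite /cR; have rn : r != 0 by rewrite gt_eqF. 
  by field.
have k0 : 0 <= 4 * r ^- 4 ^+ 2 by apply: mulr_ge0 => //; exact: sqr_ge0.
by apply: ler_wpM2l => //; apply: ler_wpM2r; [exact: rho_ge0|exact: ltW].
Qed.

Lemma c_le1 r p : 0 < r -> cR r p <= 1.
Proof.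
by move=> r0; rewrite /cR gerBl mulr_ge0 ?rho_ge0// invr_ge0 exprn_ge0// ltW.
Qed.

(** The enclosing box has volume a multiple of r^(2n+2), the exponent being the homogeneous
    dimension. *)
Lemma ball_int_cst_le r k : 0 < r -> 0 <= k ->
  ball_int r (fun=> k) <= k * ((2 * r) ^+ n * (2 * r) ^+ n * (2 * r ^+ 2)).
Proof.
move=> r0 k0; rewrite /ball_int Rintegral_cst; last exact: ball_measurable.
rewrite ler_wpM2l// -lee_fin fineK.
  rewrite -(box_measure 0 r0 (exprn_gt0 2 r0)); apply: le_measure; last exact: ball_box.
    by rewrite inE; exact: ball_measurable.
  by rewrite inE; exact: measurable_box.
rewrite ge0_fin_numE//; apply: (@le_lt_trans _ _ (mu (box 0 r (r ^+ 2)))).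
  apply: le_measure; last exact: ball_box.
    by rewrite inE; exact: ball_measurable.
  by rewrite inE; exact: measurable_box.
by rewrite box_measure ?exprn_gt0// ltry.
Qed.

(** A positive value would persist on a small box, whose measure is positive. *)
Lemma ball_int_eq0 r (h : heis R n -> R) p : 0 < r -> continuous h ->
  (forall q, 0 < cR r q -> 0 <= h q) -> ball_int r h <= 0 -> 0 < cR r p -> h p <= 0.
Proof.
move=> r0 ch h0 Jh cp; rewrite leNgt; apply/negP => hp.
have oU : open ([set q | 0 < cR r q] `&` [set q | h p / 2 < h q]).
  apply: openI.
    apply: (@open_comp _ _ (cR r) [set x | x > 0]); last exact: open_gt.
    by move=> q _; exact: (smooth_continuous (c_smooth r)).
  apply: (@open_comp _ _ h [set x | x > h p / 2]); last exact: open_gt.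
  by move=> q _; exact: ch.
have /nbhs_box[e e0 eU] : nbhs p ([set q | 0 < cR r q] `&` [set q | h p / 2 < h q]).
  apply: open_nbhs_nbhs; split=> //; split => //=.
  by rewrite gtr_pMr// invf_lt1// ltr1n.
have mb : measurable (box p e e : set (('rV[R]_n * 'rV[R]_n) * measurableTypeR R)%type).
  exact: measurable_box.
have bm : mu (box p e e) = ((2 * e) ^+ n * (2 * e) ^+ n * (2 * e))%:E := box_measure p e0 e0.
have m0 : 0 < (2 * e) ^+ n * (2 * e) ^+ n * (2 * e).
  by rewrite !mulr_gt0 ?exprn_gt0 ?mulr_gt0.
have ih := ball_int_integrable r0 ch.
have bB : box p e e `<=` [set q | 0 < cR r q] by move=> q /eU[].
have : h p / 2 * ((2 * e) ^+ n * (2 * e) ^+ n * (2 * e)) <= ball_int r h.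
  rewrite -lee_fin EFinM /ball_int /Rintegral fineK; last by apply: integrable_fin_num => //; exact: ball_measurable.
  rewrite -bm -integral_cst//.
  apply: (@le_trans _ _ (\int[mu]_(q in box p e e) (h q)%:E)%E).
    apply: ge0_le_integral => //.
    - by move=> q _; rewrite lee_fin divr_ge0// ltW.
    - apply/measurable_EFinP/measurable_funTS; exact: heis_continuous_measurable.
    - by move=> q /eU[_ /=] hq; rewrite lee_fin ltW.
  apply: ge0_subset_integral => //.
  - exact: ball_measurable.
  - by apply/measurable_EFinP/measurable_funTS; exact: heis_continuous_measurable.
have := mulr_gt0 (divr_gt0 hp (ltr0Sn _ 1 : 0 < 2 :> R)) m0; lra.
Qed.

End ball.

(** * Integral estimates *)

Section real_inequalities.
Context (R : realType).

(** Turns a Cauchy-Schwarz bound on y^2 into a sum whose weights sit in the choice of x and z. *)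
Lemma amgm (x y z : R) : 0 <= x -> 0 <= z -> y ^+ 2 <= 4 * x * z -> y <= x + z.
Proof.
move=> x0 z0 h; have xz : 0 <= x + z by rewrite addr_ge0.
have h2 : y ^+ 2 <= (x + z) ^+ 2 by have := sqr_ge0 (x - z); lra.
apply: le_trans (ler_norm y) _.
by rewrite -(@ler_pXn2r _ 2)// ?nnegrE// real_normK ?num_real.
Qed.

(** The integrand version of [mass_bound]: D and y are the divergence and the cutoff term of the
    second identity, B stands for phi^(n+1-de) and b for r^(-2n). The last two summands cancel after
    integration by parts. Young's parameter is t' r^2 c^2: it raises c^4 P to c^6 P, as in the
    energy, and lowers c^4 a to c^2 a. *)
Lemma mass_bound_pointwise (c w a f s P Q n t t' r m B y D K b k : R) :
  0 < c -> c <= 1 -> 0 < w -> 0 <= a -> 0 < f -> 0 <= P -> 0 <= Q -> 2 <= n ->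
  0 < r -> 0 < t -> 0 < t' -> 0 < k ->
  40 * n ^+ 2 * t' = t * k -> K = t'^-1 + 1024 * n ^+ 2 ->
  m = (a + f) ^+ 2 + s ^+ 2 ->
  w * (n * (a ^+ 2 + s ^+ 2 - 4 * n * f ^+ 2) - 20 * n ^+ 2 * (t' * r ^+ 2 * c ^+ 2) * P
     - (t' * r ^+ 2 * c ^+ 2)^-1 * a) <= D ->
  y ^+ 2 <= 4 / r ^+ 2 * (w ^+ 2 * (16 * n ^+ 2 * m * a)) ->
  w * f ^+ 2 <= B -> w * r ^- 4 <= B + b ->
  c ^+ 4 * (w * m) <= t * r ^+ 2 * (c ^+ 6 * (w * (Q + k * P))) +
    (8 * n ^+ 2 + 3 + 2 * K ^+ 2) * B + 2 * K ^+ 2 * b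
   + 2 * (c ^+ 4 * D) + - 2 * (- (4%:R * c ^+ 3) * y).
Proof.
move=> c0 c1 w0 a0 f0 P0 Q0 n2 r0 t0 t'0 k0 tE KE mE hD hy hB hb.
have m0 : 0 <= m by rewrite mE addr_ge0 ?sqr_ge0.
have wa : 0 <= w * a by rewrite mulr_ge0// ltW.
have c20 : 0 <= c ^+ 2 by exact: sqr_ge0.
have c40 : 0 <= c ^+ 4 by rewrite exprn_ge0// ltW.
have c41 : c ^+ 4 <= 1 by rewrite exprn_ile1// ltW.
have rn : r != 0 by rewrite gt_eqF.
have tn : t' != 0 by rewrite gt_eqF.
have cn : c != 0 by rewrite gt_eqF.
(* The constant is 1024 = 16 x 4 x 16, from the squared derivative of c^4, the gradient bound for c
   and the bound for the test function. *)
have A1' : - (4 * c ^+ 3) * y <= c ^+ 4 * (w * m) / 4 + 1024 * n ^+ 2 * (c ^+ 2 * (w * a)) / r ^+ 2.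
  apply: amgm; first by rewrite divr_ge0// mulr_ge0// mulr_ge0// ltW.
    apply: divr_ge0; last exact: sqr_ge0.
    by apply: mulr_ge0; [apply: mulr_ge0; [exact: ler0n|exact: sqr_ge0]|apply: mulr_ge0].
  apply: (@le_trans _ _ (16 * c ^+ 6 * (4 / r ^+ 2 * (w ^+ 2 * (16 * n ^+ 2 * m * a))))).
    have -> : (- (4 * c ^+ 3) * y) ^+ 2 = 16 * c ^+ 6 * y ^+ 2 by ring.
    by rewrite ler_wpM2l// mulr_ge0// exprn_ge0// ltW.
  by rewrite le_eqVlt; apply/orP; left; apply/eqP; field.
have A2 : 2 * (c ^+ 4 * (w * (n * (a ^+ 2 + s ^+ 2 - 4 * n * f ^+ 2)
     - 20 * n ^+ 2 * (t' * r ^+ 2 * c ^+ 2) * P - (t' * r ^+ 2 * c ^+ 2)^-1 * a)))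
   <= 2 * (c ^+ 4 * D) by rewrite ler_wpM2l// ler_wpM2l.
(* Completing a square trades c^2 a for c^4 a^2 and r^(-4); multiplied by w, the latter is what [hb]
   bounds. K collects both sources of c^2 a. *)
have A3 : c ^+ 2 * a * (K / r ^+ 2) <= c ^+ 4 * a ^+ 2 / 4 + K ^+ 2 * r ^- 4.
  have := sqr_ge0 (c ^+ 2 * a / 2 - K / r ^+ 2).
  have -> : (c ^+ 2 * a / 2 - K / r ^+ 2) ^+ 2 = c ^+ 4 * a ^+ 2 / 4 + K ^+ 2 * r ^- 4
      - c ^+ 2 * a * (K / r ^+ 2) by field.
  lra.
have A3w := ler_wpM2l (ltW w0) A3.
have A4 : 2 * K ^+ 2 * (w * r ^- 4) <= 2 * K ^+ 2 * (B + b).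
  by rewrite ler_wpM2l// mulr_ge0// sqr_ge0.
have B0 : 0 <= B by apply: le_trans hB; rewrite mulr_ge0 ?sqr_ge0// ltW.
have A5 : (8 * n ^+ 2 + 3) * (c ^+ 4 * (w * f ^+ 2)) <= (8 * n ^+ 2 + 3) * B.
  apply: ler_wpM2l; first by have := sqr_ge0 n; lra.
  apply: le_trans hB; rewrite ler_piMl// mulr_ge0 ?sqr_ge0//; exact: ltW.
have A6 : 0 <= t * r ^+ 2 * (c ^+ 6 * (w * Q)).
  by rewrite !mulr_ge0 ?exprn_ge0 ?(ltW t0) ?(ltW r0) ?(ltW c0) ?(ltW w0).
have E1 : 2 * (c ^+ 4 * (w * (n * (a ^+ 2 + s ^+ 2 - 4 * n * f ^+ 2)
     - 20 * n ^+ 2 * (t' * r ^+ 2 * c ^+ 2) * P - (t' * r ^+ 2 * c ^+ 2)^-1 * a))) =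
   2 * n * (c ^+ 4 * (w * (a ^+ 2 + s ^+ 2))) - 8 * n ^+ 2 * (c ^+ 4 * (w * f ^+ 2))
   - (40 * n ^+ 2 * t') * (r ^+ 2 * (c ^+ 6 * (w * P))) - 2 * (c ^+ 2 * (w * a) * (t'^-1 / r ^+ 2)).
  by field; rewrite tn rn cn.
rewrite E1 tE in A2.
have E2 : w * (c ^+ 2 * a * (K / r ^+ 2)) = c ^+ 2 * (w * a) * (t'^-1 / r ^+ 2)
   + 1024 * n ^+ 2 * (c ^+ 2 * (w * a)) / r ^+ 2.
  by rewrite KE; field; rewrite tn rn.
rewrite E2 in A3w.
have A7 : 0 <= (n - 2) * (c ^+ 4 * (w * (a ^+ 2 + s ^+ 2))).
  by rewrite mulr_ge0 ?subr_ge0// mulr_ge0// mulr_ge0 ?addr_ge0 ?sqr_ge0// ltW.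
(* The factor 4 is a lower bound for 2n; -a^2/2 accounts for twice A3, and 3m/2 is the mass itself
   plus the half lost to twice A1'. *)
have A8 : 0 <= c ^+ 4 * (w * (4 * (a ^+ 2 + s ^+ 2) - a ^+ 2 / 2 + 3 * f ^+ 2 - 3 / 2 * m)).
  rewrite mulr_ge0// mulr_ge0 ?(ltW w0)// mE.
  have := sqr_ge0 (a - f); have := sqr_ge0 a; have := sqr_ge0 s; lra.
clear KE tE mE hD hy E1 E2; lra.
Qed.
Lemma bernoulli (y : R) k : 0 <= y -> y <= 1 -> 1 - k%:R * y <= (1 - y) ^+ k.
Proof.
move=> y0 y1; elim: k => [|k IH]; first by rewrite expr0 mul0r subr0.
have h : 0 <= 1 - y by rewrite subr_ge0.
rewrite exprS; apply: le_trans (ler_wpM2l h IH).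
have := mulr_ge0 (ler0n R k) (sqr_ge0 y); rewrite -natr1; lra.
Qed.

End real_inequalities.

Section estimates.
Context (R : realType) (n : nat) (hn : (2 <= n)%N).
Local Notation sm := (sm (heis R n)).
Implicit Types (p : heis R n) (r : R).

Lemma Re_sqr_le (x : R[i]) : complex.Re x ^+ 2 <= sq x.
Proof. by rewrite /sq lerDl sqr_ge0. Qed.

Lemma ZBX a (x : sm) k : ZB a (x ^+ k.+1) = k.+1%:R * (x ^+ k * ZB a x).
Proof.
elim: k => [|k IH]; first by rewrite expr1 expr0 !mul1r.
by rewrite exprS ZBM IH exprS -natr1 -[in RHS]natr1; ring.
Qed.

Lemma continuous_exp (h : heis R n -> R) k : continuous h -> continuous (fun p => h p ^+ k).
Proof.
move=> ch; elim: k => [|k IH]; first by move=> p; exact: cst_continuous.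
have E : (fun p => h p ^+ k.+1) = (fun p => h p * h p ^+ k) by apply/funext => p; rewrite exprS.
by rewrite E; exact: continuous_mul.
Qed.

Lemma c_continuous r : continuous (@cR R n r).
Proof. by move=> p; exact: (smooth_continuous (c_smooth n r)). Qed.

Lemma divergence_ball_int r (F : 'I_n -> sm) k : 0 < r ->
  ball_int r (fun p => cR r p ^+ k.+2 * complex.Re ((\sum_a ZB a (F a)) p)) =
  ball_int r (fun p => - (k.+2%:R * cR r p ^+ k.+1) *
     complex.Re (\sum_a ZB a (cS n r) p * F a p)).
Proof.
move=> r0; set c := cS n r.
have J0 : ball_int r (fun p => complex.Re ((\sum_a ZB a (c ^+ k.+2 * F a)) p)) = 0.
  have : forall x y : sm, ball_int r (fun p => complex.Re (x p)) = 0 ->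
      ball_int r (fun p => complex.Re (y p)) = 0 -> ball_int r (fun p => complex.Re ((x + y) p)) = 0.
    move=> x y hx hy; rewrite (@ball_int_eq _ _ r _ (fun p => complex.Re (x p) + complex.Re (y p))).
      by rewrite (ball_int_add r0 (@Re_continuous _ _ x) (@Re_continuous _ _ y)) hx hy addr0.
    by move=> p _; rewrite smD cReD.
  move=> H; elim/big_rec: _ => [|a x _ hx].
    have -> : (fun p => complex.Re ((0 : sm) p)) = (fun p => 0 * complex.Re ((0 : sm) p)).
      by apply/funext => p; rewrite mul0r.
    by rewrite (ball_int_scale 0 r0 (@Re_continuous _ _ (0 : sm))) mul0r.
  by apply: H => //; exact: ball_int_ZB.
pose G : sm := \sum_a ZB a c * F a.
have E p : complex.Re ((\sum_a ZB a (c ^+ k.+2 * F a)) p) =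
   cR r p ^+ k.+2 * complex.Re ((\sum_a ZB a (F a)) p) +
   (k.+2%:R * cR r p ^+ k.+1) * complex.Re (G p).
  have -> : \sum_a ZB a (c ^+ k.+2 * F a) = c ^+ k.+2 * (\sum_a ZB a (F a)) +
     (k.+2%:R * c ^+ k.+1) * G.
    rewrite /G !mulr_sumr -big_split; apply: eq_bigr => a _; rewrite -[RHS]/(_ + _).
    rewrite (ZBM a (c ^+ k.+2) (F a)) (ZBX a c k.+1).
    by move: (ZB a c) (ZB a (F a)) (F a) (c ^+ k.+2) (c ^+ k.+1) => x y z t c'; ring.
  have e (x y t z : sm) : (x * y + t * z) p = x p * y p + t p * z p by [].
  rewrite e smX smM smX sm_nat cE cReD.
  have -> : (cR r p)%:C ^+ k.+2 = (cR r p ^+ k.+2)%:C :> R[i] by rewrite rmorphXn.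
  have -> : k.+2%:R * (cR r p)%:C ^+ k.+1 = (k.+2%:R * cR r p ^+ k.+1)%:C :> R[i].
    by rewrite rmorphM rmorphXn rmorph_nat.
  by rewrite !Re_realM.
have GE p : G p = \sum_a ZB a c p * F a p by rewrite sm_sum.
have c1 : continuous (fun p => cR r p ^+ k.+2 * complex.Re ((\sum_a ZB a (F a)) p)).
  by apply: continuous_mul; [exact/continuous_exp/c_continuous|exact: Re_continuous].
have c2 : continuous (fun p => (k.+2%:R * cR r p ^+ k.+1) * complex.Re (G p)).
  apply: continuous_mul; last exact: Re_continuous.
  exact/continuous_scale/continuous_exp/c_continuous.
move: J0; rewrite (ball_int_eq (fun p _ => E p)) (ball_int_add r0 c1 c2) => /eqP.
rewrite addr_eq0 => /eqP ->; rewrite -mulN1r -(ball_int_scale _ r0 c2).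
by apply: ball_int_eq => p _; rewrite -GE; ring.
Qed.

(** * Energy, mass and the Caccioppoli inequality *)

Variables (a ph s P Nm w : heis R n -> R) (F1 F2 : 'I_n -> sm) (de : R).
Hypotheses (ca : continuous a) (cph : continuous ph) (cs : continuous s)
  (cP : continuous P) (cNm : continuous Nm) (cw : continuous w).
Hypotheses (a0 : forall p, 0 <= a p) (ph0 : forall p, 0 < ph p)
  (P0 : forall p, 0 <= P p) (Nm0 : forall p, 0 <= Nm p) (w0 : forall p, 0 < w p).
Hypotheses (de0 : 0 <= de) (de1 : de < 2^-1).
(** This is |g|^2 for a = |Zf|^2, ph = phi, s = Tf. Below, these functions are linked to the
    equation only through the hypotheses [H1] to [H4]. *)
Let m p := (a p + ph p) ^+ 2 + s p ^+ 2.
Let N p := ph p * Nm p + (1 - 2 * de) * P p.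
Hypothesis H1 : forall p, w p * N p <= complex.Re ((\sum_a ZB a (F1 a)) p).
Hypothesis H1' : forall p, \sum_a sq (F1 a p) <= w p ^+ 2 * (75 * m p * P p).
Hypothesis H2 : forall p (e : R), 0 < e ->
  w p * (n%:R * (a p ^+ 2 + s p ^+ 2 - 4 * n%:R * ph p ^+ 2)
    - 20 * n%:R ^+ 2 * e * P p - e^-1 * a p) <= complex.Re ((\sum_a ZB a (F2 a)) p).
Hypothesis H2' : forall p, \sum_a sq (F2 a p) <= w p ^+ 2 * (16 * n%:R ^+ 2 * m p * a p).
Hypothesis H3 : forall p, w p = ph p `^ (n%:R - 1 + de) * m p `^ (- de).
Variable C : R.
Hypothesis H4 : forall r, 1 < r -> ball_int r (fun p => ph p `^ (n%:R + 1 - de)) <= C * r ^+ 2.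

Let m_gt0 p : 0 < m p.
Proof.
by rewrite ltr_pwDl ?sqr_ge0// exprn_gt0// ltr_wpDl.
Qed.
Let d1 : 0 < 1 - 2 * de.
Proof. by rewrite subr_gt0 mulrC -ltr_pdivlMr ?ltr0n// mul1r; exact: de1. Qed.
Let N0 p : 0 <= N p.
Proof. by rewrite addr_ge0// mulr_ge0// ltW. Qed.
Let cm : continuous m.
Proof.
apply: continuous_add; last exact: continuous_exp.
by apply: continuous_exp; exact: continuous_add.
Qed.
Let cN : continuous N.
Proof. by apply: continuous_add; [exact: continuous_mul|exact: continuous_scale]. Qed.

Definition energy k r := ball_int r (fun p => cR r p ^+ k * (w p * N p)).
Definition mass k r := ball_int r (fun p => cR r p ^+ k * (w p * m p)).

Hypothesis cB0 : continuous (fun p => ph p `^ (n%:R + 1 - de)).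

Let cwN k r : continuous (fun p => cR r p ^+ k * (w p * N p)).
Proof.
apply: continuous_mul; first exact/continuous_exp/c_continuous.
exact: continuous_mul.
Qed.
Let cwm k r : continuous (fun p => cR r p ^+ k * (w p * m p)).
Proof.
apply: continuous_mul; first exact/continuous_exp/c_continuous.
exact: continuous_mul.
Qed.

(** Integration by parts and Cauchy-Schwarz bound the squared cutoff term by |Zc|^2 times 75 w^2 m
    P. As |Zc|^2 <= 4(1-c)/r^2, this splits into c^(k+2)(1-c) w N, the integrand of a difference of
    energies, and c^k w m. *)
Lemma caccioppoli k r (t : R) : 0 < r -> 0 < t ->
  energy k.+2 r <= t * (energy k.+2 r - energy k.+3 r) +
    (75 * k.+2%:R ^+ 2 / (1 - 2 * de) / t / r ^+ 2) * mass k r.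
Proof.
move=> r0 t0; set K := _ / _ / _ / _.
have K0 : 0 <= K.
  by rewrite /K !divr_ge0 ?exprn_ge0 ?mulr_ge0 ?sqr_ge0// ltW.
have cF : continuous (fun p => complex.Re ((\sum_a ZB a (F1 a)) p)) by exact: Re_continuous.
apply: (@le_trans _ _ (ball_int r (fun p => cR r p ^+ k.+2 * complex.Re ((\sum_a ZB a (F1 a)) p)))).
  apply: ball_int_le => //.
    by apply: continuous_mul => //; exact/continuous_exp/c_continuous.
  by move=> p cp; rewrite ler_wpM2l// exprn_ge0// ltW.
rewrite divergence_ball_int//.
have -> : t * (energy k.+2 r - energy k.+3 r) + K * mass k r = ball_int r (fun p =>
   (t * (cR r p ^+ k.+2 * (w p * N p)) + (- t) * (cR r p ^+ k.+3 * (w p * N p))) +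
   K * (cR r p ^+ k * (w p * m p))).
  have i1 := @continuous_scale _ _ t _ (@cwN k.+2 r).
  have i2 := @continuous_scale _ _ (- t) _ (@cwN k.+3 r).
  have i3 := @continuous_scale _ _ K _ (@cwm k r).
  rewrite (ball_int_add r0 (continuous_add i1 i2) i3) (ball_int_add r0 i1 i2).
  by rewrite !(ball_int_scale _ r0)//; rewrite /energy /mass; ring.
apply: ball_int_le => //.
- have -> : (fun p => - (k.+2%:R * cR r p ^+ k.+1) * complex.Re (\sum_a ZB a (cS n r) p * F1 a p))
    = (fun p => (- k.+2%:R * cR r p ^+ k.+1) * complex.Re ((\sum_a ZB a (cS n r) * F1 a) p)).
    by apply/funext => p; rewrite sm_sum mulNr.
  apply: continuous_mul; last exact: Re_continuous.
  exact/continuous_scale/continuous_exp/c_continuous.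
- apply: continuous_add; last exact: continuous_scale.
  by apply: continuous_add; exact: continuous_scale.
move=> p cp; have c1 := c_le1 p r0.
set S := \sum_a _; set c := cR r p in cp c1 *.
have -> : t * (c ^+ k.+2 * (w p * N p)) + - t * (c ^+ k.+3 * (w p * N p)) =
   t * (c ^+ k.+2 * (1 - c) * (w p * N p)) by rewrite [c ^+ k.+3]exprS; ring.
have ck j : 0 <= c ^+ j by rewrite exprn_ge0// ltW.
have wN : 0 <= w p * N p by rewrite mulr_ge0// ltW.
have wm : 0 <= w p * m p by rewrite mulr_ge0// ltW.
apply: amgm.
- by rewrite mulr_ge0 ?(ltW t0)// mulr_ge0// mulr_ge0// subr_ge0.
- by rewrite mulr_ge0// mulr_ge0.
have SS : sq S <= (4 * (1 - c) / r ^+ 2) * (w p ^+ 2 * (75 * m p * P p)).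
  apply: (le_trans (sq_sum_mul _ _)).
  apply: ler_pM => //; try by apply: sumr_ge0 => ? _; exact: sq_ge0.
  exact: grad_c_bound.
have := le_trans (Re_sqr_le S) SS; move: (complex.Re S) => y hy.
have -> : (- (k.+2%:R * c ^+ k.+1) * y) ^+ 2 = (k.+2%:R ^+ 2 * c ^+ k.+1 ^+ 2) * y ^+ 2 by ring.
apply: (@le_trans _ _ ((k.+2%:R ^+ 2 * c ^+ k.+1 ^+ 2) *
   (4 * (1 - c) / r ^+ 2 * (w p ^+ 2 * (75 * m p * P p))))).
  by rewrite ler_wpM2l// mulr_ge0 ?sqr_ge0.
have -> : 4 * (t * (c ^+ k.+2 * (1 - c) * (w p * N p))) * (K * (c ^+ k * (w p * m p))) =
  (k.+2%:R ^+ 2 * c ^+ k.+1 ^+ 2 * (4 * (1 - c) / r ^+ 2) * w p ^+ 2 * 75 * m p) * (N p / (1 - 2 * de)).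
  have -> : c ^+ k.+1 ^+ 2 = c ^+ k.+2 * c ^+ k.
    have E2 : (k.+1 * 2 = k.+2 + k)%N by rewrite muln2 -addnn -addSnnS.
    by rewrite -exprM -exprD E2.
  have dn : 1 - 2 * de != 0 by rewrite gt_eqF.
  have tn : t != 0 by rewrite gt_eqF.
  have rn : r != 0 by rewrite gt_eqF.
  rewrite /K; move: (c ^+ k.+2) (c ^+ k) (w p) (N p) (m p) => x1 x2 x3 x4 x5.
  move: (1 - 2 * de) dn => d dn; move: (k.+2%:R) => kk.
  by field; rewrite dn tn rn.
rewrite -subr_ge0.
have -> : forall A B D E F G H Q : R, A * B * (D / E * (F * (G * H * Q))) = (A * B * (D / E) * F * G * H) * Q.
  by move=> *; ring.
rewrite -mulrBr mulr_ge0//.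
  rewrite !mulr_ge0 ?sqr_ge0 ?subr_ge0 ?invr_ge0 ?exprn_ge0 ?(ltW r0)//; exact: ltW.
(* Here (1 - 2 de) P <= N replaces P by N, at the cost of the factor 1/(1 - 2 de). *)
rewrite subr_ge0 ler_pdivlMr// mulrC /N lerDr mulr_ge0//; exact: ltW.
Qed.

(** Because m >= ph^2 and de >= 0, the factor m^(-de) is at most ph^(-2 de). *)
Let w_le p : w p <= ph p `^ (n%:R - 1 - de).
Proof.
have p0 := ph0 p.
have E : n%:R - 1 - de = (n%:R - 1 + de) + 2 * (- de) by ring.
rewrite H3 E [X in _ <= X]powRD; last by rewrite (gt_eqF p0) implybT.
rewrite ler_wpM2l ?powR_ge0// powRrM powR_mulrn ?(ltW p0)// !powRN.
rewrite lef_pV2 ?posrE ?powR_gt0 ?exprn_gt0//.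
apply: ge0_ler_powR; rewrite ?nnegrE ?exprn_ge0 ?(ltW p0)//; first exact: ltW.
rewrite /m -[leLHS]addr0 lerD ?sqr_ge0// ler_sqr ?nnegrE ?(ltW p0) ?addr_ge0// ?(ltW p0)//.
by rewrite lerDr.
Qed.

Let w_ph p : w p * ph p ^+ 2 <= ph p `^ (n%:R + 1 - de).
Proof.
have p0 := ph0 p.
have E : n%:R + 1 - de = (n%:R - 1 - de) + 2 by ring.
rewrite E [X in _ <= X]powRD; last by rewrite (gt_eqF p0) implybT.
by rewrite powR_mulrn ?(ltW p0)// ler_wpM2r// sqr_ge0.
Qed.

Let n2 : 2 <= n%:R :> R. Proof. by rewrite (ler_nat _ 2 n). Qed.

(** If ph <= r^(-2), the left side is at most r^(-2(n+1-de)), hence at most r^(-2n) since de < 1;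
    otherwise r^(-4) is below ph^2. *)
Let w_r p r : 1 < r -> w p * r ^- 4 <= ph p `^ (n%:R + 1 - de) + r ^- (2 * n).
Proof.
move=> r1; have p0 := ph0 p; have r0 : 0 < r by apply: lt_trans r1.
have y0 : 0 < r ^- 2 by rewrite invr_gt0 exprn_gt0.
have y1 : r ^- 2 <= 1 by rewrite invf_le1 ?exprn_gt0// exprn_ege1// ltW.
have -> : r ^- 4 = r ^- 2 ^+ 2 by rewrite exprVn -exprM.
have -> : r ^- (2 * n) = r ^- 2 ^+ n by rewrite exprVn -exprM.
move: (r ^- 2) y0 y1 => y y0 y1.
apply: (@le_trans _ _ (ph p `^ (n%:R - 1 - de) * y ^+ 2)).
  by rewrite ler_wpM2r ?sqr_ge0.
have d2 : 2^-1 <= 1 :> R by rewrite invf_le1// ler1n.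
have dd : de < 1 := lt_le_trans de1 d2.
have nn := n2; have dd0 := de0.
have [xy|yx] := leP (ph p) y.
  apply: (@le_trans _ _ (y `^ (n%:R - 1 - de) * y ^+ 2)).
    rewrite ler_wpM2r ?sqr_ge0// ge0_ler_powR ?nnegrE ?(ltW p0) ?(ltW y0)//.
    by lra.
  rewrite -powR_mulrn ?(ltW y0)// -powRD; last by rewrite (gt_eqF y0) implybT.
  rewrite -powR_mulrn ?(ltW y0)// -[leLHS]add0r lerD ?powR_ge0//.
  by rewrite ger_powR ?y0//; lra.
apply: (@le_trans _ _ (ph p `^ (n%:R - 1 - de) * ph p ^+ 2)).
  by rewrite ler_wpM2l ?powR_ge0// ler_sqr ?nnegrE ?(ltW p0) ?(ltW y0)// ltW.
have E : n%:R + 1 - de = (n%:R - 1 - de) + 2 by ring.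
rewrite E [X in _ <= X + _]powRD; last by rewrite (gt_eqF p0) implybT.
by rewrite powR_mulrn ?(ltW p0)// lerDl exprn_ge0// ltW.
Qed.

(** Integrating r^(-2n) over the ball gives order r^2, the same as the growth hypothesis. The free
    factor t lets the energy term be absorbed afterwards. *)
Lemma mass_bound (t : R) : 0 < t -> exists2 K : R, 0 <= K &
  forall r, 1 < r -> mass 4 r <= t * r ^+ 2 * energy 6 r + K * r ^+ 2.
Proof.
(* Chosen so that 40 n^2 t' = t(1 - 2 de): the P-term is then a part of t r^2 times the energy. *)
move=> t0; pose t' := t * (1 - 2 * de) / (40 * n%:R ^+ 2).
have n0 : 0 < n%:R :> R by have := n2; lra.
have t'0 : 0 < t' by rewrite divr_gt0 ?mulr_gt0// ?exprn_gt0.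
pose K := t'^-1 + 1024 * n%:R ^+ 2.
have C0 : 0 <= C.
  have r2 : 1 < 2 :> R by rewrite ltr1n.
  have := le_trans (ball_int_ge0 (fun p _ => powR_ge0 (ph p) _)) (H4 r2).
  by rewrite pmulr_lge0// exprn_gt0.
exists ((8 * n%:R ^+ 2 + 3 + 2 * K ^+ 2) * C + 2 * K ^+ 2 * (2 ^+ n * 2 ^+ n * 2)).
  by do ?[done|exact: sqr_ge0|exact: exprn_ge0|apply: addr_ge0|apply: mulr_ge0].
move=> r r1; have r0 : 0 < r by apply: lt_trans r1.
pose dF : sm := \sum_a ZB a (F2 a).
pose S : sm := \sum_a ZB a (cS n r) * F2 a.
have cdF : continuous (fun p => cR r p ^+ 4 * complex.Re (dF p)).
  by apply: continuous_mul; [exact/continuous_exp/c_continuous|exact: Re_continuous].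
have cSS : continuous (fun p => - (4%:R * cR r p ^+ 3) * complex.Re (S p)).
  have -> : (fun p => - (4%:R * cR r p ^+ 3) * complex.Re (S p)) =
     (fun p => - 4%:R * cR r p ^+ 3 * complex.Re (S p)).
    by apply/funext => p; rewrite mulNr.
  apply: continuous_mul; last exact: Re_continuous.
  exact/continuous_scale/continuous_exp/c_continuous.
have JE : ball_int r (fun p => cR r p ^+ 4 * complex.Re (dF p)) =
   ball_int r (fun p => - (4%:R * cR r p ^+ 3) * complex.Re (S p)).
  by rewrite (divergence_ball_int F2 2 r0); apply: ball_int_eq => p _; rewrite [S p]sm_sum.
set B := fun p => ph p `^ (n%:R + 1 - de).
have cB : continuous B.
  exact: cB0.
pose k1 := 8 * n%:R ^+ 2 + 3 + 2 * K ^+ 2.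
have pw p : 0 < cR r p -> cR r p ^+ 4 * (w p * m p) <=
   t * r ^+ 2 * (cR r p ^+ 6 * (w p * N p)) + k1 * B p + 2 * K ^+ 2 * r ^- (2 * n)
   + 2 * (cR r p ^+ 4 * complex.Re (dF p)) + - 2 * (- (4%:R * cR r p ^+ 3) * complex.Re (S p)).
  move=> cp; have c1 := c_le1 p r0.
  have rn : r != 0 by rewrite gt_eqF.
  have tn : t' != 0 by rewrite gt_eqF.
  have nn : n%:R != 0 :> R by rewrite gt_eqF.
  have e0 : 0 < t' * r ^+ 2 * cR r p ^+ 2.
    by rewrite (mulr_gt0 (mulr_gt0 t'0 (exprn_gt0 2 r0)) (exprn_gt0 2 cp)).
  have h1 := H2 p e0; rewrite -/dF in h1.
  have h2 : complex.Re (S p) ^+ 2 <= 4 / r ^+ 2 * (w p ^+ 2 * (16 * n%:R ^+ 2 * m p * a p)).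
    apply: (le_trans (Re_sqr_le _)); rewrite sm_sum; apply: (le_trans (sq_sum_mul _ _)).
    apply: ler_pM => //; try by apply: sumr_ge0 => ? _; exact: sq_ge0.
    apply: (le_trans (grad_c_bound r0 cp)).
    by rewrite ler_wpM2r ?invr_ge0 ?exprn_ge0 ?(ltW r0)// ler_piMr// lerBlDr lerDl ltW.
    exact: H2'.
  have h3 := w_ph p; have h4 := w_r p r1; rewrite -/B in h3 h4.
  have tE : 40 * n%:R ^+ 2 * t' = t * (1 - 2 * de).
    by rewrite /t'; move: (1 - 2 * de) => d; field; rewrite nn.
  have hN : 0 <= ph p * Nm p by rewrite mulr_ge0// ltW.
  exact: (mass_bound_pointwise cp c1 (w0 p) (a0 p) (ph0 p) (P0 p) hN n2 r0 t0 t'0 d1 tE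
    (erefl K) (erefl (m p)) h1 h2 h3 h4).
apply: (@le_trans _ _ (ball_int r (fun p => t * r ^+ 2 * (cR r p ^+ 6 * (w p * N p)) + k1 * B p
   + 2 * K ^+ 2 * r ^- (2 * n)
   + 2 * (cR r p ^+ 4 * complex.Re (dF p)) + - 2 * (- (4%:R * cR r p ^+ 3) * complex.Re (S p))))).
  apply: ball_int_le => //.
  do 2![apply: continuous_add; last exact: continuous_scale].
  apply: continuous_add; last by move=> p; exact: cst_continuous.
  by apply: continuous_add; apply: continuous_scale => //; exact: (@cwN 6 r).
have i1 := @continuous_scale _ _ (t * r ^+ 2) _ (@cwN 6 r).
have i2 := @continuous_scale _ _ k1 _ cB.
have i3 : continuous (fun p : heis R n => 2 * K ^+ 2 * r ^- (2 * n)).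
  by move=> p; exact: cst_continuous.
have i4 := @continuous_scale _ _ 2 _ cdF.
have i5 := @continuous_scale _ _ (- 2) _ cSS.
have i12 := continuous_add i1 i2.
have i123 := continuous_add i12 i3.
rewrite (ball_int_add r0 (continuous_add i123 i4) i5) (ball_int_add r0 i123 i4) (ball_int_add r0 i12 i3).
rewrite (ball_int_add r0 i1 i2) (ball_int_scale _ r0 (@cwN 6 r)) (ball_int_scale _ r0 cB)
  (ball_int_scale _ r0 cdF) (ball_int_scale _ r0 cSS) JE -/(energy 6 r).
have := H4 r1; rewrite -/B => hB.
have rn0 : 0 <= 2 * K ^+ 2 * r ^- (2 * n).
  by do ?[done|exact: sqr_ge0|apply: mulr_ge0]; rewrite invr_ge0 exprn_ge0// ltW.
have := ball_int_cst_le n r0 rn0.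
have -> : 2 * K ^+ 2 * r ^- (2 * n) * ((2 * r) ^+ n * (2 * r) ^+ n * (2 * r ^+ 2)) =
  2 * K ^+ 2 * (2 ^+ n * 2 ^+ n * 2) * r ^+ 2.
  rewrite mulnC exprM !exprMn; have rn : r ^+ n != 0 by rewrite gt_eqF// exprn_gt0.
  by field.
have k10 : 0 <= k1 by do ?[done|exact: sqr_ge0|apply: addr_ge0|apply: mulr_ge0].
have := ler_wpM2l k10 hB; rewrite -/k1.
lra.
Qed.

Lemma ball_int_subset r r' (h : heis R n -> R) : 0 < r -> r <= r' -> continuous h ->
  (forall p, 0 < cR r' p -> 0 <= h p) -> ball_int r h <= ball_int r' h.
Proof.
move=> r0 rr ch h0; have r'0 : 0 < r' by apply: lt_le_trans rr.
have sub : [set p | 0 < cR r p] `<=` [set p : heis R n | 0 < cR r' p].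
  move=> p /=; rewrite !c_pos// => /lt_le_trans; apply.
  by rewrite lerXn2r ?nnegrE ?(ltW r0) ?(ltW r'0).
rewrite -lee_fin /ball_int /Rintegral !fineK; try by
  (apply: integrable_fin_num; [exact: ball_measurable|exact: ball_int_integrable]).
apply: ge0_subset_integral => //; try exact: ball_measurable.
by apply/measurable_EFinP/measurable_funTS; exact: heis_continuous_measurable.
Qed.

Lemma energy_ge0 k r : 0 <= energy k r.
Proof.
apply: ball_int_ge0 => p cp; apply: mulr_ge0; first by rewrite exprn_ge0// ltW.
by apply: mulr_ge0 => //; exact: ltW.
Qed.

(** On the smaller ball, 1 - c at radius lr is l^(-4) times 1 - c at radius r, so c at radius lr is
    at least 1 - l^(-4), and Bernoulli estimates its seventh power. For large l the change of
    exponent therefore costs nothing. *)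
Lemma energy_grow l r : 0 < r -> 1 < l -> (1 - 7 * l ^- 4) * energy 6 r <= energy 7 (l * r).
Proof.
move=> r0 l1; have l0 : 0 < l by apply: lt_trans l1.
have rl : r <= l * r by rewrite ler_peMl ?(ltW r0) ?(ltW l1).
have lr0 : 0 < l * r by rewrite mulr_gt0.
apply: (@le_trans _ _ (ball_int r (fun p => cR (l * r) p ^+ 7 * (w p * N p)))); last first.
  apply: ball_int_subset => // p cp; apply: mulr_ge0; first by rewrite exprn_ge0// ltW.
  by apply: mulr_ge0 => //; exact: ltW.
rewrite -(ball_int_scale _ r0 (@cwN 6 r)); apply: ball_int_le => //; first exact/continuous_scale/(@cwN 6).
move=> p cp; rewrite mulrA; apply: ler_wpM2r; first by apply: mulr_ge0 => //; exact: ltW.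
have y0 : 0 < l ^- 4 by rewrite invr_gt0 exprn_gt0.
have y1 : l ^- 4 < 1 by rewrite invf_lt1 ?exprn_gt0// exprn_egt1.
have cE : cR (l * r) p = 1 - l ^- 4 * (1 - cR r p).
  by rewrite /cR exprMn invfM; ring.
have c1 := c_le1 p r0; have c60 : 0 <= cR r p ^+ 6 by rewrite exprn_ge0// ltW.
have x1 : 1 - l ^- 4 <= cR (l * r) p.
  by rewrite cE lerD2l lerN2 ler_piMr ?(ltW y0)// gerBl ltW.
have z0 : 0 <= 1 - l ^- 4 by rewrite subr_ge0 ltW.
have cl0 := le_trans z0 x1.
have b7 : 1 - 7 * l ^- 4 <= cR (l * r) p ^+ 7.
  apply: (@le_trans _ _ ((1 - l ^- 4) ^+ 7)).
    by apply: bernoulli; rewrite ltW.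
  by apply: lerXn2r => //; rewrite nnegrE.
apply: (le_trans (ler_wpM2r c60 b7)).
rewrite ler_piMr ?exprn_ile1 ?(ltW cp)//.
by rewrite exprn_ge0.
Qed.

(** The supremum of [energy 6] over all radii serves as the limit, and [energy_grow] brings
    [energy 7] at a larger radius close to it; the difference of the two is then small while t is
    still free. *)
Lemma energy_le0 r : 1 < r -> energy 6 r <= 0.
Proof.
pose c1 := 75 * 6 ^+ 2 / (1 - 2 * de).
have c10 : 0 < c1 by rewrite divr_gt0// mulr_gt0// exprn_gt0.
(* With t = 1/2 in [caccioppoli] the mass has coefficient 2 [c1]/r^2; this choice reduces the energy
   part of [mass_bound] to a quarter, which is absorbed. *)
have tt0 : 0 < (8 * c1)^-1 by rewrite invr_gt0 mulr_gt0.
have [K K0 hY] := mass_bound tt0.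
have I1 s' t : 1 < s' -> 0 < t -> energy 6 s' <= t * (energy 6 s' - energy 7 s') + c1 / t / s' ^+ 2 * mass 4 s'.
  by move=> s1 t0; apply: caccioppoli => //; apply: lt_trans s1.
have X6 s' : 1 < s' -> energy 6 s' <= 8 * c1 * K.
  move=> s1; have s0 : s' != 0 by rewrite gt_eqF// (lt_trans _ s1).
  have h2 : 0 < 2^-1 :> R by rewrite invr_gt0.
  have := I1 _ _ s1 h2.
  have := energy_ge0 7 s'.
  have q : 0 <= c1 / 2^-1 / s' ^+ 2.
    by apply: divr_ge0; [apply: divr_ge0; exact: ltW|exact: sqr_ge0].
  have := ler_wpM2l q (hY _ s1).
  have -> : c1 / 2^-1 / s' ^+ 2 * ((8 * c1)^-1 * s' ^+ 2 * energy 6 s' + K * s' ^+ 2) =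
    energy 6 s' / 4 + 2 * c1 * K by field; rewrite s0 gt_eqF.
  lra.
pose L := c1 * (2 * K).
have I2 s' t : 1 < s' -> 0 < t -> energy 6 s' <= t * (energy 6 s' - energy 7 s') + L / t.
  move=> s1 t0; apply: (le_trans (I1 _ _ s1 t0)); rewrite lerD2l.
  have s0 : s' != 0 by rewrite gt_eqF// (lt_trans _ s1).
  have q : 0 <= c1 / t / s' ^+ 2.
    by apply: divr_ge0; [apply: divr_ge0; exact: ltW|exact: sqr_ge0].
  apply: (le_trans (ler_wpM2l q (hY _ s1))).
  have -> : c1 / t / s' ^+ 2 * ((8 * c1)^-1 * s' ^+ 2 * energy 6 s' + K * s' ^+ 2) =
    (energy 6 s' / 8 + c1 * K) / t by field; rewrite s0 (gt_eqF t0) (gt_eqF c10).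
  by rewrite ler_wpM2r ?invr_ge0 ?(ltW t0)// /L; have := X6 _ s1; lra.
pose A := [set energy 6 s' | s' in [set s' | 1 < s']].
have supA : has_sup A.
  split; first by exists (energy 6 2); exists 2 => //=; rewrite ltr1n.
  by exists (8 * c1 * K) => _ [s' /= s1 <-]; exact: X6.
pose l := sup A.
have lX s' : 1 < s' -> energy 6 s' <= l by move=> s1; apply: ub_le_sup; [case: supA|exists s'].
suff l0 : l <= 0 by move=> r1; apply: le_trans l0; exact: lX.
have l00 : 0 <= l by apply: le_trans (energy_ge0 6 2) (lX _ _); rewrite ltr1n.
have key (t eta : R) : 0 < t -> 0 < eta -> l - eta <= t * eta + L / t.
  move=> t0 eta0.
  have [_ [r0 /= r01 <-] hr0] := @sup_adherent _ A (eta / 2) (divr_gt0 eta0 (ltr0Sn _ 1)) supA.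
  (* Since la^4 >= la, this ratio of radii makes the loss 7 la^(-4) l at most eta/2; the summand 2
     ensures la > 1. *)
  rewrite -/l in hr0; pose la := 2 + 14 * l / eta.
  have q0 : 0 <= 14 * l / eta by rewrite divr_ge0 ?(ltW eta0)// mulr_ge0.
  have la1 : 1 < la by rewrite /la; lra.
  have la0 : 0 < la by apply: lt_trans la1.
  have h7 : 7 * la ^- 4 * l <= eta / 2.
    have : la <= la ^+ 4 by rewrite ler_eXnr// ltW.
    move=> hla; rewrite mulrAC ler_pdivrMr ?exprn_gt0//.
    apply: (@le_trans _ _ (eta / 2 * la)); last by rewrite ler_wpM2l// divr_ge0// ltW.
    have -> : eta / 2 * la = eta + 7 * l by rewrite /la; field; rewrite gt_eqF.
    lra.
  have lr1 : 1 < la * r0 by rewrite mulr_egt1.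
  have r00 : 0 < r0 by apply: lt_trans r01.
  have g := energy_grow r00 la1.
  have u0 : 0 <= 7 * la ^- 4 by rewrite mulr_ge0// invr_ge0 exprn_ge0// ltW.
  have g2 := ler_wpM2l u0 (lX _ r01).
  have b7 : l - eta <= energy 7 (la * r0) by lra.
  have b6 := lX _ lr1.
  have i2 := I2 _ _ lr1 t0.
  have b67 : energy 7 (la * r0) <= energy 6 (la * r0).
    have lr0 : 0 < la * r0 by rewrite mulr_gt0.
    apply: ball_int_le => // p cp; apply: ler_wpM2r; first by apply: mulr_ge0 => //; exact: ltW.
    by rewrite exprS ler_piMl ?c_le1// exprn_ge0// ltW.
  have : t * (energy 6 (la * r0) - energy 7 (la * r0)) <= t * eta by rewrite ler_wpM2l ?(ltW t0)//; lra.
  lra.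
rewrite leNgt; apply/negP => lp.
have L0 : 0 <= L.
  by apply: mulr_ge0; [exact: ltW|apply: mulr_ge0].
(* Then L/t <= l/4, while eta = l/(8t) makes both eta and t eta at most l/8; [key] would give l -
   l/8 <= l/8 + l/4, absurd for l > 0. *)
pose t := 1 + 4 * L / l.
have t1 : 1 <= t by rewrite /t lerDl; apply: divr_ge0 => //; apply: mulr_ge0.
have t0 : 0 < t by apply: lt_le_trans t1.
have eta0 : 0 < l / (8 * t) by rewrite divr_gt0// mulr_gt0.
have := key _ _ t0 eta0.
have -> : t * (l / (8 * t)) = l / 8 by field; rewrite gt_eqF.
have e8 : l / (8 * t) <= l / 8.
  by rewrite ler_wpM2l// lef_pV2 ?posrE ?mulr_gt0// ler_peMr.
have : L / t <= l / 4.
  rewrite ler_pdivrMr// /t mulrDr mulr1.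
  have -> : l / 4 * (4 * L / l) = L by field; rewrite gt_eqF.
  by rewrite lerDr divr_ge0.
lra.
Qed.

Lemma N_eq0 p : N p = 0.
Proof.
apply/eqP; rewrite eq_le N0 andbT.
have rp := rho_ge0 p.
(* As rho p < r <= r^4, the point p lies in the ball of radius r. *)
pose r := 2 + rho p.
have r1 : 1 < r by rewrite /r; lra.
have r0 : 0 < r by apply: lt_trans r1.
have cp : 0 < cR r p.
  rewrite c_pos//; apply: (@lt_le_trans _ _ r); first by rewrite /r; lra.
  by rewrite ler_eXnr// ltW.
have h q : 0 < cR r q -> 0 <= cR r q ^+ 6 * (w q * N q).
  by move=> cq; rewrite mulr_ge0 ?exprn_ge0 ?(ltW cq)// mulr_ge0// ltW.
have := ball_int_eq0 r0 (@cwN 6 r) h (energy_le0 r1) cp.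
by rewrite pmulr_rle0 ?exprn_gt0// pmulr_rle0.
Qed.

End estimates.

(** * Rigidity *)

Section directional.
Context (R : realType) (V : normedModType R).

Lemma dv_linear (F : sm V) (k : R) (v w : V) :
  dv (k *: v + w) F = scst V k%:C * dv v F + dv w F.
Proof.
have L (f : V -> R) p : smooth f -> 'D_(k *: v + w) f p = k * 'D_v f p + 'D_w f p.
  by move=> sf; rewrite !deriveE ?linearP//; exact: smooth_differentiable.
have [F1 F2] := sm_smooth F.
apply: smP => p; have e (x y z : sm V) : (x * y + z) p = x p * y p + z p by [].
rewrite e; apply: complex_eqP; [rewrite cReD cReM|rewrite cImD cImM] => /=.
  by rewrite (L _ p F1) mul0r subr0.
by rewrite (L _ p F2) mul0r addr0.
Qed.

End directional.

Section constancy.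
Context (R : realType) (n : nat) (hn : (0 < n)%N).
Local Notation sm := (sm (heis R n)).
Implicit Types (F : sm) (p v : heis R n).

(** When TF = 0 the x- and y-derivatives are combinations of Z_a F and Zbar_a F; together with T
    they span all constant directions. *)
Lemma heis_cst F : (forall a, ZZ a F = 0) -> (forall a, ZB a F = 0) -> TT F = 0 ->
  F = scst _ (F 0).
Proof.
move=> Z0 B0 T0.
have hx a : dv (vx R a) F = 0.
  have := Z0 a; have := B0 a; rewrite /ZZ /ZB T0 !mulr0 subr0 addr0 => e1 e2.
  have -> : dv (vx R a) F = half R n * (dv (vx R a) F - ii R n * dv (vy R a) F) +
     half R n * (dv (vx R a) F + ii R n * dv (vy R a) F).
    by rewrite -mulrDr addrACA addNr addr0 half_mul2.
  by rewrite e1 e2 addr0.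
have hy a : dv (vy R a) F = 0.
  have := B0 a; rewrite /ZB T0 mulr0 subr0 hx add0r => e1.
  have -> : dv (vy R a) F = - (ii R n * ((half R n + half R n) * (ii R n * dv (vy R a) F))).
    by rewrite half2 mul1r mulrA ii2; ring.
  by rewrite mulrDl e1 addr0 mulr0 oppr0.
have dx (x : 'rV[R]_n) : dv (x, 0, 0) F = 0.
  rewrite [x]row_sum_delta; elim/big_rec: _ => [|a y _ hy'].
    have := dv_linear F 1 (0 : heis R n) 0; rewrite scaler0 addr0 scst1C mul1r => /esym/eqP.
    by rewrite -[X in _ == X]addr0 (inj_eq (addrI _)) => /eqP.
  have -> : (x 0 a *: delta_mx 0 a + y, 0, 0) = x 0 a *: vx R a + (y, 0, 0) :> heis R n.
    by congr (_, _, _); rewrite /= scaler0 addr0.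
  by rewrite dv_linear hx hy' mulr0 addr0.
have d0 : dv (0 : heis R n) F = 0 := dx 0.
have dy (x : 'rV[R]_n) : dv (0, x, 0) F = 0.
  rewrite [x]row_sum_delta; elim/big_rec: _ => [//|a y _ hy'].
  have -> : (0, x 0 a *: delta_mx 0 a + y, 0) = x 0 a *: vy R a + (0, y, 0) :> heis R n.
    by congr (_, _, _); rewrite /= scaler0 addr0.
  by rewrite dv_linear hy hy' mulr0 addr0.
apply: smP => p; apply: dv_eq0 => -[[x y] t].
have -> : (x, y, t) = 1 *: (x, 0, 0) + (1 *: (0, y, 0) + (t *: vt R n + 0)) :> heis R n.
  by congr (_, _, _); rewrite /= !scaler0 ?scale1r ?add0r ?addr0//; exact/esym/mulr1.
by rewrite !dv_linear dx dy d0 -/(TT F) T0 !mulr0 !addr0.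
Qed.

Lemma TTN F : TT (- F) = - TT F. Proof. exact: dvN. Qed.

Lemma ZZ_sum a (F : 'I_n -> sm) : ZZ a (\sum_b F b) = \sum_b ZZ a (F b).
Proof. exact: (big_morph (ZZ a) (@ZZD R n a) (ZZ0 R a)). Qed.

Lemma ZB_sum a (F : 'I_n -> sm) : ZB a (\sum_b F b) = \sum_b ZB a (F b).
Proof. exact: (big_morph (@ZB R n a) (@ZBD R n a) (@ZB0 R n a)). Qed.

Lemma TT_sum (F : 'I_n -> sm) : TT (\sum_b F b) = \sum_b TT (F b).
Proof. exact: (big_morph (@TT R n) (@TTD R n) (dv0 _)). Qed.

Lemma ZB_st a : ZB a (st R n) = - (ii R n * sz R a).
Proof. by rewrite -[st R n]cj_real ZB_cj ZZ_st cjM cj_ii cjK mulNr. Qed.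

Lemma dlt_sum (F : 'I_n -> sm) a : \sum_b dlt R b a * F b = F a.
Proof.
by rewrite (bigD1 a)//= /dlt eqxx mul1r big1 ?addr0// => b /negPf ->; rewrite mul0r.
Qed.

(** Subtracting the model t + i|z|^2, which has the same Zbar and T derivatives, leaves a function
    killed by Zbar and T. Its Z-derivatives are constants and give mu; removing the linear part
    leaves the constant lam. *)
Lemma affine_CR F : (forall a, ZB a F = 0) -> TT F = 1 ->
  (forall a b, ZZ b (ZZ a F) = 0) -> exists (mu : 'I_n -> R[i]) (lam : R[i]),
  (F = st R n + ii R n * nz R n + \sum_a scst _ (mu a) * sz R a + scst _ lam) /\
  forall a, ZZ a F = (ii R n * cj (sz R a)) *+ 2 + scst _ (mu a).
Proof.
move=> BF TF ZZF.
have Bnz a : ZB a (nz R n) = sz R a.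
  rewrite /nz ZB_sum -[RHS]dlt_sum; apply: eq_bigr => b _.
  by rewrite ZBM ZB_sz ZB_cj ZZ_sz cj_dlt /dlt mul0r add0r mulrC.
have Znz a : ZZ a (nz R n) = cj (sz R a).
  rewrite /nz ZZ_sum -[RHS](dlt_sum (fun b => cj (sz R b))); apply: eq_bigr => b _.
  by rewrite ZZM ZZ_sz ZZ_cj ZB_sz cj0 mulr0 addr0.
have Tnz : TT (nz R n) = 0.
  by rewrite /nz TT_sum big1// => b _; rewrite TTM TT_cj TT_sz cj0 mul0r mulr0 addr0.
have Tst : TT (st R n) = 1 by rewrite /TT dv_st /= scst1C.
pose G : sm := st R n + ii R n * nz R n.
have BG a : ZB a G = 0.
  by rewrite /G ZBD ZB_st (ZBM a (ii R n)) Bnz ZB_cst mul0r add0r addNr.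
have ZG a : ZZ a G = (ii R n * cj (sz R a)) *+ 2.
  by rewrite /G ZZD ZZ_st (ZZM a (ii R n)) Znz ZZ_cst mul0r add0r -mulr2n.
have TG : TT G = 1.
  by rewrite /G TTD (TTM (ii R n)) Tnz TT_cst Tst mul0r mulr0 !addr0.
pose F0 := F - G.
have BF0 a : ZB a F0 = 0 by rewrite /F0 ZBD ZBN BF BG subrr.
have TF0 : TT F0 = 0 by rewrite /F0 TTD TTN TF TG subrr.
have ZZG a b : ZZ b (ZZ a G) = 0.
  rewrite ZG mulr2n ZZD (ZZM b (ii R n)) ZZ_cst ZZ_cj ZB_sz cj0; by ring.
pose mu a := ZZ a F0 0.
(* On [F0] the fields Zbar and Z commute, since their commutator is a multiple of T [F0] = 0. *)
have ZF0 a : ZZ a F0 = scst _ (mu a).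
  apply: heis_cst => [b|b|].
  - by rewrite /F0 ZZD ZZN ZZD ZZN ZZF ZZG subrr.
  - by rewrite ZB_ZZ BF0 ZZ0 TF0 mulr0 mul0rn addr0.
  - by rewrite TT_ZZ TF0 ZZ0.
pose F1 := F0 - \sum_a scst _ (mu a) * sz R a.
have F1E : F1 = scst _ (F1 0).
  apply: heis_cst => [b|b|].
  - rewrite /F1 ZZD ZZN ZZ_sum ZF0 -[X in X - _](dlt_sum (fun b => scst _ (mu b))) -sumrB big1// => a _.
    by rewrite (ZZM b (scst _ _)) ZZ_cst ZZ_sz; ring.
  - rewrite /F1 ZBD ZBN ZB_sum BF0 big1 ?subrr// => a _.
    by rewrite (ZBM b (scst _ _)) ZB_cst ZB_sz; ring.
  - rewrite /F1 TTD TTN TT_sum TF0 big1 ?subrr// => a _.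
    by rewrite (TTM (scst _ _)) TT_cst TT_sz; ring.
exists mu, (F1 0); split.
  by rewrite -F1E /F1 /F0 -/G; ring.
by move=> a; rewrite -ZF0 -ZG -ZZD /F0 addrC subrK.
Qed.

End constancy.

Section rigidity.
Context (R : realType) (n : nat) (hn : (0 < n)%N).
Local Notation sm := (sm (heis R n)).
Local Notation I := (ii R n).
Local Notation cj := (@cj R (heis R n)).
Local Notation Z := (@ZZ R n).
Local Notation Zb := (@ZB R n).
Local Notation T := (@TT R n).
Implicit Types (p v : heis R n).
Variables (f phi : sm).
Hypotheses (f_real : cj f = f) (phi_real : cj phi = phi).
Hypothesis Zphi : forall a, Z a phi = (phi * Z a f) *+ 2.
Hypothesis phi_gt0 : forall p, 0 < complex.Re (phi p).
Local Notation g := (jlg Z T cj I f phi).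
Local Notation gb := (jlgb Z T cj I f phi).
Local Notation fz := (fz Z f).
Hypothesis Dt0 : forall a b, Dt Z f a b = 0.
Hypothesis Et0 : forall a b, Et Z Zb T cj I f phi a b = 0.
Hypothesis Gv0 : forall a, Gv Z T cj I f phi a = 0.
Let H := heis_calculus_sm R n.

Let Dv0 a : Dv Z cj f a = 0.
Proof. by rewrite /Dv big1// => b _; rewrite Dt0 mul0r. Qed.
Let Ev0 a : Ev Z Zb T cj I f phi a = 0.
Proof. by rewrite /Ev big1// => b _; rewrite Et0 mul0r. Qed.

Let Zg a : Z a g = (g * fz a) *+ 2.
Proof.
by rewrite (Z_jlg H f_real phi_real Zphi) Dv0 Ev0 Gv0 subr0 !add0r.
Qed.

Let Zbg a : Zb a g = 0.
Proof.
by rewrite (Zb_jlg H f_real phi_real Zphi) Dv0 Ev0 Gv0 !addr0 cj0.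
Qed.

(** The inverse of g as conj(g)/|g|^2, which stays in the ring of smooth functions. *)
Let ginv : sm := gb * sreal (smooth_powR (- 1) (mR_gt0 f phi_gt0) (smooth_mR f phi)).

Let ggV : g * ginv = 1.
Proof.
have e (x y z : sm) p : (x * (y * z)) p = (x * y) p * z p by rewrite mulrA.
apply: smP => p; rewrite /ginv e (ggbE f_real phi_real) sm1 /=.
by rewrite powR_inv1 ?ltW ?mR_gt0// -rmorphM /= divff ?rmorph1// gt_eqF// mR_gt0.
Qed.

Let w : sm := I * ginv.

Let gw : g * w = I.
Proof. by rewrite /w mulrCA ggV mulr1. Qed.

Let cancel_g (x y : sm) : g * x = g * y -> x = y.
Proof.
move=> e; have := congr1 (fun z => ginv * z) e.
by rewrite !mulrA [ginv * g]mulrC ggV !mul1r.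
Qed.

Let Zw a : Z a w = - (w * fz a) *+ 2.
Proof.
apply: cancel_g; have := congr1 (Z a) gw.
rewrite (ZZM a g) Zg [RHS]ZZ_cst => /eqP; rewrite addrC addr_eq0 => /eqP ->; ring.
Qed.

Let Zbw a : Zb a w = 0.
Proof.
apply: cancel_g; have := congr1 (Zb a) gw.
by rewrite (ZBM a g) Zbg [RHS]ZB_cst mul0r add0r mulr0.
Qed.

Let half_inj (x y : sm) : x *+ 2 = y *+ 2 -> x = y.
Proof. by move=> e; rewrite -(half_mul2 x) -(half_mul2 y) -!mulr2n e. Qed.

(** The contributions of Z w = -2w Zf and of Z_b Z_a f = 2 f_a f_b, the vanishing of D, cancel each
    other. *)
Let ZZw a b : Z b (Z a w) = 0.
Proof.
have ZDf : Z b (fz a) = (fz a * fz b) *+ 2.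
  by have := Dt0 a b => /eqP; rewrite subr_eq0 => /eqP.
rewrite Zw mulr2n ZZD !ZZN (ZZM b w) ZDf Zw; ring.
Qed.

(** Since Zbar w = 0, the commutator gives 2i Tw = Zbar_a(-2w f_a), and Zbar_a f_a = -g together
    with gw = i makes this 2i. An index a exists because n > 0. *)
Let Tw : T w = 1.
Proof.
pose a := Ordinal hn; have i2 := ii2 R n.
have e := ZB_ZZ a a w; rewrite Zbw ZZ0 add0r /dlt eqxx mulr1 in e.
have ZDf : Zb a (fz a) = - g.
  have := Et0 a a => /eqP; rewrite /Et eqxx mulr1 addr_eq0 => /eqP; by [].
move: e; rewrite Zw mulr2n ZBD !ZBN (ZBM a w) Zbw ZDf mul0r add0r mulrN opprK mulrC gw -mulr2n.
move=> /half_inj; move: (T w) => t e.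
have -> : t = - (I * (I * t)) by rewrite mulrA i2; ring.
by rewrite -e i2 opprK.
Qed.

Definition wfun (mu : 'I_n -> R[i]) (lam : R[i]) p : R[i] :=
  (p.2)%:C + 'i%C * (znorm p)%:C + \sum_a mu a * zcoord p 0 a + lam.

(** From gw = i follows Im w = |w|^2 (|Zf|^2 + phi). Summing |Z_a w|^2 = 4|w|^2 |f_a|^2 with Z_a w =
    2i conj(z_a) + mu_a evaluates |w|^2 |Zf|^2; in the difference |w|^2 phi the terms |z|^2 and Im
    <mu,z> cancel. *)
Lemma rigid : exists (mu : 'I_n -> R[i]) (lam : R[i]), forall p,
  complex.Re (phi p) * sq (wfun mu lam p) = complex.Im lam - (\sum_a sq (mu a)) / 4
  /\ wfun mu lam p != 0.
Proof.
have [mu [lam [wE ZwE]]] := affine_CR Zbw Tw ZZw.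
exists mu, lam => p.
have wp : w p = wfun mu lam p.
  have e (x y z s l : sm) : (x + y * z + s + l) p = x p + y p * z p + s p + l p by [].
  rewrite wE e nzE sm_sum /wfun; congr (_ + _ + _ + _).
  by apply: eq_bigr => a _; rewrite smM szE.
have gwp : g p * w p = 'i%C by have := congr1 (fun x : sm => x p) gw; rewrite smM.
have w0 : w p != 0.
  apply/eqP => e; move: gwp; rewrite e mulr0 => /(congr1 (@complex.Im R)) /=.
  by move=> /esym/eqP; exact/negP/oner_neq0.
split; last by rewrite -wp.
have Zwp a : sq ('i%C * conjc (zcoord p 0 a) *+ 2 + mu a) = 4 * sq (w p) * sq (fz a p).
  have := congr1 (fun x : sm => sq (x p)) (ZwE a); rewrite Zw.
  have e (x y m' : sm) : ((x * y) *+ 2 + m') p = (x p * y p) *+ 2 + m' p by [].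
  have e' (x y : sm) : (- (x * y) *+ 2) p = (- (x p * y p)) *+ 2 by [].
  rewrite (congr1 (@sq R) (e I (cj (sz R a)) (scst _ (mu a)))) (congr1 (@sq R) (e' w (fz a))).
  rewrite -[cj _ p]/(conjc (sz R a p)) szE => <-.
  move: (w p) (fz a p) => [x1 x2] [y1 y2]; rewrite /sq !mulr2n /=; ring.
have sumZ : 4 * sq (w p) * aR f p = 4 * znorm p + \sum_a sq (mu a) + 4 * complex.Im (\sum_a mu a * zcoord p 0 a).
  rewrite /aR mulr_sumr; under eq_bigr do rewrite -Zwp.
  rewrite (big_morph (@complex.Im R) (@cImD R) (erefl _)) /znorm !mulr_sumr -!big_split /=.
  apply: eq_bigr => a _; rewrite /zcoord mxE; case: (mu a) => m1 m2.
  by rewrite /sq mulr2n /=; ring.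
have A : complex.Im (w p) = sq (w p) * AR f phi p.
  have : complex.Re (g p * w p * conjc (w p)) = sq (w p) * AR f phi p.
    rewrite -mulrA mul_conj (gE f_real phi_real).
    by move: (sq _) (AR _ _ _) (sR _ _) => x y z /=; ring.
  by rewrite gwp => <-; case: (w p) => x y /=; ring.
have Imw : complex.Im (w p) = znorm p + complex.Im (\sum_a mu a * zcoord p 0 a) + complex.Im lam.
  by rewrite wp /wfun !cImD cImM /=; ring.
rewrite -wp -[complex.Re (phi p)]/(phR phi p).
move: A; rewrite Imw /AR; move: sumZ; set S := \sum_a sq (mu a).
move: (sq (w p)) (aR f p) (phR phi p) => x y z; lra.
Qed.

End rigidity.

(** * The classification *)

Section vanishing.
Context (R : realType) (n : nat) (hn : (2 <= n)%N).
Local Notation sm := (sm (heis R n)).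
Local Notation I := (ii R n).
Local Notation cj := (@cj R (heis R n)).
Local Notation Z := (@ZZ R n).
Local Notation Zb := (@ZB R n).
Local Notation T := (@TT R n).
Implicit Types (p v : heis R n).

Lemma sq_eq0 (x : R[i]) : sq x = 0 -> x = 0.
Proof.
case: x => a b; rewrite /sq /= => /eqP; rewrite paddr_eq0 ?sqr_ge0// !sqrf_eq0.
by move=> /andP[/eqP-> /eqP->].
Qed.

Lemma Pf_eq0 (x y z : R[i]) : Pf x y z = 0 -> z = 0.
Proof.
move=> e; apply: sq_eq0; apply/eqP; rewrite eq_le sq_ge0 andbT.
move: e (sq_ge0 (z + x)) (sq_ge0 (z - y)) (sq_ge0 (x + y)); rewrite /Pf.
move: (sq z) (sq _) (sq _) (sq _) => a b c d e; lra.
Qed.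

Variables (f phi : sm).
Hypotheses (f_real : cj f = f) (phi_real : cj phi = phi).
Hypothesis Zphi : forall a, Z a phi = (phi * Z a f) *+ 2.
Hypothesis Tphi : T phi = (phi * T f) *+ 2.
Hypothesis pde : \sum_a Zb a (Z a f) = - (n%:R * jlg Z T cj I f phi).
Hypothesis phi_gt0 : forall p, 0 < complex.Re (phi p).
Variables (de C : R).
Hypotheses (de0 : 0 <= de) (de1 : de < 2^-1).
Hypothesis growth : forall r, 1 < r ->
  ball_int r (fun p => phR phi p `^ (n%:R + 1 - de)) <= C * r ^+ 2.

Lemma PfR_continuous : continuous (PfR f phi).
Proof.
pose q (x : sm) := x * cj x.
pose F : sm := \sum_a (q (Gv Z T cj I f phi a) + q (Gv Z T cj I f phi a + Dv Z cj f a)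
  + q (Gv Z T cj I f phi a - Ev Z Zb T cj I f phi a)
  + q (Dv Z cj f a + Ev Z Zb T cj I f phi a)).
have -> : PfR f phi = (fun p => complex.Re (F p)); last exact: Re_continuous.
apply/funext => p; rewrite /F sm_sum Re_sum; apply: eq_bigr => a _.
have e (x y z : sm) : complex.Re ((q z + q (z + x) + q (z - y) + q (x + y)) p) =
    Pf (x p) (y p) (z p).
  rewrite -[(q z + q (z + x) + q (z - y) + q (x + y)) p]/(z p * conjc (z p) +
    (z p + x p) * conjc (z p + x p) + (z p - y p) * conjc (z p - y p)
    + (x p + y p) * conjc (x p + y p)).
  by rewrite !mul_conj.
by rewrite e.
Qed.

Lemma nR_continuous : continuous (fun p => nER f phi p + nDR f p).
Proof.
have -> : (fun p => nER f phi p + nDR f p) = (fun p => complex.Re ((normE Z Zb T cj I f phi + normD Z cj f) p)).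
  by apply/funext => p; rewrite smD nE_val nD_val.
exact: Re_continuous.
Qed.

Lemma NR_eq0 p : NR f phi de p = 0.
Proof.
have w0 := wR_gt0 f phi_gt0 de.
have sqW (x : R) (y : R[i]) : sq (x%:C * y) = x ^+ 2 * sq y.
  by case: y => y1 y2; rewrite /sq /=; ring.
apply: (@N_eq0 R n hn (aR f) (phR phi) (sR f) (PfR f phi) (fun p => nER f phi p + nDR f p)
  (wR f phi de) (fun a => weight f phi_gt0 de * Vv Z Zb T cj I f phi a)
  (fun a => weight f phi_gt0 de * test_fun f phi * fz Z f a) de _ _ _ _ _ _ _ _ _ _ _ de0 de1
  _ _ _ _ _ C growth).
- by move=> q; exact: (smooth_continuous (smooth_aR f)).
- by move=> q; exact: (smooth_continuous (smooth_phR phi)).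
- by move=> q; exact: (smooth_continuous (smooth_sR f)).
- exact: PfR_continuous.
- exact: nR_continuous.
- by move=> q; exact: (smooth_continuous (smooth_wR f phi_gt0 de)).
- exact: aR_ge0.
- exact: phi_gt0.
- exact: PfR_ge0.
- by move=> q; exact: (addr_ge0 (nER_ge0 f phi q) (nDR_ge0 f q)).
- exact: w0.
- move=> q; exact: (divV_ge f_real phi_real Zphi Tphi pde phi_gt0 de0 q).
- move=> q; have := V_bound f_real phi_real q => hV.
  have -> : \sum_a sq ((weight f phi_gt0 de * Vv Z Zb T cj I f phi a) q) =
    wR f phi de q ^+ 2 * \sum_a sq (Vv Z Zb T cj I f phi a q).
    by rewrite mulr_sumr; apply: eq_bigr => a _; rewrite smM sqW.
  by rewrite ler_wpM2l ?sqr_ge0.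
- move=> q e e0; exact: (divh_ge hn f_real phi_real Zphi pde phi_gt0 de0 de1 q e0).
- move=> q; have hh := h_bound hn f_real phi_real phi_gt0 q.
  have -> : \sum_a sq ((weight f phi_gt0 de * test_fun f phi * fz Z f a) q) =
    wR f phi de q ^+ 2 * (sq (test_fun f phi q) * aR f q).
    rewrite /aR !mulr_sumr; apply: eq_bigr => a _.
    have e (x y z : sm) : (x * y * z) q = x q * (y q * z q) by rewrite mulrA.
    by rewrite (congr1 (@sq R) (e _ _ _)) sqW sqM.
  by rewrite ler_wpM2l ?sqr_ge0// ler_wpM2r ?aR_ge0.
- by [].
- by move=> q; exact: (smooth_continuous (smooth_powR _ phi_gt0 (smooth_phR phi))).
Qed.

Lemma tensors_eq0 : [/\ forall a b, Dt Z f a b = 0,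
  forall a b, Et Z Zb T cj I f phi a b = 0 & forall a, Gv Z T cj I f phi a = 0].
Proof.
have d1 : 0 < 1 - 2 * de by rewrite subr_gt0 mulrC -ltr_pdivlMr ?ltr0n// mul1r.
have h p : [/\ nER f phi p = 0, nDR f p = 0 & PfR f phi p = 0].
  have := NR_eq0 p; rewrite /NR.
  have := PfR_ge0 f phi p; have := nER_ge0 f phi p; have := nDR_ge0 f p.
  have : 0 < phR phi p := phi_gt0 p.
  move: (phR phi p) (nER f phi p) (nDR f p) (PfR f phi p) => x y z t x0 z0 y0 t0 /eqP.
  have d1t : 0 <= (1 - 2 * de) * t by rewrite mulr_ge0// ltW.
  have xyz : 0 <= x * (y + z) by apply: mulr_ge0; [exact: ltW|exact: addr_ge0].
  rewrite paddr_eq0// !mulf_eq0 (gt_eqF d1) (gt_eqF x0) /= paddr_eq0//.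
  by move=> /andP[/andP[/eqP-> /eqP->] /eqP->].
have sum0 (F : 'I_n -> R) : (forall a, 0 <= F a) -> \sum_a F a = 0 -> forall a, F a = 0.
  move=> F0 /eqP; rewrite psumr_eq0// => /allP S a.
  by apply/eqP/S; rewrite mem_index_enum.
have sum00 (F : 'I_n -> 'I_n -> R[i]) : \sum_a \sum_b sq (F a b) = 0 -> forall a b, F a b = 0.
  move=> /sum0 S a b; apply: sq_eq0.
  have S' : \sum_b sq (F a b) = 0.
    by apply: S => c; apply: sumr_ge0 => d _; exact: sq_ge0.
  by apply: (sum0 _ _ S') => c; exact: sq_ge0.
split=> [a b|a b|a]; apply: smP => p; have [hE hD hP] := h p.
- exact: (sum00 _ hD).
- exact: (sum00 _ hE).
exact: (Pf_eq0 (sum0 _ (fun a => Pf_ge0 _ _ _) hP a)).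
Qed.

End vanishing.

Lemma modc_sq (R : realType) (z : R[i]) : modc z ^+ 2 = sq z.
Proof. by case: z => a b; rewrite /modc /sq /= sqr_sqrtr// addr_ge0 ?sqr_ge0. Qed.

Lemma ball_int_le_integral (R : realType) n r (h : heis R n -> R) (K : R) : 0 < r -> continuous h ->
  (\int[heis_measure R n]_(p in koranyi_ball r) (h p)%:E <= K%:E)%E -> ball_int r h <= K.
Proof.
move=> r0 ch; rewrite koranyi_ballE// => hK.
rewrite -lee_fin /ball_int /Rintegral fineK//.
by apply: integrable_fin_num; [exact: ball_measurable|exact: ball_int_integrable].
Qed.

Unset Implicit Arguments.
Theorem theorem1p4 (R : realType) (n : nat) (hn : (2 <= n)%N)
    (u : heis R n -> R) (u_smooth : smooth u) (u_gt0 : forall p, 0 < u p)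
    (u_sol : forall p,
      4 * sublaplacian u p = n%:R ^+ 2 * u p `^ ((n%:R + 2) / n%:R))
    (hint : exists C q : R,
      [/\ 0 < C,
          (2 * n%:R + 1) / n%:R < q,
          q <= (2 * n%:R + 2) / n%:R &
          forall r : R, 1 < r ->
            (\int[heis_measure R n]_(p in koranyi_ball r) (u p `^ q)%:E
               <= (C * r ^+ 2)%:E)%E]) :
  exists (mu : 'rV[R[i]]_n) (lambda : R[i]),
    norm2 mu < 4 * complex.Im lambda /\
    forall p : heis R n,
      u p = (4 * complex.Im lambda - norm2 mu) `^ (n%:R / 2) /
            modc ((tcoord p)%:C + 'i%C * (norm2 (zcoord p))%:C
                  + bilin mu (zcoord p) + lambda) ^+ n.
Proof.
have n0 : (0 < n)%N := leq_trans (isT : (0 < 2)%N) hn.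
have nR : 0 < n%:R :> R by rewrite ltr0n.
have [C [q [_ q1 q2 hq]]] := hint.
pose f := fS u_smooth u_gt0; pose phi := phiS u_smooth u_gt0.
have phE p : complex.Re (phi p) = 4^-1 * u p `^ (2 / n%:R) by [].
have phi_gt0 p : 0 < complex.Re (phi p).
  by rewrite phE mulr_gt0 ?invr_gt0// powR_gt0.
(* The bounds on q are exactly 0 <= de < 1/2, and (2/n)(n+1-de) = q makes phi^(n+1-de) a constant
   multiple of u^q. *)
pose de := (2 * n%:R + 2 - n%:R * q) / 2.
have nq1 : 2 * n%:R + 1 < n%:R * q by move: q1; rewrite ltr_pdivrMr// [q * _]mulrC.
have nq2 : n%:R * q <= 2 * n%:R + 2 by move: q2; rewrite ler_pdivlMr// [q * _]mulrC.
have de0 : 0 <= de by rewrite divr_ge0// subr_ge0.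
have de1 : de < 2^-1 by rewrite -[X in _ < X]mul1r ltr_pM2r ?invr_gt0//; lra.
have growth r : 1 < r -> ball_int r (fun p => phR phi p `^ (n%:R + 1 - de)) <= C * r ^+ 2.
  move=> r1; have r0 : 0 < r by apply: lt_trans r1.
  have cu : continuous (fun p => u p `^ q).
    by move=> p; exact: (smooth_continuous (smooth_powR q u_gt0 u_smooth)).
  apply: le_trans (ball_int_le_integral r0 cu (hq r r1)).
  apply: ball_int_le => //.
    by move=> p; exact: (smooth_continuous (smooth_powR _ phi_gt0 (smooth_phR phi))).
  move=> p _; rewrite -[phR phi p]/(4^-1 * u p `^ (2 / n%:R)) powRM ?powR_ge0 ?invr_ge0//.
  rewrite -powRrM.
  have -> : 2 / n%:R * (n%:R + 1 - de) = q.
    by rewrite /de; field; rewrite gt_eqF.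
  (* That constant is (1/4)^(n+1-de), at most 1. *)
  rewrite ler_piMl ?powR_ge0//.
  have s0 : 0 <= n%:R + 1 - de by have : 2^-1 <= 1 :> R; [rewrite invf_le1// ler1n|lra].
  apply: (@le_trans _ _ (1 `^ (n%:R + 1 - de))); last by rewrite powR1.
  by apply: ge0_ler_powR; rewrite ?nnegrE ?invr_ge0// invf_le1// ler1n.
have fr := fS_real u_smooth u_gt0; have pr := phiS_real u_smooth u_gt0.
have Zp := ZZ_phiS u_smooth u_gt0 n0; have Tp := TT_phiS u_smooth u_gt0 n0.
have pde := pde_sm u_smooth u_gt0 n0 u_sol.
have [D0 E0 G0] := tensors_eq0 hn fr pr Zp Tp pde phi_gt0 de0 de1 growth.
have [mu [lam rig]] := rigid n0 fr pr Zp phi_gt0 D0 E0 G0.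
pose M := \row_a mu a.
have nM : norm2 M = \sum_a sq (mu a).
  by apply: eq_bigr => a _; rewrite mxE modc_sq.
pose K := 4 * complex.Im lam - norm2 M.
(* Four times the identity of [rigid], which clears the factor 1/4 in phi. *)
have uK p : u p `^ (2 / n%:R) * sq (wfun mu lam p) = K.
  have [e _] := rig p; move: e; rewrite phE /K nM; lra.
have s_gt0 p : 0 < sq (wfun mu lam p).
  have [_ w0] := rig p; rewrite lt_neqAle sq_ge0 andbT eq_sym.
  by apply/eqP => /sq_eq0 e; move: w0; rewrite e eqxx.
(* Positivity of u gives the strict inequality between mu and lambda. *)
have K0 : 0 < K by rewrite -(uK 0) mulr_gt0// powR_gt0.
exists M, lam; split; first by rewrite -subr_gt0.
move=> p.
have -> : (tcoord p)%:C + 'i%C * (norm2 (zcoord p))%:C + bilin M (zcoord p) + lam = wfun mu lam p.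
  rewrite norm2E /wfun /bilin; congr (_ + _ + _ + _).
  by apply: eq_bigr => a _; rewrite mxE.
rewrite -/K; have s0 := s_gt0 p.
have -> : modc (wfun mu lam p) ^+ n = sq (wfun mu lam p) `^ (n%:R / 2).
  have m0 : 0 <= modc (wfun mu lam p) by case: (wfun _ _ _) => x y; exact: sqrtr_ge0.
  rewrite -modc_sq -powR_mulrn// -[_ ^+ 2]powR_mulrn// -powRrM; congr (_ `^ _).
  by field.
rewrite -(uK p) powRM ?powR_ge0 ?sq_ge0// mulfK; last by rewrite gt_eqF// powR_gt0.
rewrite -powRrM -[LHS](powRr1 (ltW (u_gt0 p))); congr (_ `^ _).
by field; rewrite gt_eqF.
Qed.
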